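(* Let $\Omega\subset\mathbb{C}$ be a simply connected domain with non-empty boundary, let $\alpha_0\in(-2,0)$, suppose that the Inverse Brennan's Conjecture holds for the interval $[\alpha_0,2/3)$, and let $p\in\bigl(\frac{|\alpha_0|+2}{|\alpha_0|+1},2\bigr)$. Let $\varphi:\Omega\to\mathbb{D}$ be a conformal homeomorphism of $\Omega$ onto the unit disc and let $h(z)=J(z,\varphi)=|\varphi'(z)|^2$. Then the embedding operator $$j_r:\overset{\circ}{W_p^1}(\Omega)\hookrightarrow L_r(\Omega,h),\qquad j_r(f)=f,$$ is compact for every $r$ such that $$1\le r<\frac{2p}{2-p}\cdot\frac{|\alpha_0|}{2+|\alpha_0|}<\frac{p}{2-p}.$$
   Context: $\mu$ is Lebesgue measure on $\mathbb{C}\cong\mathbb{R}^2$; $\mathbb{D}$ is the open unit disc. Functions are real-valued. ''The Inverse Brennan's Conjecture holds for the interval $[\alpha_0,2/3)$'' means: for every conformal homeomorphism $\psi$ of $\mathbb{D}$ onto a simply connected plane domain with non-empty boundary, $\int_{\mathbb{D}}|\psi'(w)|^{\alpha}\,d\mu<+\infty$ for all $\alpha\in[\alpha_0,2/3)$. $J(z,\varphi)$ is the Jacobian of $\varphi$ at $z$; $h$ is called the conformal weight. $L_r(\Omega,h)$ is the weighted Lebesgue space with norm $\|f\mid L_r(\Omega,h)\|=\bigl(\int_\Omega|f(z)|^r h(z)\,d\mu\bigr)^{1/r}$. For $1\le p<\infty$, $W_p^1(\Omega)$ is the space of locally integrable weakly differentiable functions $f:\Omega\to\mathbb{R}$ with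 finite norm $\|f\mid W_p^1(\Omega)\|=\bigl(\int_\Omega|f|^p\,d\mu\bigr)^{1/p}+\bigl(\int_\Omega|\nabla f|^p\,d\mu\bigr)^{1/p}$, and $\overset{\circ}{W_p^1}(\Omega)$ is the closure of $C_0^\infty(\Omega)$ in $W_p^1(\Omega)$. *)

(* Defs.v *)
From mathcomp Require Import all_boot all_order all_algebra.
From mathcomp Require Import complex.
From mathcomp Require Import all_classical all_reals all_analysis.

Set Implicit Arguments.
Unset Strict Implicit.
Unset Printing Implicit Defensive.
Import Order.TTheory GRing.Theory Num.Theory.
Import numFieldNormedType.Exports.
Local Open Scope classical_set_scope.
Local Open Scope ring_scope.

(* The plane C = R^2 is the type [R * R]: it carries the product topology and
   Lebesgue measure.  The field [R[i]] is only used for complex derivatives and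
   for the modulus. *)

Definition toC (R : realType) (z : R * R) : R[i] := complex.Complex z.1 z.2.
Definition ofC (R : realType) (w : R[i]) : R * R := (complex.Re w, complex.Im w).

(* [R[i]^o] is [R[i]] seen as a normed module over itself: derivability below is
   complex differentiability, with complex increments. *)
Definition complexify (R : realType) (phi : R * R -> R * R) : R[i]^o -> R[i]^o :=
  fun w => toC (phi (ofC w)).

Definition cderivable (R : realType) (phi : R * R -> R * R) (z : R * R) : Prop :=
  derivable (complexify phi) (toC z) 1.

Definition cderiv (R : realType) (phi : R * R -> R * R) (z : R * R) : R[i] :=
  'D_1 (complexify phi) (toC z).

Definition modulus (R : realType) (w : R[i]) : R := ComplexField.Normc.normc w.

Definition e1 (R : realType) : R * R := (1, 0).
Definition e2 (R : realType) : R * R := (0, 1).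

Definition jacobian_det (R : realType) (phi : R * R -> R * R) (z : R * R) : R :=
  ('D_(e1 R) phi z).1 * ('D_(e2 R) phi z).2
  - ('D_(e1 R) phi z).2 * ('D_(e2 R) phi z).1.

Lemma ofC_cvg (R : realType) (F : set_system R) {FF : Filter F} (f : R -> R[i]^o) (d : R[i]^o) :
  f @ F --> d -> (fun t => ofC (f t)) @ F --> ofC d.
Proof.
move=> /cvgrPdist_lt fd.
have h1 : (fun t => complex.Re (f t)) @ F --> (complex.Re d : R).
  apply/cvgrPdist_lt => e e0.
  have := fd (e%:C)%C; rewrite ltcR => /(_ e0); apply: filterS => t /=.
  rewrite normc_def ltcR; apply: le_lt_trans.
  move: (f t) => -[a b]; case: (d) => a' b' /=.
  by rewrite -sqrtr_sqr ler_wsqrtr// lerDl sqr_ge0.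
have h2 : (fun t => complex.Im (f t)) @ F --> (complex.Im d : R).
  apply/cvgrPdist_lt => e e0.
  have := fd (e%:C)%C; rewrite ltcR => /(_ e0); apply: filterS => t /=.
  rewrite normc_def ltcR; apply: le_lt_trans.
  move: (f t) => -[a b]; case: (d) => a' b' /=.
  by rewrite -sqrtr_sqr ler_wsqrtr// lerDr sqr_ge0.
exact: cvg_pair h1 h2.
Qed.

Lemma derive_eq_lim (R : numFieldType) (V W : normedModType R) (f : V -> W) a v l :
  h^-1 *: (f (h *: v + a) - f a) @[h --> 0^'] --> l -> 'D_v f a = l.
Proof. by move=> fl; apply: cvg_lim => //; exact: norm_hausdorff. Qed.

Lemma partial_cderiv (R : realType) (phi : R * R -> R * R) (z : R * R) (v : R[i]) :
  v != 0 -> cderivable phi z -> 'D_(ofC v) phi z = ofC (v * cderiv phi z).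
Proof.
move=> v0 /cvg_ex[/= d dP].
have -> : cderiv phi z = d by apply: (@cvg_lim R[i]^o) dP; exact: norm_hausdorff.
apply: derive_eq_lim.
have H : (fun t : R => (t%:C)%C * v : R[i]^o) @ (0:R)^' --> ((0 : R[i]^o)^').
  move=> A /=. rewrite /dnbhs /within /= => /nbhs_ballP[e /= e0 eA].
  have [r r0 re] : exists2 r : R, 0 < r & r%:C%C * `|v| = e.
    exists (complex.Re (e / `|v|)).
      have : 0 < e / `|v| by rewrite divr_gt0// normr_gt0.
      by case: (e / `|v|) => a b; rewrite ltcE /= => /andP[].
    have : e / `|v| \is Num.real by rewrite gtr0_real// divr_gt0// normr_gt0.
    move=> /RRe_real ->. by rewrite divfK// normr_eq0.
  suff : \forall t \near (0 : R), t != 0 -> A ((t%:C)%C * v) by [].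
  near=> t => t0; apply: eA; last by rewrite mulf_neq0// (inj_eq (@complexI _)).
  rewrite /ball /= sub0r normrN normrM -re ltr_pM2r ?normr_gt0//.
  rewrite normc_def/= expr0n/= addr0 sqrtr_sqr ltcR.
  near: t; exists r => //= t; rewrite /ball/= sub0r normrN; exact.
have {}dP := cvg_comp _ _ H dP.
have : (fun t : R => ofC (v * (((t%:C)%C * v)^-1 *: (complexify phi (((t%:C)%C * v) *: 1 + toC z) - complexify phi (toC z))) : R[i]^o)) @ 0^' --> ofC (v * d).
  apply: ofC_cvg.
  apply: (@cvgM R[i] R (0^') _ (fun=> v) _ v d); [exact: cvg_cst|exact: dP].
apply: cvg_trans; apply: near_eq_cvg; near=> t.
have t0 : t != 0 by near: t; exact: nbhs_dnbhs_neq.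
rewrite /= [_ *: 1]mulr1.
have -> : v * (((t%:C)%C * v)^-1 *: (complexify phi ((t%:C)%C * v + toC z) - complexify phi (toC z))) =  ((t^-1)%:C)%C * (complexify phi ((t%:C)%C * v + toC z) - complexify phi (toC z)).
  rewrite /GRing.scale/= fmorphV mulrA; congr (_ * _).
  by rewrite invfM mulrCA mulfV ?mulr1.
rewrite /complexify.
have -> : ofC ((t%:C)%C * v + toC z) = t *: ofC v + z.
  by case: (v) => a b; case: (z) => x y; congr pair; rewrite /= mul0r ?addr0 ?subr0.
have -> : ofC (toC z) = z by case: (z).
case: (phi _) => a b; case: (phi _) => a' b'; congr pair; rewrite /= mul0r ?addr0 ?subr0//.
Unshelve. all: by end_near. Qed.

Lemma jacobian_detE (R : realType) (phi : R * R -> R * R) (z : R * R) :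
  cderivable phi z -> jacobian_det phi z = modulus (cderiv phi z) ^+ 2.
Proof.
move=> dphi; rewrite /jacobian_det /modulus.
have -> : e1 R = ofC 1 by [].
have -> : e2 R = ofC 'i%C by [].
rewrite !partial_cderiv ?oner_neq0//; last by rewrite eq_complex /= oner_eq0 andbF.
case: (cderiv phi z) => a b /=.
rewrite sqr_sqrtr ?addr_ge0 ?sqr_ge0// !(mul0r, mul1r, add0r, addr0, subr0, sub0r).
by rewrite mulrN opprK !expr2.
Qed.

Definition unit_disc (R : realType) : set (R * R) :=
  [set z | modulus (toC z) < 1].
Arguments unit_disc : clear implicits.

Definition boundary (T : topologicalType) (A : set T) : set T :=
  closure A `\` interior A.

Definition domain (R : realType) (Omega : set (R * R)) : Prop :=
  [/\ open Omega, connected Omega & Omega !=set0].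

(* Every loop is homotopic in Omega, relative to its endpoints, to a constant
   loop.  Path-connectedness is part of [domain]: open connected plane sets. *)
Definition simply_connected (R : realType) (Omega : set (R * R)) : Prop :=
  forall gamma : R -> R * R,
    {within `[0, 1], continuous gamma} ->
    (forall t, t \in `[0, 1] -> Omega (gamma t)) ->
    gamma 0 = gamma 1 ->
    exists H : R * R -> R * R,
      [/\ {within `[0, 1] `*` `[0, 1], continuous H},
          (forall s t, s \in `[0, 1] -> t \in `[0, 1] -> Omega (H (s, t))),
          (forall t, t \in `[0, 1] -> H (0, t) = gamma t),
          (forall t, t \in `[0, 1] -> H (1, t) = gamma 0) &
          (forall s, s \in `[0, 1] -> H (s, 0) = gamma 0 /\ H (s, 1) = gamma 0)].

Definition conformal_homeomorphism (R : realType) (A B : set (R * R))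
    (phi : R * R -> R * R) : Prop :=
  [/\ set_bij A B phi,
      {within A, continuous phi},
      (exists psi : R * R -> R * R,
         {within B, continuous psi} /\ {in A, cancel phi psi}),
      (forall z, A z -> cderivable phi z) &
      (forall z, A z -> cderiv phi z != 0)].

(* Lebesgue measure on the Borel sets of the plane. *)
Definition mu2 (R : realType)
    : {measure set (measurableTypeR R * measurableTypeR R) -> \bar R} :=
  (@lebesgue_measure R \x @lebesgue_measure R)%E.
Arguments mu2 : clear implicits.

Definition inverse_brennan (R : realType) (alpha0 : R) : Prop :=
  forall (Omega : set (R * R)) (psi : R * R -> R * R),
    domain Omega -> simply_connected Omega -> boundary Omega !=set0 ->
    conformal_homeomorphism (unit_disc R) Omega psi ->
    forall alpha : R, alpha0 <= alpha < 2 / 3 ->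
      (\int[mu2 R]_(w in unit_disc R) (modulus (cderiv psi w) `^ alpha)%:E
         < +oo)%E.

Definition partials (R : realType) (s : seq bool) (eta : R * R -> R)
    : R * R -> R :=
  foldr (fun (b : bool) (g : R * R -> R) => 'D_(if b then e2 R else e1 R) g)
    eta s.

Definition smooth (R : realType) (eta : R * R -> R) : Prop :=
  forall s : seq bool, continuous (partials s eta) /\
    forall z, derivable (partials s eta) z (e1 R) /\
              derivable (partials s eta) z (e2 R).

Definition test_function (R : realType) (Omega : set (R * R))
    (eta : R * R -> R) : Prop :=
  [/\ smooth eta, compact (closure [set z | eta z != 0]) &
      closure [set z | eta z != 0] `<=` Omega].

Definition loc_integrable (R : realType) (Omega : set (R * R))
    (f : R * R -> R) : Prop :=
  measurable_fun Omega f /\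
  forall K : set (R * R), compact K -> K `<=` Omega ->
    (\int[mu2 R]_(z in K) `|f z|%:E < +oo)%E.

Definition weak_gradient (R : realType) (Omega : set (R * R))
    (f : R * R -> R) (g : R * R -> R * R) : Prop :=
  [/\ loc_integrable Omega (fun z => (g z).1),
      loc_integrable Omega (fun z => (g z).2) &
      forall eta, test_function Omega eta ->
        (\int[mu2 R]_(z in Omega) (f z * 'D_(e1 R) eta z)%:E
           = - \int[mu2 R]_(z in Omega) ((g z).1 * eta z)%:E)%E /\
        (\int[mu2 R]_(z in Omega) (f z * 'D_(e2 R) eta z)%:E
           = - \int[mu2 R]_(z in Omega) ((g z).2 * eta z)%:E)%E].

(* A chosen weak gradient; it is unique almost everywhere when it exists, so
   the norms below do not depend on the choice. *)
Definition wgrad (R : realType) (Omega : set (R * R)) (f : R * R -> R)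
    : R * R -> R * R :=
  xget (fun=> (0, 0)) [set g | weak_gradient Omega f g].

Definition grad_norm (R : realType) (Omega : set (R * R)) (f : R * R -> R)
    (z : R * R) : R :=
  Num.sqrt ((wgrad Omega f z).1 ^+ 2 + (wgrad Omega f z).2 ^+ 2).

(* Functions are represented by maps on the whole plane of which only the values
   on Omega are used, and are not quotiented by a.e. equality; the
   norms are thus seminorms, whose quotients are the usual normed spaces. *)
Record function_space (R : realType) := FunctionSpace {
  elements : set (R * R -> R);
  norm_of : (R * R -> R) -> \bar R }.

Definition L_norm (R : realType) (Omega : set (R * R)) (r : R)
    (h f : R * R -> R) : \bar R :=
  ((\int[mu2 R]_(z in Omega) (`|f z| `^ r * h z)%:E) `^ r^-1)%E.

Definition weighted_L (R : realType) (r : R) (Omega : set (R * R))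
    (h : R * R -> R) : function_space R :=
  FunctionSpace
    [set f : R * R -> R |
      measurable_fun Omega f /\ (L_norm Omega r h f < +oo)%E]
    (L_norm Omega r h).

Definition W1_norm (R : realType) (p : R) (Omega : set (R * R))
    (f : R * R -> R) : \bar R :=
  (L_norm Omega p (cst 1%R) f + L_norm Omega p (cst 1%R) (grad_norm Omega f))%E.

Definition W1 (R : realType) (p : R) (Omega : set (R * R)) : function_space R :=
  FunctionSpace
    [set f | [/\ loc_integrable Omega f,
                 (exists g, weak_gradient Omega f g) &
                 (W1_norm p Omega f < +oo)%E]]
    (W1_norm p Omega).

Definition W1_0 (R : realType) (p : R) (Omega : set (R * R))
    : function_space R :=
  FunctionSpace
    [set f | elements (W1 p Omega) f /\
       forall eps : R, 0 < eps -> exists eta, test_function Omega eta /\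
         (W1_norm p Omega (f \- eta)%R < eps%:E)%E]
    (W1_norm p Omega).

Definition bounded_in (R : realType) (X : function_space R)
    (B : set (R * R -> R)) : Prop :=
  B `<=` elements X /\ exists M : R, forall f, B f -> (norm_of X f <= M%:E)%E.

Definition relatively_compact_in (R : realType) (Y : function_space R)
    (B : set (R * R -> R)) : Prop :=
  forall u : nat -> R * R -> R, (forall n, B (u n)) ->
    exists (k : nat -> nat) (g : R * R -> R),
      [/\ {homo k : m n / (m < n)%N}, elements Y g &
          (fun n => norm_of Y (u (k n) \- g)%R) @ \oo --> (0 : \bar R)%E].

Definition compact_operator (R : realType) (X Y : function_space R)
    (T : (R * R -> R) -> (R * R -> R)) : Prop :=
  [/\ forall f, elements X f -> elements Y (T f),
      forall (a : R) f g, T (a *: f + g) = a *: T f + T g &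
      forall B, bounded_in X B -> relatively_compact_in Y (T @` B)].

(* Main.v *)
Require Import Defs.
From mathcomp Require Import all_boot all_order all_algebra.
From mathcomp Require Import complex.
From mathcomp Require Import all_classical all_reals all_analysis.
From mathcomp Require Import ring lra.
From mathcomp Require Import measurable_realfun.
Import Order.TTheory GRing.Theory Num.Theory.
Import numFieldNormedType.Exports.
Local Open Scope classical_set_scope.
Local Open Scope ring_scope.
Set Implicit Arguments.
Unset Strict Implicit.
Unset Printing Implicit Defensive.

(** Write a = |alpha0|, q = 2p/(2-p), s = q/(q-r) and psi for the inverse of phi.
    Two facts are combined.

    The first is that a weight h >= 0 on an open set Omega, with h^s integrable
    over Omega, makes W_p^1 with zero boundary values embed compactly into
    L_r(Omega, h) for 1 < p < 2 and 1 <= r < q ([compact_embedding]).  A bounded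
    sequence of that space is replaced by test functions eta_n, close to it in L_p,
    whose gradients stay bounded in L_p ([approx_test]).  By Sobolev's inequality
    ([sobolev]) the eta_n are bounded in L_q; by Rellich's argument, Poincare's
    inequality on the cells of a fine grid ([poincare_cell], [rellich_ae]), a
    subsequence converges almost everywhere.  In Young's inequality
    |u|^r h <= e |u|^q + C_e h^s the first term is uniformly small because the
    L_q norms are bounded, and the second is an integrable dominating function;
    hence the integrals of |u_n - g|^r h tend to 0 ([weighted_cvg]).

    The second is that h = |phi'|^2 satisfies this condition
    ([jacobian_pow_integrable]).  Formally, the change of variables w = phi(z)
    turns the integral of |phi'|^(2s) over Omega into that of |psi'|^(2-2s) over
    the disc, which is finite when alpha0 <= 2-2s < 2/3.  Only an inequality up to
    a constant is required, and it follows from the fact that an L-Lipschitz map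
    multiplies areas by at most 4 L^2 (distances being taken in the sup norm):
    since psi is nearly M-Lipschitz where |psi'| < M, the set where |phi'| > 1/M
    has area at most 16 M^2 times that of the set where |psi'| <= 4M
    ([distortion]).  Summing these estimates over the levels 1/M = 2^k gives the
    inequality between the integrals ([level_sum]).

    The two meet in the exponents: r < q a / (2+a) is equivalent to
    2s - 2 < a, that is to alpha0 < 2-2s. *)

(** * Borel sets and rectangles of the plane *)

Section plane_measurability.
Variable R : realType.
Implicit Types A D : set (R * R).

(** The Borel sets of the plane are generated by rectangles, so an open set is
    written as a countable union of squares with rational centres. *)
Lemma open_measurable_plane A : open A -> measurable A.
Proof.
move=> oA.
pose box (q q' : rat) (n : nat) : set (R * R) :=
  `]ratr q - n.+1%:R^-1, ratr q + n.+1%:R^-1[%classic `*`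
  `]ratr q' - n.+1%:R^-1, ratr q' + n.+1%:R^-1[%classic.
pose B (q q' : rat) (n : nat) := if `[< box q q' n `<=` A >] then box q q' n else set0.
have -> : A = \bigcup_q \bigcup_q' \bigcup_n B q q' n.
  apply/seteqP; split => [[x y] Axy|z [q _ [q' _ [n _]]]]; last first.
    by rewrite /B; case: asboolP => // + Bz; apply.
  have /nbhs_ballP[e /= e0 eA] : nbhs (x, y) A by exact: open_nbhs_nbhs.
  have [n ne] : exists n : nat, n.+1%:R^-1 < e / 2.
    have [n] := ltr_add_invr (y := 0) (x := e / 2) ltac:(by rewrite divr_gt0).
    by rewrite add0r => ?; exists n.
  have n0 : (0 : R) < n.+1%:R^-1 by rewrite invr_gt0.
  have boxE q q' : box q q' n = `]ratr q - n.+1%:R^-1, ratr q + n.+1%:R^-1[%classic `*`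
     `]ratr q' - n.+1%:R^-1, ratr q' + n.+1%:R^-1[%classic by [].
  move: n.+1%:R^-1 ne n0 boxE => d ne d0 boxE.
  have [q] := @rat_in_itvoo R (x - d) (x + d) ltac:(lra).
  have [q'] := @rat_in_itvoo R (y - d) (y + d) ltac:(lra).
  rewrite !in_itv/= => /andP[h1 h2] /andP[h3 h4].
  exists q => //; exists q' => //; exists n => //.
  rewrite /B boxE; case: asboolP => [_|].
    by split; rewrite /= in_itv/=; lra.
  case => -[u v] [/=]; rewrite !in_itv/= => /andP[h5 h6] /andP[h7 h8].
  apply: eA; split => /=; rewrite /ball/= ltr_norml; apply/andP; split; lra.
apply: bigcupT_measurable_rat => q; apply: bigcupT_measurable_rat => q'.
apply: bigcupT_measurable => n; rewrite /B; case: asboolP => _ //.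
exact: measurableX.
Qed.

Lemma closed_measurable_plane A : closed A -> measurable A.
Proof. by move/closed_openC/open_measurable_plane/measurableC; rewrite setCK. Qed.

Lemma hausdorff_plane : hausdorff_space (R * R)%type.
Proof. exact: (@norm_hausdorff R (R * R)%type). Qed.

Lemma compact_measurable_plane A : compact A -> measurable A.
Proof.
by move/compact_closed => /(_ hausdorff_plane); exact: closed_measurable_plane.
Qed.

Lemma within_continuous_measurable D (f : R * R -> R) :
  measurable D -> {within D, continuous f} -> measurable_fun D f.
Proof.
move=> mD /continuousP cf; apply: (measurability _ (RGenOpens.measurableE R)).
move=> _ [_ [a [b ->] <-]].
have oab : open (`]a, b[%classic : set R) by exact: interval_open.
move: (cf _ oab) => /open_subspaceP[V oV VD].
by rewrite setIC -VD; apply: measurableI => //; exact: open_measurable_plane.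
Qed.

(** Measurability of a pair is available for functions on the whole plane, hence
    the detour through the extensions by zero of the two coordinates. *)
Lemma within_continuous_measurable_plane D (f : R * R -> R * R) :
  measurable D -> {within D, continuous f} -> measurable_fun D f.
Proof.
move=> mD cf.
have h1 : measurable_fun D (fst \o f).
  apply: within_continuous_measurable => // z.
  apply: (continuous_comp (cf z)); exact: cvg_fst.
have h2 : measurable_fun D (snd \o f).
  apply: within_continuous_measurable => // z.
  apply: (continuous_comp (cf z)); exact: cvg_snd.
move=> _ A mA.
have mg : measurable_fun setT (fun z => (((fst \o f) \_ D) z, ((snd \o f) \_ D) z)).
  by apply: measurable_fun_pair; apply/(measurable_restrictT _ mD).
rewrite (_ : D `&` _ = D `&` (fun z => (((fst \o f) \_ D) z, ((snd \o f) \_ D) z)) @^-1` A).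
  by apply: measurableI => //; rewrite -[X in measurable X]setTI; exact: mg.
apply/seteqP; split => z [Dz] /=; rewrite !patchE mem_set//=; by case: (f z).
Qed.

Lemma continuous_measurable_plane (f : R * R -> R) :
  continuous f -> measurable_fun setT f.
Proof.
move=> cf; apply: within_continuous_measurable => //.
exact: continuous_subspaceT.
Qed.

Lemma mu2_rect (A B : set R) : measurable A -> measurable B ->
  mu2 R (A `*` B) = (lebesgue_measure A * lebesgue_measure B)%E.
Proof. by move=> mA mB; rewrite /mu2/= product_measure1E. Qed.

Definition box (N : R) : set (R * R) := `[-N, N] `*` `[-N, N].

Lemma measurable_box N : measurable (box N).
Proof. exact: measurableX. Qed.

Lemma mu2_box N : 0 <= N -> mu2 R (box N) = ((2 * N) ^+ 2)%:E.
Proof.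
move=> N0; rewrite mu2_rect// lebesgue_measure_itv/= lte_fin.
case: ltP => h; last by (have -> : N = 0 by lra); rewrite mul0e mulr0 expr0n.
by rewrite -EFinD -EFinM; congr EFin; ring.
Qed.

Lemma bounded_plane_box A : compact A -> exists N : nat, A `<=` box N%:R.
Proof.
move=> /compact_bounded[M [_ /(_ (`|M| + 1))]] h.
exists (Num.truncn (`|M| + 1)).+1 => -[x y] /h.
rewrite (lt_le_trans (ltr_pwDr _ (ler_norm M)) (lexx _))// => /(_ isT); rewrite /= prod_normE/= ge_max => /andP[].
have := truncnS_gt (`|M| + 1); set n := _.+1 => k.
rewrite !ler_norml => /andP[? ?] /andP[? ?].
by split; rewrite /= in_itv/=; apply/andP; split; lra.
Qed.

End plane_measurability.

(** * Coordinate lines, the fundamental theorem of calculus and Tonelli *)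

Section plane_calculus.
Variable R : realType.
Implicit Types (f g : R * R -> R) (b : bool).

(** The two coordinates are treated together: [b] selects the direction of a
    partial derivative, and [put b s t] is the point whose coordinate along that
    direction is [s], the other one being [t]. *)
Definition dir b : R * R := if b then e2 R else e1 R.
Definition put b (s t : R) : R * R := if b then (t, s) else (s, t).
Definition moving b (z : R * R) : R := if b then z.2 else z.1.
Definition still b (z : R * R) : R := if b then z.1 else z.2.

Lemma putE b z : put b (moving b z) (still b z) = z.
Proof. by case: b z => -[]. Qed.

Lemma put_shift b h s t : h *: dir b + put b s t = put b (h + s) t.
Proof.
by case: b => /=; congr pair; rewrite /= ?[_ *: 0]mulr0 ?[_ *: 1]mulr1 ?add0r.
Qed.

Definition C1 f := continuous f /\
  forall b, (forall z, derivable f z (dir b)) /\ continuous ('D_(dir b) f).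

Lemma is_derive_line b f s t : derivable f (put b s t) (dir b) ->
  is_derive s (1:R) (fun s => f (put b s t)) ('D_(dir b) f (put b s t)).
Proof.
move=> df.
have E : (fun h : R => h^-1 *: ((f \o shift (put b s t)) (h *: dir b) - f (put b s t))) =
  (fun h : R => h^-1 *: (((fun s => f (put b s t)) \o shift s) (h *: 1) - f (put b s t))).
  by apply/funext => h /=; rewrite put_shift [_%:A]mulr1.
split; first by move: df; rewrite /derivable E.
by rewrite /derive E.
Qed.

Lemma continuous_put b t : continuous (fun s : R => put b s t).
Proof.
by move=> s; case: b; rewrite /put /=; apply: (@cvg_pair _ _ _ _ (nbhs _) (nbhs _)) => //=; exact: cvg_cst.
Qed.

Lemma continuous_line b f t : continuous f -> continuous (fun s => f (put b s t)).
Proof. by move=> cf s; apply: (@continuous_comp _ _ _ (fun s => put b s t) f); [exact: continuous_put|exact: cf]. Qed.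

Lemma FTC_C1 (u : R -> R) (a c : R) : a < c ->
  (forall x, derivable u x 1) -> continuous (derive1 u) ->
  (\int[@lebesgue_measure R]_(x in `[a, c]) (derive1 u x)%:E = (u c - u a)%:E)%E.
Proof.
move=> ac du cu; rewrite EFinB; apply: continuous_FTC2 => //.
  exact: continuous_subspaceT.
have cuu : continuous u by move=> x; exact/differentiable_continuous/derivable1_diffP.
split => //.
- by apply: cvg_at_right_filter; exact: cuu.
- by apply: cvg_at_left_filter; exact: cuu.
Qed.

Lemma FTC_le (u : R -> R) (a c : R) : a <= c ->
  (forall x, derivable u x 1) -> continuous (derive1 u) ->
  (`|u c - u a|%:E <= \int[@lebesgue_measure R]_(x in `[a, c]) `|derive1 u x|%:E)%E.
Proof.
rewrite le_eqVlt => /predU1P[->|ac] du cu.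
  by rewrite subrr normr0; apply: integral_ge0 => x _; rewrite lee_fin.
rewrite -abse_EFin -FTC_C1//; apply: (le_trans (le_abse_integral _ _ _)) => //.
by apply/measurable_EFinP/measurable_funTS; exact: continuous_measurable_fun.
Qed.

Lemma line_le b f t (a c : R) (I : interval R) : C1 f ->
  a \in I -> c \in I ->
  (`|f (put b c t) - f (put b a t)|%:E
     <= \int[@lebesgue_measure R]_(s in [set` I]) `|'D_(dir b) f (put b s t)|%:E)%E.
Proof.
move=> [cf /(_ b)[df cdf]].
wlog ac : a c / a <= c.
  by move=> h aI cI; have [/h|/ltW /h] := leP a c; [exact|rewrite distrC; exact].
move=> aI cI.
have dE s : derive1 (fun s => f (put b s t)) s = 'D_(dir b) f (put b s t).
  by rewrite derive1E; have [_ ->] := is_derive_line (df (put b s t)).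
apply: (@le_trans _ _ _ _ _ (@FTC_le (fun s => f (put b s t)) _ _ ac _ _)).
- by move=> x; have [] := is_derive_line (df (put b x t)).
- by rewrite (funext dE); exact: (@continuous_line b (fun z => (derive f z (dir b))) t cdf).
rewrite (funext dE : derive1 (fun s => f (put b s t)) = fun s => 'D_(dir b) f (put b s t)).
apply: ge0_subset_integral => //.
  apply/measurable_EFinP/measurable_funTS; apply: measurableT_comp => //.
  by apply: continuous_measurable_fun; exact: (@continuous_line b (fun z => derive f z (dir b)) t cdf).
move=> x /=; rewrite in_itv/=; exact: (interval_is_interval aI cI).
Qed.

Lemma tonelli b (F : R * R -> \bar R) : measurable_fun setT F -> (forall z, 0 <= F z)%E ->
  (\int[mu2 R]_z F z = \int[@lebesgue_measure R]_t \int[@lebesgue_measure R]_s F (put b s t))%E.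
Proof.
move=> mF F0; case: b => /=.
- by rewrite [LHS]fubini_tonelli1.
- by rewrite [LHS]fubini_tonelli2.
Qed.

Lemma measurable_put b t : measurable_fun setT (fun s : R => put b s t).
Proof. by case: b; apply: measurable_fun_pair. Qed.

Lemma measurable_tonelli b (F : R * R -> \bar R) : measurable_fun setT F -> (forall z, 0 <= F z)%E ->
  measurable_fun setT (fun t => \int[@lebesgue_measure R]_s F (put b s t))%E.
Proof.
move=> mF F0; case: b => /=.
- exact: measurable_fun_fubini_tonelli_F.
- exact: measurable_fun_fubini_tonelli_G.
Qed.

End plane_calculus.

(** * Algebra of smooth functions *)

Section smooth_functions.
Variable R : realType.
Implicit Types (f g v w : R * R -> R) (b : bool).

Lemma is_derive_lineP b f s t l :
  is_derive (put b s t) (dir R b) f l <-> is_derive s (1:R) (fun s => f (put b s t)) l.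
Proof.
have E : (fun h : R => h^-1 *: ((f \o shift (put b s t)) (h *: dir R b) - f (put b s t))) =
  (fun h : R => h^-1 *: (((fun s => f (put b s t)) \o shift s) (h *: 1) - f (put b s t))).
  by apply/funext => h /=; rewrite put_shift [_%:A]mulr1.
by split => -[d dl]; split; move: d dl; rewrite /derivable /derive E.
Qed.

Lemma is_derive_chain b f (F : R -> R) z l m :
  is_derive (f z) (1:R) F m -> is_derive z (dir R b) f l ->
  is_derive z (dir R b) (F \o f) (m * l).
Proof.
rewrite -(putE b z) => dF /is_derive_lineP df; apply/is_derive_lineP.
exact: is_derive1_comp.
Qed.

Lemma smooth_C1 f : smooth f -> C1 f.
Proof.
move=> sf; split; first exact: (sf [::]).1.
have [_ h] := sf [::].
move=> b; split; last exact: (proj1 (sf [:: b])).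
by move=> z; have [h1 h2] := h z; case: b; [exact: h2|exact: h1].
Qed.

Lemma smooth_derive b f : smooth f -> smooth ('D_(dir R b) f).
Proof.
move=> sf s; have -> : partials s ('D_(dir R b) f) = partials (rcons s b) f.
  by rewrite /partials foldr_rcons.
exact: sf.
Qed.

(** Smoothness speaks of all iterated partial derivatives at once; a class of C1
    functions that is stable under partial derivatives consists of smooth
    functions. *)
Lemma smooth_class (S : set (R * R -> R)) :
  (forall f, S f -> C1 f) -> (forall b f, S f -> S ('D_(dir R b) f)) ->
  forall f, S f -> smooth f.
Proof.
move=> SC SD f Sf s; have : S (partials s f) by elim: s => //= b s; exact: SD.
by move=> /SC[cs ds]; split => // z; split; [exact: (ds false).1|exact: (ds true).1].
Qed.

Lemma C1D f g : C1 f -> C1 g -> C1 (f + g).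
Proof.
move=> [cf df] [cg dg]; split; first by move=> z; apply: cvgD; [exact: cf|exact: cg].
move=> b; have [h1 h2] := df b; have [h3 h4] := dg b; split.
  by move=> z; exact: derivableD.
have -> : 'D_(dir R b) (f + g) = fun z => 'D_(dir R b) f z + 'D_(dir R b) g z.
  by apply/funext => z; rewrite deriveD.
by move=> z; apply: cvgD; [exact: h2|exact: h4].
Qed.

Lemma deriveD_fun b f g : C1 f -> C1 g ->
  'D_(dir R b) (f + g) = 'D_(dir R b) f + 'D_(dir R b) g.
Proof.
by move=> [_ df] [_ dg]; apply/funext => z; rewrite deriveD//; [exact: (df b).1|exact: (dg b).1].
Qed.

Lemma deriveM_fun b f g : C1 f -> C1 g ->
  'D_(dir R b) (f * g) = f * 'D_(dir R b) g + g * 'D_(dir R b) f.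
Proof.
by move=> [_ df] [_ dg]; apply/funext => z; rewrite deriveM//; [exact: (df b).1|exact: (dg b).1].
Qed.

Lemma C1M f g : C1 f -> C1 g -> C1 (f * g).
Proof.
move=> cf cg; split; first by move=> z; apply: cvgM; [exact: cf.1|exact: cg.1].
move=> b; split; first by move=> z; apply: derivableM; [exact: (cf.2 b).1|exact: (cg.2 b).1].
rewrite deriveM_fun// => z; apply: cvgD; apply: cvgM.
- exact: cf.1.
- exact: (cg.2 b).2.
- exact: cg.1.
- exact: (cf.2 b).2.
Qed.

Inductive sums (S : set (R * R -> R)) : (R * R -> R) -> Prop :=
| sums_in f : S f -> sums S f
| sums_add f g : sums S f -> sums S g -> sums S (f + g).

(** The partial derivatives of a product are sums of products.  Classes of
    products are stable only up to finite sums, which is enough. *)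
Lemma smooth_sums (S : set (R * R -> R)) :
  (forall f, S f -> C1 f) -> (forall b f, S f -> sums S ('D_(dir R b) f)) ->
  forall f, S f -> smooth f.
Proof.
move=> SC SD f Sf; apply: (@smooth_class (sums S)); last exact: sums_in.
- by move=> g; elim=> [h /SC//|h k _ Ch _ Ck]; exact: C1D.
- move=> b g Sg; have : C1 g /\ sums S ('D_(dir R b) g); last by case.
  elim: Sg => {g} [g Sg|g h _ [Cg Sg] _ [Ch Sh]]; first by split; [exact: SC|exact: SD].
  by split; [exact: C1D|rewrite deriveD_fun//; exact: sums_add].
Qed.

Lemma smoothM f g : smooth f -> smooth g -> smooth (f * g).
Proof.
move=> sf sg.
apply: (@smooth_sums [set h | exists f g, [/\ smooth f, smooth g & h = f * g]]).
- by move=> _ [f' [g' [sf' sg' ->]]]; apply: C1M; exact: smooth_C1.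
- move=> b _ [f' [g' [sf' sg' ->]]]; rewrite deriveM_fun; try exact: smooth_C1.
  apply: sums_add; apply: sums_in.
    exists f', ('D_(dir R b) g'); split; [exact: sf'|exact: smooth_derive|exact: erefl].
  exists g', ('D_(dir R b) f'); split; [exact: sg'|exact: smooth_derive|exact: erefl].
- by exists f, g; split; [exact: sf|exact: sg|exact: erefl].
Qed.

Lemma smooth_cst (c : R) : smooth (cst c : R * R -> R).
Proof.
have D b (k : R) : 'D_(dir R b) (cst k : R * R -> R) = cst 0.
  by apply/funext => z; rewrite derive_cst.
apply: (@smooth_class [set h | exists c, h = cst c]); last by exists c.
  move=> _ [k ->]; split; first exact: cst_continuous.
  move=> b; split => [z|]; first exact: derivable_cst.
  by rewrite D; exact: cst_continuous.
by move=> b _ [k ->]; exists 0; exact: D.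
Qed.

Lemma derive_sqrpow b v (e a : R) z : 0 < e -> C1 v ->
  is_derive z (dir R b) (fun z => (v z ^+ 2 + e) `^ a)
    ((v z ^+ 2 + e) `^ (a - 1) * ((2 * a) * v z * 'D_(dir R b) v z)).
Proof.
move=> e0 [_ /(_ b)[dv _]].
have p0 : 0 < v z ^+ 2 + e by rewrite ltr_wpDl// sqr_ge0.
have d1 : is_derive (v z) (1 : R) (fun y : R => y ^+ 2 + e) (2 * v z).
  apply: is_derive_eq. rewrite addr0 /GRing.scale /=. ring.
have d2 := @is_derive1_powR R a _ p0.
have d3 : is_derive (v z) (1 : R) (fun y : R => (y ^+ 2 + e) `^ a)
    (a * (v z ^+ 2 + e) `^ (a - 1) * (2 * v z)).
  exact: (is_derive1_comp (f := fun x : R => x `^ a) (g := fun y : R => y ^+ 2 + e)).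
have := @is_derive_chain b v (fun y => (y ^+ 2 + e) `^ a) z _ _ d3 (derivableP (dv z)).
by move=> /is_derive_eq; apply; ring.
Qed.

Lemma continuous_sqrpow v (e a : R) : 0 < e -> continuous v ->
  continuous (fun z => (v z ^+ 2 + e) `^ a).
Proof.
move=> e0 cv z.
have p0 : 0 < v z ^+ 2 + e by rewrite ltr_wpDl// sqr_ge0.
apply: (@continuous_comp _ _ _ (fun z => v z ^+ 2 + e) (fun x => x `^ a)).
  by apply: cvgD; [apply: cvgM; exact: cv|exact: cvg_cst].
have [/derivable1_diffP d _] := @is_derive1_powR R a _ p0.
exact: differentiable_continuous.
Qed.

(** The class of the functions (v^2+e)^a w, with a and w varying, is stable under
    partial derivatives up to sums; the regularization e > 0 keeps the base of the
    power away from 0. *)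
Lemma smooth_sqrpow v w (e a : R) : 0 < e -> smooth v -> smooth w ->
  smooth ((fun z => (v z ^+ 2 + e) `^ a) * w).
Proof.
move=> e0 sv sw.
have C1p a' : C1 (fun z => (v z ^+ 2 + e) `^ a').
  split; first by apply: continuous_sqrpow => //; exact: (smooth_C1 sv).1.
  move=> b; have D z := @derive_sqrpow b v e a' z e0 (smooth_C1 sv).
  split; first by move=> z; have [] := D z.
  have -> : 'D_(dir R b) (fun z => (v z ^+ 2 + e) `^ a') =
     fun z => ((v z ^+ 2 + e) `^ (a' - 1) * ((2 * a') * v z * 'D_(dir R b) v z)).
    by apply/funext => z; have [] := D z.
  move=> z; apply: cvgM.
    by apply: continuous_sqrpow => //; exact: (smooth_C1 sv).1.
  apply: cvgM; last exact: ((smooth_C1 sv).2 b).2.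
  by apply: cvgM; [exact: cvg_cst|exact: (smooth_C1 sv).1].
apply: (@smooth_sums [set h | exists a w, smooth w /\ h = (fun z => (v z ^+ 2 + e) `^ a) * w]).
- by move=> _ [a' [w' [sw' ->]]]; apply: C1M => //; exact: smooth_C1.
- move=> b _ [a' [w' [sw' ->]]]; rewrite deriveM_fun//; last exact: smooth_C1.
  apply: sums_add; apply: sums_in.
    exists a', ('D_(dir R b) w'); split; [exact: smooth_derive|exact: erefl].
  exists (a' - 1), (w' * (cst (2 * a') * v * 'D_(dir R b) v)); split.
    apply: smoothM; first exact: sw'.
    apply: smoothM; last exact: smooth_derive.
    by apply: smoothM; [exact: smooth_cst|exact: sv].
  apply/funext => z; have [_ E] := @derive_sqrpow b v e a' z e0 (smooth_C1 sv).
  change (w' z * 'D_(dir R b) (fun z => (v z ^+ 2 + e) `^ a') z =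
    (v z ^+ 2 + e) `^ (a' - 1) * (w' z * (2 * a' * v z * 'D_(dir R b) v z))).
  by rewrite E mulrCA.
- by exists a, w; split; [exact: sw|exact: erefl].
Qed.

End smooth_functions.

(** * Test functions *)

Section test_functions.
Variable R : realType.
Implicit Types (f g eta zeta : R * R -> R) (b : bool) (Om : set (R * R)).

Lemma test_sub Om eta zeta : test_function Om eta -> smooth zeta ->
  (forall z, ~ closure [set z | eta z != 0] z -> zeta z = 0) ->
  test_function Om zeta.
Proof.
move=> [_ cK KO] sz z0.
have sub : closure [set z | zeta z != 0] `<=` closure [set z | eta z != 0].
  rewrite [X in _ `<=` X]((closure_id _).1 (@closed_closure _ _)).
  apply: closure_subset => z /=; apply: contra_neqP; exact: z0.
split=> //; last exact: subset_trans KO.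
by apply: (subclosed_compact _ cK sub); exact: closed_closure.
Qed.

Lemma derive_near0 b f z : (\forall w \near z, f w = 0) -> 'D_(dir R b) f z = 0.
Proof.
move=> f0; by rewrite (@near_eq_derive _ _ _ _ (cst 0))//; exact: derive_cst.
Qed.

Lemma test_derive Om b eta : test_function Om eta -> test_function Om ('D_(dir R b) eta).
Proof.
move=> te; apply: (test_sub te); first by apply: smooth_derive; case: te.
move=> z nKz; apply: derive_near0.
have oK : open (~` closure [set z | eta z != 0]) by exact/closed_openC/closed_closure.
have := open_nbhs_nbhs (conj oK nKz); apply: filterS => w nKw.
by apply/eqP/negPn/negP => ew; apply: nKw; exact: subset_closure.
Qed.

Lemma test_off Om eta z : test_function Om eta -> ~ Om z -> eta z = 0.
Proof.
move=> [_ _ KO] nO; apply/eqP/negPn/negP => ez; apply: nO; apply: KO.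
exact: subset_closure.
Qed.

(** A quantitative form of compact support, convenient for cutting integrals off
    at a box. *)
Definition supported f := exists N : nat, forall z, ~ box N%:R z -> f z = 0.

Lemma test_supported Om eta : test_function Om eta -> supported eta.
Proof.
move=> [_ cK _]; have [N KN] := bounded_plane_box cK; exists N => z nN.
by apply/eqP/negPn/negP => ez; apply: nN; apply: KN; exact: subset_closure.
Qed.

Lemma closed_box (N : R) : closed (box N).
Proof.
have -> : box N = (fst @^-1` `[-N, N]) `&` (snd @^-1` `[-N, N]) :> set (R * R) by [].
apply: closedI; apply: closed_comp.
- by move=> z _; exact: cvg_fst.
- exact: interval_closed.
- by move=> z _; exact: cvg_snd.
- exact: interval_closed.
Qed.

Lemma compact_box (N : R) : compact (box N).
Proof. by apply: compact_setX; exact: segment_compact. Qed.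

Lemma supported_derive b f : supported f -> supported ('D_(dir R b) f).
Proof.
move=> [N f0]; exists N => z nN; apply: derive_near0.
have oK : open (~` box (N%:R : R)) by exact/closed_openC/closed_box.
by have := open_nbhs_nbhs (conj oK nN); apply: filterS => w; exact: f0.
Qed.

Lemma continuous_bounded_on f K : continuous f -> compact K ->
  exists2 M, 0 <= M & forall z, K z -> `|f z| <= M.
Proof.
move=> cf cK.
have /compact_bounded[M [_ /(_ (`|M| + 1))]] : compact (f @` K).
  by apply: continuous_compact => //; exact: continuous_subspaceT.
rewrite (lt_le_trans (ltr_pwDr _ (ler_norm M)) (lexx _))// => /(_ isT) h.
exists (`|M| + 1) => [|z Kz]; first by rewrite addr_ge0.
by apply: h; exists z.
Qed.

Lemma supported_bounded f : continuous f -> supported f ->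
  exists2 M, 0 <= M & forall z, `|f z| <= M.
Proof.
move=> cf [N f0]; have [M M0 h] := continuous_bounded_on cf (@compact_box N%:R).
exists M => // z; have [/h//|/f0 ->] := pselect (box N%:R z); by rewrite normr0.
Qed.

Local Open Scope ereal_scope.

Lemma integral_off (D : set (R * R)) (F : R * R -> \bar R) :
  (forall z, ~ D z -> F z = 0) -> \int[mu2 R]_(z in D) F z = \int[mu2 R]_z F z.
Proof.
move=> F0; rewrite integral_mkcond; congr integral; apply/funext => z.
by rewrite patchE; case: ifPn => // /negP; rewrite in_setE => /F0.
Qed.

Lemma ge0_integral_off (D E : set (R * R)) (F : R * R -> \bar R) :
  (forall z, D z -> ~ E z -> F z = 0) -> E `<=` D ->
  \int[mu2 R]_(z in D) F z = \int[mu2 R]_(z in E) F z.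
Proof.
move=> F0 ED; rewrite integral_mkcond [RHS]integral_mkcond.
congr integral; apply/funext => z; rewrite !patchE.
have [Ez|nEz] := pselect (E z); first by rewrite !mem_set//; exact: ED.
by rewrite (memNset nEz); case: ifPn => // /set_mem Dz; exact: F0.
Qed.

Lemma integrable_supported f : continuous f -> supported f ->
  (mu2 R).-integrable setT (EFin \o f).
Proof.
move=> cf sf; have [M M0 fM] := supported_bounded cf sf; case: sf => N f0.
apply/integrableP; split.
  by apply/measurable_EFinP; exact: continuous_measurable_plane.
rewrite -(@integral_off (box N%:R)); last by move=> z /f0 /= ->; rewrite normr0.
apply: (@le_lt_trans _ _ (\int[mu2 R]_(z in box N%:R) (cst M%:E z))).
  apply: ge0_le_integral => //.
  - exact: measurable_box.
  - apply/measurable_EFinP/measurable_funTS; apply: measurableT_comp => //.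
    exact: continuous_measurable_plane.
  - by move=> z _; rewrite lee_fin.
rewrite integral_cst//; last exact: measurable_box.
by rewrite [X in _ * X](mu2_box (ler0n _ N)) -EFinM ltry.
Qed.

(** On each line of direction [b] the fundamental theorem of calculus applies
    between two points at which f vanishes; then integrate over the lines. *)
Lemma integral_derive0 b f : C1 f -> supported f -> \int[mu2 R]_z ('D_(dir R b) f z)%:E = 0.
Proof.
move=> cf sf; have [df cdf] := cf.2 b.
have int := integrable_supported cdf (supported_derive b sf).
have [N f0] := supported_derive b sf; have [N' f0'] := sf.
pose a : R := (N + N').+1%:R.
have out (c : R) t : (a <= `|c|)%R -> f (put b c t) = 0%R /\ 'D_(dir R b) f (put b c t) = 0%R.
  move=> ac; have h (n : nat) : (n <= N + N')%N -> ~ box n%:R (put b c t).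
    rewrite -(ler_nat R) => nN; have : (n%:R < `|c|)%R.
      by apply: lt_le_trans ac; rewrite /a -addn1 natrD; lra.
    move=> nc; case: b {int f0 df cdf} => -[/=]; rewrite !in_itv/= -!ler_norml => h1 h2.
    by rewrite leNgt nc in h2.
    by rewrite leNgt nc in h1.
  by split; [apply/f0'/h/leq_addl|apply/f0/h/leq_addr].
have inner t : \int[@lebesgue_measure R]_s ('D_(dir R b) f (put b s t))%:E = 0.
  have -> : \int[@lebesgue_measure R]_s ('D_(dir R b) f (put b s t))%:E =
     \int[@lebesgue_measure R]_(s in `[(-a)%R, a]) ('D_(dir R b) f (put b s t))%:E.
    rewrite [RHS]integral_mkcond; congr integral; apply/funext => s.
    rewrite patchE; case: ifPn => // /negP; rewrite inE /= in_itv /= -ler_norml => /negP.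
    by rewrite -ltNge => /ltW/out -/(_ t)[_ ->].
  have dE s : derive1 (fun s => f (put b s t)) s = 'D_(dir R b) f (put b s t).
    by rewrite derive1E; have [_ ->] := is_derive_line (df (put b s t)).
  have a0 : (0 < a)%R by rewrite /a ltr0n.
  have := @FTC_C1 _ (fun s => f (put b s t)) (-a)%R a.
  rewrite (funext dE : derive1 (fun s => f (put b s t)) = fun s => 'D_(dir R b) f (put b s t)).
  move=> ->.
  - by rewrite (out a t _).1 ?(out (-a)%R t _).1 ?subrr// ?normrN ?gtr0_norm.
  - by lra.
  - by move=> x; have [] := is_derive_line (df (put b x t)).
  - exact: (@continuous_line _ b (fun z => derive f z (dir R b)) t cdf).
case: b int inner {out df cdf f0} => int inner.
- rewrite -integral12_prod_meas1//= /fubini_F /= -[RHS](@integral0 _ _ _ (@lebesgue_measure R) setT).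
  by apply: eq_integral => t _; exact: inner.
- rewrite -integral21_prod_meas1//= /fubini_G /= -[RHS](@integral0 _ _ _ (@lebesgue_measure R) setT).
  by apply: eq_integral => t _; exact: inner.
Qed.

End test_functions.

(** * Weak gradients and test functions *)

Section weak_gradients.
Variable R : realType.
Implicit Types (f eta zeta : R * R -> R) (g : R * R -> R * R) (b : bool) (Om : set (R * R)).

Local Open Scope ereal_scope.

Lemma weak_gradientP Om f g : weak_gradient Om f g <->
  (forall b, loc_integrable Om (fun z => moving b (g z))) /\
  (forall b eta, test_function Om eta ->
    \int[mu2 R]_(z in Om) (f z * 'D_(dir R b) eta z)%:E
      = - \int[mu2 R]_(z in Om) (moving b (g z) * eta z)%:E).
Proof.
split=> [[l1 l2 h]|[l h]]; first by split => -[] // eta /h [].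
split; [exact: (l false)|exact: (l true)|move=> eta te].
by split; [exact: (h false)|exact: (h true)].
Qed.

Lemma test_measurable Om eta D : test_function Om eta -> measurable_fun D eta.
Proof.
move=> [s _ _]; apply: measurable_funTS.
by apply: continuous_measurable_plane; exact: (smooth_C1 s).1.
Qed.

Lemma test_bounded Om eta : test_function Om eta ->
  exists2 M, (0 <= M)%R & forall z, (`|eta z| <= M)%R.
Proof.
move=> te; apply: supported_bounded; last exact: test_supported te.
by case: te => /smooth_C1[].
Qed.

Lemma loc_integrable_continuous Om f : continuous f -> loc_integrable Om f.
Proof.
move=> cf; split; first by apply: measurable_funTS; exact: continuous_measurable_plane.
move=> K cK KO; have [M M0 fM] := continuous_bounded_on cf cK.
have [N KN] := bounded_plane_box cK.
have mK := compact_measurable_plane cK.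
apply: (@le_lt_trans _ _ (\int[mu2 R]_(z in K) (cst M%:E z))).
  apply: ge0_le_integral => //.
  apply/measurable_EFinP/measurable_funTS; apply: measurableT_comp => //.
    exact: continuous_measurable_plane.
rewrite [X in X < _]integral_cst; last exact: mK.
apply: lte_mul_pinfty; rewrite ?lee_fin//.
apply: (@le_lt_trans _ _ (mu2 R (box N%:R))).
  by apply: le_measure; rewrite ?inE//; exact: measurable_box.
by rewrite [X in X < _](mu2_box (ler0n _ N)) ltry.
Qed.

Lemma loc_integrableB Om f f' : open Om -> loc_integrable Om f -> loc_integrable Om f' ->
  loc_integrable Om (f \- f')%R.
Proof.
move=> oO [mf lf] [mf' lf']; split; first exact: measurable_funB.
move=> K cK KO; have mK := compact_measurable_plane cK.
have m1 := measurable_funS (open_measurable_plane oO) KO mf.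
have m2 := measurable_funS (open_measurable_plane oO) KO mf'.
apply: (@le_lt_trans _ _ (\int[mu2 R]_(z in K) (`|f z|%:E + `|f' z|%:E))).
  apply: ge0_le_integral => //.
  - by apply/measurable_EFinP; apply: measurableT_comp => //; exact: measurable_funB.
  - by apply: emeasurable_funD; apply/measurable_EFinP; exact: measurableT_comp.
  - by move=> z _; rewrite -EFinD lee_fin; exact: ler_normB.
rewrite ge0_integralD//; try by apply/measurable_EFinP; exact: measurableT_comp.
by apply: lte_add_pinfty; [exact: lf|exact: lf'].
Qed.

Lemma loc_test_integrable Om f zeta : open Om -> loc_integrable Om f -> test_function Om zeta ->
  (mu2 R).-integrable Om (fun z => (f z * zeta z)%:E).
Proof.
move=> oO [mf lf] tz; have mO := open_measurable_plane oO.
have [M M0 zM] := test_bounded tz.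
have mz : measurable_fun Om zeta := test_measurable tz.
case: (tz) => _ cK KO; have mK := compact_measurable_plane cK.
have mfK := measurable_funS mO KO mf.
apply/integrableP; split; first by apply/measurable_EFinP; exact: measurable_funM.
rewrite (ge0_integral_off (E := closure [set z | zeta z != 0%R])) //; last first.
  move=> z Oz nKz; have -> : zeta z = 0%R; last by rewrite mulr0 /= normr0.
  by apply/eqP/negPn/negP => ez; apply: nKz; exact: subset_closure.
apply: (@le_lt_trans _ _ (\int[mu2 R]_(z in closure [set z | zeta z != 0%R]) (M%:E * `|f z|%:E))).
  apply: ge0_le_integral => //.
  - apply: measurableT_comp => //; apply/measurable_EFinP; apply: measurable_funM => //.
    exact: test_measurable tz.
  - by apply: emeasurable_funM => //; apply/measurable_EFinP; exact: measurableT_comp.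
  - by move=> z _; rewrite -EFinM lee_fin normrM mulrC ler_wpM2r.
rewrite ge0_integralZl//; last by apply/measurable_EFinP; exact: measurableT_comp.
by apply: lte_mul_pinfty; rewrite ?lee_fin//; exact: lf.
Qed.

Lemma fin_num_adde_eq0 (x y : \bar R) : x \is a fin_num -> y \is a fin_num ->
  x + y = 0 -> x = - y.
Proof.
move=> /fineK <- /fineK <- /(congr1 fine)/= /eqP.
by rewrite addr_eq0 => /eqP ->.
Qed.

Lemma open_integral_fin_num Om (F : R * R -> \bar R) : open Om ->
  (mu2 R).-integrable Om F -> \int[mu2 R]_(z in Om) F z \is a fin_num.
Proof. by move=> oO; apply: integrable_fin_num; exact: open_measurable_plane. Qed.

(** The product eta zeta is itself a test function, so that the integral of its
    partial derivative is 0. *)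
Lemma test_by_parts Om b eta zeta : open Om -> test_function Om eta -> test_function Om zeta ->
  \int[mu2 R]_(z in Om) (eta z * 'D_(dir R b) zeta z)%:E
   = - \int[mu2 R]_(z in Om) ('D_(dir R b) eta z * zeta z)%:E.
Proof.
move=> oO te tz.
have ce := smooth_C1 (let: And3 s _ _ := te in s).
have cz := smooth_C1 (let: And3 s _ _ := tz in s).
have cez := C1M ce cz.
have sup : supported (eta * zeta)%R.
  have [N h] := test_supported te; exists N => z /h.
  by rewrite /GRing.mul/= => ->; exact: mul0r.
have E z : 'D_(dir R b) (eta * zeta)%R z =
    (eta z * 'D_(dir R b) zeta z + zeta z * 'D_(dir R b) eta z)%R.
  exact: (congr1 (fun h => h z) (deriveM_fun b ce cz)).
have := integral_derive0 b cez sup.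
under eq_integral do rewrite E EFinD.
rewrite -(@integral_off _ Om); last first.
  by move=> z nO; rewrite (test_off te nO) (test_off tz nO) !mul0r adde0.
have i1 : (mu2 R).-integrable Om (fun z => (eta z * 'D_(dir R b) zeta z)%:E).
  apply: loc_test_integrable => //; last exact: test_derive.
  by apply: loc_integrable_continuous; exact: ce.1.
have i2 : (mu2 R).-integrable Om (fun z => (zeta z * 'D_(dir R b) eta z)%:E).
  apply: loc_test_integrable => //; last exact: test_derive.
  by apply: loc_integrable_continuous; exact: cz.1.
rewrite integralD//; last exact: open_measurable_plane.
have -> : \int[mu2 R]_(z in Om) ('D_(dir R b) eta z * zeta z)%:E =
    \int[mu2 R]_(z in Om) (zeta z * 'D_(dir R b) eta z)%:E.
  by apply: eq_integral => z _; rewrite mulrC.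
have mO := open_measurable_plane oO.
exact: fin_num_adde_eq0 (open_integral_fin_num oO i1) (open_integral_fin_num oO i2).
Qed.

Lemma weak_gradient_sub Om f g eta : open Om -> loc_integrable Om f ->
  weak_gradient Om f g -> test_function Om eta ->
  weak_gradient Om (f \- eta)%R
    (fun z => ((g z).1 - 'D_(dir R false) eta z, (g z).2 - 'D_(dir R true) eta z)%R).
Proof.
move=> oO lf /weak_gradientP[lg h] te; apply/weak_gradientP.
have E b z : moving b ((g z).1 - 'D_(dir R false) eta z, (g z).2 - 'D_(dir R true) eta z)%R
   = (moving b (g z) - 'D_(dir R b) eta z)%R by case: b.
have cD b : continuous ('D_(dir R b) eta).
  by case: te => /smooth_C1[_ /(_ b)[]].
have ce : continuous eta by case: te => /smooth_C1[].
split=> [b|b zeta tz].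
  rewrite (_ : (fun z => _) = ((fun z => moving b (g z)) \- 'D_(dir R b) eta)%R).
    by apply: loc_integrableB => //; exact: loc_integrable_continuous.
  by apply/funext => z; rewrite E.
have mO := open_measurable_plane oO.
under eq_integral do rewrite mulrBl EFinB.
under [in RHS]eq_integral do rewrite E mulrBl EFinB.
rewrite !integralB//; last 4 first.
- by apply: loc_test_integrable => //; exact: lg.
- by apply: loc_test_integrable => //; apply: loc_integrable_continuous; exact: cD.
- by apply: loc_test_integrable => //; exact: test_derive.
- apply: loc_test_integrable => //; last exact: test_derive.
  exact: loc_integrable_continuous.
rewrite h// test_by_parts// oppeB ?oppeK//.
apply: fin_num_adde_defr; apply: open_integral_fin_num => //.
by apply: loc_test_integrable => //; exact: lg.
Qed.

Lemma wgradP Om f : (exists g, weak_gradient Om f g) -> weak_gradient Om f (wgrad Om f).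
Proof. by move=> [g fg]; rewrite /wgrad; case: xgetP => [_ -> //|/(_ g)]. Qed.

(** [wgrad] chooses arbitrary weak gradients of f and of f - eta.  Uniqueness almost
    everywhere is avoided: the difference of the two choices represents the classical
    derivative of eta against test functions, and that is all that the duality
    argument uses. *)
Lemma wgrad_diff Om f eta b zeta : open Om -> loc_integrable Om f ->
  (exists g, weak_gradient Om f g) -> test_function Om eta -> test_function Om zeta ->
  \int[mu2 R]_(z in Om) ('D_(dir R b) eta z * zeta z)%:E =
  \int[mu2 R]_(z in Om)
    ((moving b (wgrad Om f z) - moving b (wgrad Om (f \- eta)%R z)) * zeta z)%:E.
Proof.
move=> oO lf exf te tz; have mO := open_measurable_plane oO.
have /weak_gradientP[l1 h1] := wgradP exf.
have /wgradP/weak_gradientP[l2 h2] : exists g, weak_gradient Om (f \- eta)%R g.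
  by case: exf => g /weak_gradient_sub h; eexists; exact: (h _ oO lf te).
under [in RHS]eq_integral do rewrite mulrBl EFinB.
rewrite integralB//; last 2 first.
- by apply: loc_test_integrable => //; exact: l1.
- by apply: loc_test_integrable => //; exact: l2.
have E1 := h1 b zeta tz; have E2 := h2 b zeta tz.
have {E1} <- : - (\int[mu2 R]_(z in Om) (f z * 'D_(dir R b) zeta z)%:E) =
    \int[mu2 R]_(z in Om) (moving b (wgrad Om f z) * zeta z)%:E.
  by rewrite E1 oppeK.
have {E2} <- : - (\int[mu2 R]_(z in Om) ((f \- eta)%R z * 'D_(dir R b) zeta z)%:E) =
    \int[mu2 R]_(z in Om) (moving b (wgrad Om (f \- eta)%R z) * zeta z)%:E.
  by rewrite E2 oppeK.
have tdz : test_function Om ('D_(dir R b) zeta) by exact: test_derive.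
have ce : continuous eta by case: te => /smooth_C1[].
have i1 := loc_test_integrable oO lf tdz.
have i2 := loc_test_integrable oO (@loc_integrable_continuous Om _ ce) tdz.
have -> : \int[mu2 R]_(z in Om) ((f \- eta)%R z * 'D_(dir R b) zeta z)%:E =
    (\int[mu2 R]_(z in Om) (f z * 'D_(dir R b) zeta z)%:E) -
    \int[mu2 R]_(z in Om) (eta z * 'D_(dir R b) zeta z)%:E.
  by rewrite -integralB//; apply: eq_integral => z _; rewrite /= mulrBl EFinB.
have -> : \int[mu2 R]_(z in Om) ('D_(dir R b) eta z * zeta z)%:E =
  - (\int[mu2 R]_(z in Om) (eta z * 'D_(dir R b) zeta z)%:E).
  by rewrite test_by_parts// oppeK.
move: (open_integral_fin_num oO i1) (open_integral_fin_num oO i2).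
move: (\int[mu2 R]_(z in Om) (f z * _)%:E) (\int[mu2 R]_(z in Om) (eta z * _)%:E).
by move=> x y /fineK <- /fineK <-; rewrite -!(EFinN, EFinD); congr EFin; ring.
Qed.

End weak_gradients.

(** * Inequalities between powers *)

Section power_inequalities.
Variable R : realType.
Implicit Types a b e p q r s t x y : R.

Lemma ler_powR_neg x y a : a <= 0 -> 0 < y -> y <= x -> x `^ a <= y `^ a.
Proof.
move=> a0 y0 yx; rewrite -(opprK a) !(powRN _ (- a)) lef_pV2 ?posrE ?powR_gt0//.
- by apply: ge0_ler_powR; rewrite ?oppr_ge0 ?nnegrE// ltW// (lt_le_trans y0).
- exact: lt_le_trans yx.
Qed.

Lemma powR_norm_sqr x a : (x ^+ 2) `^ a = `|x| `^ (2 * a).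
Proof. by rewrite -real_normK ?num_real// -powR_mulrn// -powRrM. Qed.

(** With [sqrpow_le], this says that (x^2+e)^(p/2-1) x is a smooth substitute for
    |x|^(p-2) x: its product with x is |x|^p up to a constant that vanishes with e,
    and its absolute value is at most |x|^(p-1). *)
Lemma sqrpow_ge p e x : 0 < p < 2 -> 0 < e ->
  `|x| `^ p <= x * ((x ^+ 2 + e) `^ (p / 2 - 1) * x) + e `^ (p / 2).
Proof.
move=> /andP[p0 p2] e0.
have s0 : 0 <= x ^+ 2 by exact: sqr_ge0.
have s1 : 0 < x ^+ 2 + e by lra.
have -> : x * ((x ^+ 2 + e) `^ (p / 2 - 1) * x) = (x ^+ 2 + e) `^ (p / 2) - e * (x ^+ 2 + e) `^ (p / 2 - 1).
  rewrite -(mulr_powRB1 (ltW s1) (_ : 0 < p / 2)); last by lra.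
  by ring.
have h1 : `|x| `^ p <= (x ^+ 2 + e) `^ (p / 2).
  rewrite [X in _ `^ X <= _](_ : p = 2 * (p / 2)); last by lra.
  rewrite -powR_norm_sqr.
  by apply: ge0_ler_powR; rewrite ?nnegrE; lra.
have h2 : e * (x ^+ 2 + e) `^ (p / 2 - 1) <= e `^ (p / 2).
  rewrite -(mulr_powRB1 (ltW e0) (_ : 0 < p / 2)); last by lra.
  by rewrite ler_wpM2l ?(ltW e0)//; apply: ler_powR_neg; lra.
lra.
Qed.

Lemma sqrpow_le p e x : 1 < p < 2 -> 0 < e ->
  `|(x ^+ 2 + e) `^ (p / 2 - 1) * x| <= `|x| `^ (p - 1).
Proof.
move=> /andP[p1 p2] e0; have [->|x0] := eqVneq x 0.
  by rewrite mulr0 normr0 powR_ge0.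
have n0 : 0 < `|x| by rewrite normr_gt0.
rewrite normrM ger0_norm ?powR_ge0// mulrC.
rewrite -(mulr_powRB1 (ltW n0) (_ : 0 < p - 1)); last by lra.
rewrite ler_wpM2l// (_ : p - 1 - 1 = 2 * (p / 2 - 1)); last by lra.
rewrite -powR_norm_sqr; apply: ler_powR_neg; last by lra.
  by lra.
by rewrite exprn_even_gt0.
Qed.

(** Young's inequality with a factor 1/2 in front of the term to be absorbed; the
    proof compares b with 2a. *)
Lemma young_half p a b : 1 < p < 2 -> 0 <= a -> 0 <= b ->
  a * b `^ (p - 1) <= 2^-1 * b `^ p + 2 * a `^ p.
Proof.
move=> /andP[p1 p2] a0 b0.
have p0 : 0 < p by lra.
have [ab|ab] := leP (2 * a) b.
  rewrite -(mulr_powRB1 b0 p0) mulrA -[leLHS]addr0 lerD ?mulr_ge0 ?powR_ge0//.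
  by rewrite ler_wpM2r ?powR_ge0//; lra.
apply: (@le_trans _ _ (a * (2 * a) `^ (p - 1))).
  by rewrite ler_wpM2l//; apply: ge0_ler_powR; rewrite ?nnegrE; lra.
rewrite powRM//.
rewrite mulrCA mulr_powRB1// -[leLHS]add0r lerD ?mulr_ge0 ?powR_ge0//.
rewrite ler_wpM2r ?powR_ge0//; rewrite -[leRHS]powRr1//.
by apply: ler_powR; lra.
Qed.

(** Young's inequality for the exponents q/r and s, with an arbitrarily small factor
    in front of a^q.  It is proved by deciding which of the two terms on the right
    dominates. *)
Lemma young_eps e q r s a b : 0 < e -> 0 < r -> r < q -> s = q / (q - r) -> 0 <= a -> 0 <= b ->
  a `^ r * b <= e * a `^ q + (e^-1) `^ (r / (q - r)) * b `^ s.
Proof.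
move=> e0 r0 rq sE a0 b0; have qr : 0 < q - r by lra.
have pos : 0 < (e^-1) `^ (r / (q - r)) by rewrite powR_gt0 // invr_gt0.
have [h|h] := leP b (e * a `^ (q - r)).
  rewrite -[leLHS]addr0 lerD ?mulr_ge0 ?powR_ge0//.
  apply: le_trans (ler_wpM2l (powR_ge0 _ _) h) _.
  rewrite mulrCA -powRD; first by rewrite (_ : r + (q - r) = q)//; ring.
  by apply/implyP; rewrite (_ : r + (q - r) = q)//; [move/eqP; lra|ring].
rewrite -[leLHS]add0r lerD ?mulr_ge0 ?powR_ge0// ?(ltW e0)//.
have h' : a <= (e^-1 * b) `^ ((q - r)^-1).
  rewrite -[leLHS]powRr1// -[X in _ `^ X](@mulfV _ (q - r)) ?gt_eqF// powRrM.
  apply: ge0_ler_powR; rewrite ?nnegrE ?invr_ge0 ?powR_ge0 ?mulr_ge0 ?invr_ge0 ?(ltW e0)//.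
    exact: ltW.
  by rewrite -ler_pdivrMl ?invr_gt0// invrK ltW.
have h2 : a `^ r <= (e^-1 * b) `^ (r / (q - r)).
  rewrite [r / _]mulrC powRrM; apply: ge0_ler_powR; rewrite ?nnegrE ?powR_ge0//.
  exact: ltW.
apply: le_trans (ler_wpM2r b0 h2) _.
rewrite powRM ?invr_ge0 ?(ltW e0)// -mulrA ler_wpM2l ?powR_ge0//.
have -> : s = r / (q - r) + 1 by rewrite sE; field; lra.
rewrite powRD ?powRr1//; apply/implyP => /eqP.
have : 0 < r / (q - r) by rewrite divr_gt0.
lra.
Qed.

Lemma powRD2 p a b : 0 <= p -> 0 <= a -> 0 <= b ->
  (a + b) `^ p <= 2 `^ p * (a `^ p + b `^ p).
Proof.
move=> p0; wlog ab : a b / a <= b.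
  move=> h a0 b0; have [/h|/ltW /h] := leP a b; first exact.
  by rewrite addrC [X in _ * X]addrC; exact.
move=> a0 b0; apply: (@le_trans _ _ ((2 * b) `^ p)).
  by apply: ge0_ler_powR; rewrite ?nnegrE; lra.
by rewrite powRM// ler_wpM2l ?powR_ge0// lerDr powR_ge0.
Qed.

End power_inequalities.

(** * An L_p bound by duality with test functions *)

Section gradient_bound.
Variable R : realType.
Implicit Types (f eta zeta v G : R * R -> R) (b : bool) (Om : set (R * R)).

Lemma measurable_normpow (D : set (R * R)) f p : measurable_fun D f ->
  measurable_fun D (fun z => `|f z| `^ p).
Proof.
move=> mf; apply: (@measurableT_comp _ _ _ _ _ _ (fun x : R => x `^ p)).
  exact: measurable_powR.
exact: measurableT_comp.
Qed.

Local Open Scope ereal_scope.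

Lemma measurable_normpowE (D : set (R * R)) f p : measurable_fun D f ->
  measurable_fun D (fun z => (`|f z| `^ p)%:E).
Proof. by move=> mf; apply/measurable_EFinP; exact: measurable_normpow. Qed.

Lemma test_pow_lty Om v p : (0 < p)%R -> test_function Om v ->
  \int[mu2 R]_z (`|v z| `^ p)%:E < +oo.
Proof.
move=> p0 tv; have [N v0] := test_supported tv; have [M M0 vM] := test_bounded tv.
rewrite -(@integral_off _ (box N%:R)); last first.
  by move=> z /v0 ->; rewrite normr0 powR0// gt_eqF.
have mv : measurable_fun setT v := test_measurable tv.
apply: (@le_lt_trans _ _ (\int[mu2 R]_(z in box N%:R) (cst (M `^ p)%:E z))).
  apply: ge0_le_integral => //.
  - exact: measurable_box.
  - by apply: measurable_normpowE; exact: measurable_funTS.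
  - by move=> z _; rewrite lee_fin; apply: ge0_ler_powR; rewrite ?nnegrE ?(ltW p0).
rewrite [X in X < _]integral_cst; last exact: measurable_box.
by rewrite [X in _ * X](mu2_box (ler0n _ N)) -EFinM ltry.
Qed.

Lemma compact_mu2_fin (K : set (R * R)) : compact K -> mu2 R K < +oo.
Proof.
move=> cK; have [N KN] := bounded_plane_box cK.
apply: (@le_lt_trans _ _ (mu2 R (box N%:R))).
  apply: le_measure; rewrite ?inE//; first exact: compact_measurable_plane.
  exact: measurable_box.
by rewrite [X in X < _](mu2_box (ler0n _ N)) ltry.
Qed.

(** Finiteness of X is what allows half of X to be moved to the left. *)
Lemma half_absorb (X Y : \bar R) (m : R) : X \is a fin_num -> Y \is a fin_num ->
  (0 <= m)%R ->
  (forall d : R, (0 < d)%R -> X <= (2^-1)%:E * X + 2%:E * Y + (d * m)%:E) ->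
  X <= 4%:E * Y.
Proof.
move=> /fineK <- /fineK <- m0 h; set x := fine X; set y := fine Y.
apply/lee_addgt0Pr => e e0.
have d0 : (0 < e / (2 * (m + 1)))%R by rewrite divr_gt0// mulr_gt0// ltr_wpDl.
have := h _ d0; rewrite -!EFinM -!EFinD !lee_fin -/x -/y.
have : (e / (2 * (m + 1)) * m <= e / 2)%R.
  rewrite invfM mulrA -mulrA ger_pMr ?divr_gt0// mulrC ler_pdivrMr ?mul1r; lra.
move: x y (e / (2 * (m + 1)) * m)%R => x y u; lra.
Qed.

(** If v and G have the same integrals against test functions, then v is bounded by
    G in L_p.  Formally one tests with |v|^(p-2) v and applies Young's inequality;
    this function is not smooth where v vanishes, so it is regularized, and the error
    is a small multiple of the area of the support of v. *)
Lemma test_dual_bound Om v G p : open Om -> (1 < p < 2)%R ->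
  test_function Om v -> measurable_fun Om G ->
  (forall zeta, test_function Om zeta ->
    \int[mu2 R]_(z in Om) (v z * zeta z)%:E = \int[mu2 R]_(z in Om) (G z * zeta z)%:E) ->
  \int[mu2 R]_(z in Om) (`|v z| `^ p)%:E <= 4%:E * \int[mu2 R]_(z in Om) (`|G z| `^ p)%:E.
Proof.
move=> oO p12 tv mG vG; have /andP[p1 p2] := p12.
have mO := open_measurable_plane oO.
have mv : measurable_fun Om v := test_measurable tv.
set X := \int[mu2 R]_(z in Om) (`|v z| `^ p)%:E.
set Y := \int[mu2 R]_(z in Om) (`|G z| `^ p)%:E.
have Y0 : 0 <= Y by apply: integral_ge0 => z _; rewrite lee_fin powR_ge0.
have X0 : 0 <= X by apply: integral_ge0 => z _; rewrite lee_fin powR_ge0.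
have [->|Yfin] := eqVneq Y +oo; first by rewrite gt0_muley ?leey// lte_fin.
have {}Yfin : Y \is a fin_num by rewrite (ge0_fin_numE Y0) ltey.
have Xfin : X \is a fin_num.
  rewrite (ge0_fin_numE X0); apply: le_lt_trans (test_pow_lty (_ : 0 < p)%R tv); last by lra.
  apply: ge0_subset_integral => //; first by apply: measurable_normpowE; exact: test_measurable tv.
case: (tv) => sv cK KO; set K := closure [set z | v z != 0%R] in cK KO.
have mK := compact_measurable_plane cK.
have Kfin := compact_mu2_fin cK.
set m := fine (mu2 R K).
have mE : mu2 R K = m%:E by rewrite fineK// ge0_fin_numE.
have m0 : (0 <= m)%R by rewrite fine_ge0.
have key d : (0 < d)%R -> X <= (2^-1)%:E * X + 2%:E * Y + (d * m)%:E.
  (* e is chosen so that e^(p/2), the error of the regularization, equals d *)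
  move=> d0; pose e := (d `^ (2 / p))%R.
  have e0 : (0 < e)%R by rewrite powR_gt0.
  have ed : (e `^ (p / 2))%R = d.
    by rewrite /e -powRrM (_ : 2 / p * (p / 2) = 1)%R ?powRr1 ?ltW//; field; lra.
  pose zeta := ((fun z => (v z ^+ 2 + e) `^ (p / 2 - 1)) * v)%R.
  have tz : test_function Om zeta.
    apply: (test_sub tv); first exact: smooth_sqrpow.
    move=> z nK; rewrite /zeta /GRing.mul /=.
    have -> : v z = 0%R by apply/eqP/negPn/negP => ez; apply: nK; exact: subset_closure.
    exact: mulr0.
  have mz : measurable_fun Om zeta := test_measurable tz.
  have zE z : zeta z = ((v z ^+ 2 + e) `^ (p / 2 - 1) * v z)%R by [].
  have vz0 z : (0 <= v z * zeta z)%R.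
    by rewrite zE mulrCA mulr_ge0 ?powR_ge0// -expr2 sqr_ge0.
  have step1 : X <= \int[mu2 R]_(z in Om) (v z * zeta z)%:E + (d * m)%:E.
    have -> : (d * m)%:E = \int[mu2 R]_(z in Om) (d * \1_K z)%:E.
      under eq_integral do rewrite EFinM.
      rewrite ge0_integralZl//; last 2 first.
      - by apply/measurable_EFinP; exact: measurable_indic.
      - by rewrite lee_fin ltW.
      by rewrite integral_indic// (setIidl KO) EFinM -mE.
    rewrite -ge0_integralD//; last 4 first.
    - by move=> z _; rewrite lee_fin.
    - by apply/measurable_EFinP; exact: measurable_funM.
    - by move=> z _; rewrite lee_fin mulr_ge0// ltW.
    - by apply/measurable_EFinP; apply: measurable_funM => //; exact: measurable_indic.
    apply: ge0_le_integral => //.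
    - exact: measurable_normpowE.
    - apply/measurable_EFinP; apply: measurable_funD; apply: measurable_funM => //.
    - move=> z Oz; rewrite -EFinD lee_fin.
      have [Kz|nKz] := pselect (K z).
        rewrite indicE mem_set// mulr1 zE -ed; apply: sqrpow_ge => //; lra.
      have -> : v z = 0%R by apply/eqP/negPn/negP => ez; apply: nKz; exact: subset_closure.
      by rewrite normr0 powR0 ?gt_eqF ?mul0r ?add0r ?mulr_ge0// ?ltW//; lra.
  apply: (le_trans step1); rewrite leeD2r// vG//.
  apply: (le_trans (lee_abs _)); apply: (le_trans (le_abse_integral _ _ _)) => //.
    by apply/measurable_EFinP; exact: measurable_funM.
  rewrite -ge0_integralZl//; last exact: measurable_normpowE.
  rewrite -ge0_integralZl//; last exact: measurable_normpowE.
  rewrite -ge0_integralD//; last 2 first.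
  - by apply: emeasurable_funM => //; exact: measurable_normpowE.
  - by apply: emeasurable_funM => //; exact: measurable_normpowE.
  apply: ge0_le_integral => //.
  - apply: measurableT_comp => //; apply/measurable_EFinP; exact: measurable_funM.
  - by apply: emeasurable_funD; apply: emeasurable_funM => //; exact: measurable_normpowE.
  - move=> z Oz; rewrite -!EFinM -EFinD lee_fin normrM.
    apply: le_trans (young_half p12 (normr_ge0 _) (normr_ge0 _)).
    by rewrite ler_wpM2l// zE; apply: sqrpow_le.
exact: half_absorb Xfin Yfin m0 key.
Qed.

End gradient_bound.

(** * The derivative of a power of the absolute value *)

Section norm_power.
Variable R : realType.
Implicit Types (a c x : R).

Lemma continuous_normpow a : 0 < a -> continuous (fun x : R => `|x| `^ a).
Proof.
move=> a0 x; have [->|x0] := eqVneq x 0.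
  apply/cvgrPdist_lt => e e0; near=> y.
  rewrite normr0 powR0 ?gt_eqF// sub0r normrN ger0_norm ?powR_ge0//.
  have -> : e = (e `^ a^-1) `^ a by rewrite -powRrM mulVf ?gt_eqF// powRr1// ltW.
  apply: gt0_ltr_powR; rewrite ?nnegrE ?powR_ge0//.
  near: y; exists (e `^ a^-1) => /=; first exact: powR_gt0.
  by move=> y /=; rewrite sub0r normrN.
have n0 : 0 < `|x| by rewrite normr_gt0.
apply: (@continuous_comp _ _ _ (fun x : R => `|x|) (fun y : R => y `^ a)).
  exact: norm_continuous.
have [/derivable1_diffP d _] := @is_derive1_powR R a _ n0.
exact: differentiable_continuous.
Unshelve. all: by end_near. Qed.

(** For a > 0 this is sign(x) |x|^a, written without a case distinction so that its continuity
    is immediate. *)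
Definition spow a (x : R) := `|(x + `|x|) / 2| `^ a - `|(x - `|x|) / 2| `^ a.

Lemma continuous_spow a : 0 < a -> continuous (spow a).
Proof.
move=> a0 x; apply: cvgB.
  apply: (@continuous_comp _ _ _ (fun x : R => (x + `|x|) / 2) (fun y : R => `|y| `^ a)).
    by apply: cvgM; [apply: cvgD => //; exact: norm_continuous|exact: cvg_cst].
  exact: continuous_normpow.
apply: (@continuous_comp _ _ _ (fun x : R => (x - `|x|) / 2) (fun y : R => `|y| `^ a)).
  by apply: cvgM; [apply: cvgB => //; exact: norm_continuous|exact: cvg_cst].
exact: continuous_normpow.
Qed.

Lemma spow_pos a x : 0 < a -> 0 <= x -> spow a x = x `^ a.
Proof.
move=> a0 x0; rewrite /spow (ger0_norm x0) subrr mul0r normr0 powR0 ?gt_eqF// subr0.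
by rewrite (_ : (x + x) / 2 = x) ?ger0_norm//; lra.
Qed.

Lemma spow_neg a x : 0 < a -> x <= 0 -> spow a x = - (- x) `^ a.
Proof.
move=> a0 x0; rewrite /spow (ler0_norm x0) subrr mul0r normr0 powR0 ?gt_eqF// sub0r.
by rewrite (_ : (x - - x) / 2 = x) ?ler0_norm//; lra.
Qed.

Lemma norm_spow a x : 0 < a -> `|spow a x| = `|x| `^ a.
Proof.
move=> a0; have [x0|/ltW x0] := leP 0 x.
  by rewrite spow_pos// ger0_norm ?powR_ge0// ger0_norm.
by rewrite spow_neg// normrN ger0_norm ?powR_ge0// ler0_norm.
Qed.

Lemma is_derive_normpow c x : 1 < c ->
  is_derive x (1 : R) (fun x : R => `|x| `^ c) (c * spow (c - 1) x).
Proof.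
move=> c1; have c10 : 0 < c - 1 by lra.
have [x0|x0|->] := ltgtP x 0.
- have m0 : 0 < - x by lra.
  have d2 := @is_derive1_powR R c _ m0.
  have d1 : is_derive x (1 : R) (fun y : R => - y) (-1).
    by apply: is_derive_eq.
  have : is_derive x (1 : R) (fun y : R => (- y) `^ c) (c * (- x) `^ (c - 1) * -1).
    exact: (is_derive1_comp (f := fun x : R => x `^ c) (g := fun y : R => - y)).
  have E : \forall y \near x, (- y) `^ c = `|y| `^ c.
    near=> y; rewrite ltr0_norm//; near: y; exact: lt_nbhsl.
  move=> [h1 h2]; split.
    by apply: near_eq_derivable h1 => //; exact: E.
  rewrite -(@near_eq_derive _ _ _ (fun y : R => (- y) `^ c))// h2 spow_neg ?ltW//; ring.
- have d2 := @is_derive1_powR R c _ x0.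
  have E : \forall y \near x, y `^ c = `|y| `^ c.
    near=> y; rewrite gtr0_norm//; near: y; exact: lt_nbhsr.
  case: d2 => [h1 h2]; split.
    by apply: near_eq_derivable h1 => //; exact: E.
  by rewrite -(@near_eq_derive _ _ _ (fun y : R => y `^ c))// h2 spow_pos ?ltW.
- rewrite spow_pos// powR0 ?gt_eqF// mulr0.
  have H : (fun h : R => h^-1 *: (((fun x : R => `|x| `^ c) \o shift 0) (h *: (1 : R)) - `|0 : R| `^ c)) @ 0^' --> (0 : R).
    rewrite normr0 powR0; last by rewrite gt_eqF//; lra.
    apply/cvgrPdist_lt => e e0.
    have /cvgrPdist_lt/(_ e e0) := continuous_normpow c10 (x := 0).
    rewrite normr0 powR0 ?gt_eqF// => nb; near=> h.
    have h0 : h != 0 by near: h; exact: nbhs_dnbhs_neq.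
    have hn : 0 < `|h| by rewrite normr_gt0.
    rewrite sub0r normrN /= [h *: 1]mulr1 addr0 subr0 normrM normfV.
    rewrite ger0_norm ?powR_ge0// -(mulr_powRB1 (ltW hn)) ?mulKf ?gt_eqF//; last by lra.
    have : `|0 - `|h| `^ (c - 1)| < e by near: h; exact: nbhs_dnbhs.
    by rewrite sub0r normrN ger0_norm ?powR_ge0.
  by split; [apply/cvg_ex; exists 0|apply: cvg_lim].
Unshelve. all: by end_near. Qed.

End norm_power.

(** * Sobolev's inequality for test functions *)

Section sobolev.
Variable R : realType.
Implicit Types (f eta zeta v G : R * R -> R) (b : bool) (Om : set (R * R)).

Lemma C1_normpow eta c : 1 < c -> C1 eta -> C1 (fun z => `|eta z| `^ c) /\
  forall b z, 'D_(dir R b) (fun z => `|eta z| `^ c) z = c * spow (c - 1) (eta z) * 'D_(dir R b) eta z.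
Proof.
move=> c1 [ce de].
have D b z : is_derive z (dir R b) (fun z => `|eta z| `^ c)
    (c * spow (c - 1) (eta z) * 'D_(dir R b) eta z).
  have d1 := is_derive_normpow (eta z) c1.
  exact: (@is_derive_chain _ b eta (fun x => `|x| `^ c) z _ _ d1 (derivableP ((de b).1 z))).
split; last by move=> b z; have [] := D b z.
split.
  move=> z; apply: (@continuous_comp _ _ _ eta (fun x => `|x| `^ c)); first exact: ce.
  by apply: continuous_normpow; lra.
move=> b; split; first by move=> z; have [] := D b z.
have -> : 'D_(dir R b) (fun z => `|eta z| `^ c) =
    fun z => c * spow (c - 1) (eta z) * 'D_(dir R b) eta z.
  by apply/funext => z; have [] := D b z.
move=> z; apply: cvgM; last exact: (de b).2.
apply: cvgM; first exact: cvg_cst.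
apply: (@continuous_comp _ _ _ eta (spow (c - 1))); first exact: ce.
by apply: continuous_spow; lra.
Qed.

(** The choice d = 1/(2gy) turns the first term on the right into y/2, which is
    absorbed; since p-1 < 1, the remaining power of y is smaller than y. *)
Lemma scale_absorb (g p B y : R) : 1 < p < 2 -> 0 < g -> 0 <= B -> 0 <= y ->
  (forall d, 0 < d -> y <= g * (d * y ^+ 2 + (d^-1) `^ (p - 1) * B)) ->
  y <= (2 * g * (2 * g) `^ (p - 1) * B) `^ ((2 - p)^-1).
Proof.
move=> /andP[p1 p2] g0 B0; rewrite le_eqVlt => /predU1P[<- _|y0 h].
  exact: powR_ge0.
have gy : 0 < 2 * g * y by rewrite !mulr_gt0.
have := h (2 * g * y)^-1; rewrite invr_gt0 => /(_ gy).
have -> : g * ((2 * g * y)^-1 * y ^+ 2 + ((2 * g * y)^-1)^-1 `^ (p - 1) * B) =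
  y / 2 + g * (2 * g) `^ (p - 1) * B * y `^ (p - 1).
  rewrite invrK powRM ?(ltW y0) ?mulr_ge0 ?(ltW g0)//.
  by field; rewrite !gt_eqF.
set k := g * _ * B => hk.
have hy : y <= 2 * k * y `^ (p - 1) by rewrite -mulrA; move: hk; set w := k * _; lra.
have k0 : 0 <= 2 * k by rewrite !mulr_ge0 ?powR_ge0 ?(ltW g0).
have yp : y `^ (2 - p) <= 2 * k.
  have P : 0 < y `^ (p - 1) by rewrite powR_gt0.
  rewrite -(ler_pM2r P) -powRD; last by apply/implyP => _; rewrite gt_eqF.
  by rewrite (_ : 2 - p + (p - 1) = 1); [rewrite powRr1 ?(ltW y0)|ring].
rewrite (_ : 2 * g * _ * B = 2 * k); last by rewrite /k; ring.
have -> : y = (y `^ (2 - p)) `^ (2 - p)^-1.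
  by rewrite -powRrM mulfV ?powRr1 ?(ltW y0)// gt_eqF//; lra.
by apply: ge0_ler_powR; rewrite ?nnegrE ?powR_ge0 ?invr_ge0//; lra.
Qed.

Local Open Scope ereal_scope.

Lemma measurable_line b (t : R) (F : R * R -> \bar R) : measurable_fun setT F ->
  measurable_fun setT (fun s : R => F (put b s t)).
Proof. by move=> mF; apply: (measurableT_comp mF); exact: measurable_put. Qed.

(** On the horizontal and on the vertical line through a point, |v| is at most the
    integral of the partial derivative along that line.  The product of the two
    bounds separates the variables. *)
Lemma gagliardo_nirenberg v : C1 v -> supported v ->
  \int[mu2 R]_z (`|v z| ^+ 2)%:E <=
  (\int[mu2 R]_z `|'D_(dir R false) v z|%:E) * (\int[mu2 R]_z `|'D_(dir R true) v z|%:E).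
Proof.
move=> cv [N v0].
pose I b (t : R) := \int[@lebesgue_measure R]_s `|'D_(dir R b) v (put b s t)|%:E.
have mD b : measurable_fun setT (fun z => `|'D_(dir R b) v z|%:E).
  apply/measurable_EFinP; apply: measurableT_comp => //.
  by apply: continuous_measurable_plane; exact: (cv.2 b).2.
have D0 b z : 0 <= `|'D_(dir R b) v z|%:E by [].
have I0 b t : 0 <= I b t by apply: integral_ge0.
have mI b : measurable_fun setT (I b) := measurable_tonelli b (mD b) (D0 b).
(* v vanishes at the point of the line with coordinate N+1, outside its support *)
have vI b s t : `|v (put b s t)|%:E <= I b t.
  have := @line_le R b v t (N.+1%:R) s `]-oo, +oo[ cv.
  rewrite !in_itv/= => /(_ isT isT).
  rewrite (v0 (put b N.+1%:R t)) ?subr0 ?set_itvE//.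
  have Nlt : (N%:R < N.+1%:R :> R)%R by rewrite ltr_nat.
  by case: b => -[/=]; rewrite !in_itv/=; lra.
have intI b : \int[@lebesgue_measure R]_t I b t = \int[mu2 R]_z `|'D_(dir R b) v z|%:E.
  by rewrite (tonelli b).
have mv2 : measurable_fun setT (fun z => (`|v z| ^+ 2)%:E).
  apply/measurable_EFinP; apply: (@measurable_funX _ _ _ _ (fun z => `|v z|)%R).
  apply: measurableT_comp => //; apply: continuous_measurable_plane; exact: cv.1.
rewrite (tonelli false)//.
apply: (@le_trans _ _ (\int[@lebesgue_measure R]_t (I false t * \int[@lebesgue_measure R]_s I true s))).
  apply: ge0_le_integral => //.
  - by move=> t _; apply: integral_ge0.
  - by apply: (@measurable_tonelli R false (fun z => (`|v z| ^+ 2)%:E)).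
  - by apply: emeasurable_funM; [exact: mI|exact: measurable_cst].
  - move=> t _; rewrite -ge0_integralZl//; last exact: mI.
    apply: ge0_le_integral => //.
    + exact: (@measurable_line false t (fun z => (`|v z| ^+ 2)%:E) mv2).
    + by apply: emeasurable_funM; [exact: measurable_cst|exact: mI].
    + move=> s _; have h1 := vI false s t.
      have h2 : `|v (put false s t)|%:E <= I true s := vI true t s.
      by rewrite expr2 EFinM; apply: (lee_pmul _ _ h1 h2).
rewrite ge0_integralZr//; [|exact: mI|by apply: integral_ge0].
by rewrite -(intI false) -(intI true); exact: lexx.
Qed.

(** Apply [gagliardo_nirenberg] to v = |eta|^c with c = p/(2-p), for which v^2 is
    |eta|^q.  In absolute value the derivative of v is c |eta|^(c-1) times that of
    eta; by Young's inequality its integral is at most a small multiple of the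
    integral of |eta|^q plus a multiple of B, and the small term is absorbed. *)
Lemma sobolev Om (p B : R) : (1 < p < 2)%R -> (0 <= B)%R -> exists K : R, (0 <= K)%R /\
  forall eta, test_function Om eta ->
    (forall b, \int[mu2 R]_z (`|'D_(dir R b) eta z| `^ p)%:E <= B%:E) ->
    \int[mu2 R]_z (`|eta z| `^ (2 * p / (2 - p)))%:E <= K%:E.
Proof.
move=> p12 B0; have /andP[p1 p2] := p12.
have [c cE] : exists c, c = (p / (2 - p))%R by eexists.
have p2' : (0 < 2 - p)%R by lra.
have c1 : (1 < c)%R by rewrite cE ltr_pdivlMr//; lra.
have qE : (2 * p / (2 - p) = 2 * c)%R by rewrite cE mulrA.
exists (((2 * c * (2 * c) `^ (p - 1) * B) `^ ((2 - p)^-1)) ^+ 2)%R.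
split; first exact: exprn_ge0 (powR_ge0 _ _).
move=> eta te DB; rewrite qE.
have ce := smooth_C1 (let: And3 s _ _ := te in s).
have [cv Dv] := C1_normpow c1 ce.
set v := (fun z => `|eta z| `^ c)%R in cv Dv.
have sv : supported v.
  have [N h] := test_supported te; exists N => z /h; rewrite /v => ->.
  by rewrite normr0 powR0// gt_eqF//; lra.
have v2 z : (`|v z| ^+ 2 = `|eta z| `^ (2 * c))%R.
  by rewrite ger0_norm ?powR_ge0// -powR_mulrn ?powR_ge0// -powRrM mulrC.
have me : measurable_fun setT eta := test_measurable te.
have Xfin := test_pow_lty (_ : 0 < 2 * c)%R te.
have {Xfin} := Xfin ltac:(lra).
have gn := gagliardo_nirenberg cv sv.
have EX : \int[mu2 R]_z (`|v z| ^+ 2)%:E = \int[mu2 R]_z (`|eta z| `^ (2 * c))%:E.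
  by apply: eq_integral => z _; rewrite v2.
rewrite EX in gn; set X := (\int[mu2 R]_z (`|eta z| `^ (2 * c))%:E) in gn *.
have X0 : 0 <= X by apply: integral_ge0 => z _; rewrite lee_fin powR_ge0.
move=> Xlty; have /fineK XE : X \is a fin_num by rewrite (ge0_fin_numE X0).
pose x := fine X; have x0 : (0 <= x)%R by rewrite fine_ge0.
have W b d : (0 < d)%R -> \int[mu2 R]_z `|'D_(dir R b) v z|%:E <=
    (c * (d * x + (d^-1) `^ (p - 1) * B))%:E.
  move=> d0; apply: (@le_trans _ _ (\int[mu2 R]_z (c%:E * (d%:E * (`|eta z| `^ (2 * c))%:E + ((d^-1) `^ (p - 1))%:E * (`|'D_(dir R b) eta z| `^ p)%:E)))).
    apply: ge0_le_integral => //.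
    - apply/measurable_EFinP; apply: measurableT_comp => //.
      by apply: continuous_measurable_plane; exact: (cv.2 b).2.
    - apply: emeasurable_funM => //; apply: emeasurable_funD; apply: emeasurable_funM => //.
        exact: measurable_normpowE.
      apply: measurable_normpowE; apply: continuous_measurable_plane; exact: (ce.2 b).2.
    - move=> z _; rewrite Dv -!(EFinM, EFinD) lee_fin !normrM (gtr0_norm (_ : 0 < c)%R); last by lra.
      rewrite -mulrA ler_pM2l; last by lra.
      rewrite norm_spow; last by lra.
      have -> : (p - 1 = (c - 1) / (2 * c - (c - 1)))%R by rewrite cE; field; lra.
      apply: young_eps => //; [lra|lra|].
      by rewrite cE; field; lra.
  have mDe : measurable_fun setT (fun z => (`|'D_(dir R b) eta z| `^ p)%:E).
    apply: measurable_normpowE; apply: continuous_measurable_plane; exact: (ce.2 b).2.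
  have mep : measurable_fun setT (fun z => (`|eta z| `^ (2 * c))%:E).
    exact: measurable_normpowE.
  have n1 z : 0 <= d%:E * (`|eta z| `^ (2 * c))%:E.
    by rewrite -EFinM lee_fin mulr_ge0 ?powR_ge0 ?(ltW d0).
  have n2 z : 0 <= ((d^-1) `^ (p - 1))%:E * (`|'D_(dir R b) eta z| `^ p)%:E.
    by rewrite -EFinM lee_fin mulr_ge0 ?powR_ge0.
  rewrite ge0_integralZl//; last 3 first.
  - by apply: emeasurable_funD; apply: emeasurable_funM.
  - by move=> z _; exact: adde_ge0.
  - by rewrite lee_fin; lra.
  rewrite ge0_integralD//; [|exact: emeasurable_funM|exact: emeasurable_funM].
  have d0' : 0 <= d%:E by rewrite lee_fin; exact: (ltW d0).
  have p0' : 0 <= ((d^-1) `^ (p - 1))%:E by rewrite lee_fin powR_ge0.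
  rewrite !ge0_integralZl//.
  rewrite -/X -XE -/x !(EFinM, EFinD).
  apply: lee_wpmul2l; first by rewrite lee_fin; lra.
  by rewrite leeD2l//; apply: lee_wpmul2l.
rewrite -XE lee_fin -/x.
have -> : x = (Num.sqrt x ^+ 2)%R by rewrite sqr_sqrtr.
rewrite ler_sqr ?nnegrE ?sqrtr_ge0 ?powR_ge0//.
apply: scale_absorb => //; [lra|].
move=> d d0; rewrite sqr_sqrtr//.
set w := (c * _)%R.
have w0 : (0 <= w)%R.
  by rewrite mulr_ge0 ?addr_ge0 ?mulr_ge0 ?powR_ge0// ?(ltW d0)//; lra.
rewrite -(@ler_sqr _ (Num.sqrt x)) ?nnegrE ?sqrtr_ge0// sqr_sqrtr//.
rewrite -lee_fin /x XE; apply: (le_trans gn).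
by rewrite expr2 EFinM; apply: lee_pmul; rewrite ?integral_ge0//; exact: W.
Qed.

End sobolev.

(** * Approximation by test functions with bounded gradients *)

Section sobolev_space.
Variable R : realType.
Implicit Types (f eta zeta v G h : R * R -> R) (b : bool) (Om D : set (R * R)) (p q r M K : R).
Local Open Scope ereal_scope.

Lemma L_norm_le Om r h f M : (0 < r)%R -> (0 <= M)%R ->
  0 <= \int[mu2 R]_(z in Om) (`|f z| `^ r * h z)%:E ->
  L_norm Om r h f <= M%:E ->
  \int[mu2 R]_(z in Om) (`|f z| `^ r * h z)%:E <= (M `^ r)%:E.
Proof.
rewrite /L_norm => r0 M0; set I := \int[mu2 R]_(z in Om) _ => I0 IM.
have -> : I = (I `^ r^-1) `^ r by rewrite -poweRrM mulVf ?poweRe1// gt_eqF.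
have H (x : \bar R) : 0 <= x -> x \in `[0, +oo] by move=> x0; rewrite in_itv/= x0 leey.
by rewrite -poweR_EFin; apply: gt0_ler_poweR => //; rewrite ?(ltW r0)// H ?poweR_ge0// lee_fin.
Qed.

Lemma W1_norm_le Om p f M : (0 < p)%R -> (0 <= M)%R -> W1_norm p Om f <= M%:E ->
  \int[mu2 R]_(z in Om) (`|f z| `^ p)%:E <= (M `^ p)%:E /\
  \int[mu2 R]_(z in Om) (`|grad_norm Om f z| `^ p)%:E <= (M `^ p)%:E.
Proof.
move=> p0 M0; rewrite /W1_norm => h.
have E (g : R * R -> R) : \int[mu2 R]_(z in Om) (`|g z| `^ p * cst 1%R z)%:E =
    \int[mu2 R]_(z in Om) (`|g z| `^ p)%:E.
  by apply: eq_integral => z _; rewrite mulr1.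
have L0 (g : R * R -> R) : 0 <= L_norm Om p (cst 1%R) g by exact: poweR_ge0.
split; rewrite -E; apply: L_norm_le => //.
- by rewrite E; apply: integral_ge0 => z _; rewrite lee_fin powR_ge0.
- by apply: le_trans h; rewrite leeDl.
- by rewrite E; apply: integral_ge0 => z _; rewrite lee_fin powR_ge0.
- by apply: le_trans h; rewrite leeDr.
Qed.

Lemma moving_le_grad_norm Om f b z : (`|moving b (wgrad Om f z)| <= `|grad_norm Om f z|)%R.
Proof.
rewrite (ger0_norm (sqrtr_ge0 _)) -sqrtr_sqr ler_sqrt ?addr_ge0 ?sqr_ge0//.
by case: b; rewrite /= ?lerDl ?lerDr sqr_ge0.
Qed.

Lemma W1_sub_test Om p f eta : open Om -> elements (W1 p Om) f -> test_function Om eta ->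
  exists g, weak_gradient Om (f \- eta)%R g.
Proof.
move=> oO [lf [g fg] _] te; eexists; exact: weak_gradient_sub oO lf fg te.
Qed.

Lemma measurable_moving_wgrad Om f b : (exists g, weak_gradient Om f g) ->
  measurable_fun Om (fun z => moving b (wgrad Om f z)).
Proof. by move=> /wgradP/weak_gradientP[/(_ b)[]]. Qed.

Lemma measurable_grad_norm Om f : (exists g, weak_gradient Om f g) ->
  measurable_fun Om (grad_norm Om f).
Proof.
move=> ex; apply: measurableT_comp; first by apply: continuous_measurable_fun; exact: sqrt_continuous.
apply: measurable_funD; apply: measurable_funX.
  exact: (measurable_moving_wgrad false ex).
exact: (measurable_moving_wgrad true ex).
Qed.

(** The difference of the chosen weak gradients of f and of f - eta represents the
    derivative of eta against test functions, so that [test_dual_bound] applies. *)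
Lemma test_gradient_bound Om p f eta M b : open Om -> (1 < p < 2)%R -> (0 <= M)%R ->
  elements (W1 p Om) f -> test_function Om eta ->
  W1_norm p Om f <= M%:E -> W1_norm p Om (f \- eta)%R <= M%:E ->
  \int[mu2 R]_z (`|'D_(dir R b) eta z| `^ p)%:E <= (4 * (2 `^ p * (M `^ p + M `^ p)))%:E.
Proof.
move=> oO p12 M0 Wf te fM feM; have /andP[p1 p2] := p12.
have p0 : (0 < p)%R by lra.
have tD : test_function Om ('D_(dir R b) eta) by exact: test_derive.
have exf : exists g, weak_gradient Om f g by case: Wf.
have exfe := W1_sub_test oO Wf te.
have mO := open_measurable_plane oO.
have bound g : (exists w, weak_gradient Om g w) -> W1_norm p Om g <= M%:E ->
    exists A G : R * R -> R, [/\ (fun z => moving b (wgrad Om g z)) = A,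
      measurable_fun Om A, measurable_fun Om G,
      (forall z, `|A z| <= `|G z|)%R &
      \int[mu2 R]_(z in Om) (`|G z| `^ p)%:E <= (M `^ p)%:E].
  move=> exg gM; have [_ g1] := W1_norm_le p0 M0 gM.
  exists (fun z => moving b (wgrad Om g z)), (grad_norm Om g); split => //.
  - exact: measurable_moving_wgrad.
  - exact: measurable_grad_norm.
  - by move=> z; exact: moving_le_grad_norm.
have [A1 [G1 [AE1 mA1 mG1 AG1 iG1]]] := bound _ exf fM.
have [A2 [G2 [AE2 mA2 mG2 AG2 iG2]]] := bound _ exfe feM.
have diff zeta : test_function Om zeta ->
    \int[mu2 R]_(z in Om) ('D_(dir R b) eta z * zeta z)%:E =
    \int[mu2 R]_(z in Om) ((A1 z - A2 z) * zeta z)%:E.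
  by move=> tz; rewrite -AE1 -AE2; apply: wgrad_diff => //; case: Wf.
rewrite -(@integral_off _ Om); last first.
  by move=> z nO; rewrite (test_off tD nO) normr0 powR0// gt_eqF.
have mA : measurable_fun Om (fun z => A1 z - A2 z)%R := measurable_funB mA1 mA2.
apply: (le_trans (test_dual_bound oO p12 tD mA diff)).
rewrite EFinM; apply: lee_wpmul2l; first by rewrite lee_fin.
have mg1 := measurable_normpowE p mG1; have mg2 := measurable_normpowE p mG2.
have g0 (g : R * R -> R) z : 0 <= (`|g z| `^ p)%:E by rewrite lee_fin powR_ge0.
apply: (@le_trans _ _ (\int[mu2 R]_(z in Om) ((2 `^ p)%:E *
    ((`|G1 z| `^ p)%:E + (`|G2 z| `^ p)%:E)))).
  apply: ge0_le_integral => //.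
  - exact: measurable_normpowE.
  - by apply: emeasurable_funM; [exact: measurable_cst|exact: emeasurable_funD].
  - move=> z Oz; rewrite -!(EFinM, EFinD) lee_fin.
    apply: le_trans (powRD2 (ltW p0) (normr_ge0 _) (normr_ge0 _)).
    apply: ge0_ler_powR; rewrite ?nnegrE ?addr_ge0 ?(ltW p0)//.
    by apply: (le_trans (ler_normB _ _)); exact: lerD.
rewrite ge0_integralZl//; [|exact: emeasurable_funD|by move=> z _; exact: adde_ge0].
rewrite ge0_integralD// EFinM EFinD; apply: lee_wpmul2l; first by rewrite lee_fin powR_ge0.
exact: (leeD iG1 iG2).
Qed.

Lemma approx_test Om p M : open Om -> (1 < p < 2)%R -> (0 <= M)%R -> exists2 K, (0 <= K)%R &
  forall f, elements (W1_0 p Om) f -> W1_norm p Om f <= M%:E ->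
  forall e, (0 < e)%R -> exists eta, [/\ test_function Om eta,
    \int[mu2 R]_(z in Om) (`|f z - eta z| `^ p)%:E <= e%:E,
    forall b, \int[mu2 R]_z (`|'D_(dir R b) eta z| `^ p)%:E <= K%:E &
    \int[mu2 R]_z (`|eta z| `^ (2 * p / (2 - p)))%:E <= K%:E].
Proof.
move=> oO p12 M0; have /andP[p1 p2] := p12.
(* M + 1 bounds the norms of f and of f - eta as soon as the latter is at most 1 *)
pose B := (4 * (2 `^ p * ((M + 1) `^ p + (M + 1) `^ p)))%R.
have B0 : (0 <= B)%R by rewrite !mulr_ge0 ?addr_ge0 ?powR_ge0.
have [K [K0 sob]] := sobolev Om p12 B0.
exists (B + K)%R; first exact: addr_ge0.
move=> f [Wf appr] fM e e0.
pose d := Num.min 1%R (e `^ p^-1)%R.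
have d0 : (0 < d)%R by rewrite lt_min ltr01 powR_gt0.
have [eta [te /ltW he]] := appr d d0.
have hd b : \int[mu2 R]_z (`|'D_(dir R b) eta z| `^ p)%:E <= B%:E.
  apply: (test_gradient_bound b oO p12 _ Wf te); first by rewrite addr_ge0.
  - by apply: (le_trans fM); rewrite lee_fin lerDl.
  - by apply: (le_trans he); rewrite lee_fin (le_trans (_ : _ <= 1)%R) ?ge_min ?lexx// lerDr.
exists eta; split => //.
- have p0 : (0 < p)%R by lra.
  have [h _] := W1_norm_le p0 (ltW d0) he.
  apply: (le_trans h).
  rewrite lee_fin [leRHS](_ : e = ((e `^ p^-1) `^ p)%R); last first.
    by rewrite -powRrM mulVf ?gt_eqF// powRr1 ?(ltW e0).
  apply: ge0_ler_powR; rewrite ?nnegrE ?powR_ge0 ?(ltW d0)//; first by lra.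
  by rewrite ge_min lexx orbT.
- by move=> b; apply: (le_trans (hd b)); rewrite lee_fin lerDl.
- by apply: (le_trans (sob _ te hd)); rewrite lee_fin lerDr.
Qed.

End sobolev_space.

(** * Convergence almost everywhere and convergence of integrals *)

Section convergence.
Variable R : realType.
Implicit Types (f g eta h : R * R -> R) (Om D : set (R * R)) (p q r s M K : R).
Implicit Types (F : nat -> R * R -> R).
Local Open Scope ereal_scope.

Global Instance ae_mu2_filter : Filter (almost_everywhere (mu2 R)).
Proof. exact: ae_filter_ringOfSetsType. Qed.

Lemma nonneg_eseries_cvg (u : nat -> R) : (forall n, 0 <= u n)%R ->
  \sum_(n <oo) (u n)%:E < +oo -> cvgn (series u).
Proof.
move=> u0 ult; apply: nondecreasing_is_cvgn; first exact: nondecreasing_series.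
have S0 : 0 <= \sum_(n <oo) (u n)%:E by apply: nneseries_ge0 => n _ _; rewrite lee_fin.
have fin : \sum_(n <oo) (u n)%:E \is a fin_num.
  by rewrite (ge0_fin_numE S0).
exists (fine (\sum_(n <oo) (u n)%:E)) => _ [n _ <-].
rewrite -lee_fin fineK// /series/= -sumEFin.
by apply: nneseries_lim_ge => k _ _; rewrite lee_fin.
Qed.

(** The sum of the series has a finite integral, hence is finite almost everywhere. *)
Lemma fast_cvg_ae D F : measurable D -> (forall n, measurable_fun D (F n)) ->
  (forall n z, 0 <= F n z)%R ->
  (forall n, \int[mu2 R]_(z in D) (F n z)%:E <= ((2^-1) ^+ n)%:E) ->
  {ae mu2 R, forall z, D z -> cvgn (series (fun n => F n z))}.
Proof.
move=> mD mF F0 FI.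
have mFE n : measurable_fun D (fun z => (F n z)%:E) by apply/measurable_EFinP.
have F0E n z : 0 <= (F n z)%:E by rewrite lee_fin.
have S0 z : 0 <= \sum_(n <oo) (F n z)%:E by exact: nneseries_ge0.
have int : \int[mu2 R]_(z in D) (\sum_(n <oo) (F n z)%:E) < +oo.
  rewrite integral_nneseries//.
  apply: (@le_lt_trans _ _ (\sum_(n <oo) ((2^-1) ^+ n)%:E)).
    by apply: lee_nneseries => [n _ _|n _]; [exact: integral_ge0|exact: FI].
  have C := @cvg_geometric_eseries_half R 2 0.
  have E : eseries (fun k => (2 / (2 ^ (k + 1))%:R : R)%:E) =
      (fun n => \sum_(0 <= k < n) ((2^-1) ^+ k)%:E).
    apply/funext => n; apply: eq_bigr => k _; congr EFin.
    by rewrite addn1 expnS natrM natrX exprVn; field; rewrite expf_neq0.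
  by rewrite E in C; rewrite (cvg_lim _ C)// ltry.
have : (mu2 R).-integrable D (fun z => \sum_(n <oo) (F n z)%:E).
  apply/integrableP; split.
    apply: (@ge0_emeasurable_sum _ _ _ D (fun n z => (F n z)%:E) xpredT); [by move=> k z *; exact: F0E|by move=> k *; exact: mFE].
  by under eq_integral do rewrite gee0_abs//.
move=> ig; have : {ae mu2 R, forall z, D z -> \sum_(n <oo) (F n z)%:E \is a fin_num}.
  by apply: integrable_ae.
apply: filterS => z h Dz.
by apply: nonneg_eseries_cvg => //; have := h Dz; rewrite ge0_fin_numE.
Qed.

Lemma cvg_normpow0 (u : nat -> R) p : (0 < p)%R ->
  (fun n => (`|u n| `^ p)%R) @ \oo --> (0%R : R) -> u @ \oo --> (0%R : R).
Proof.
move=> p0 h; apply/norm_cvg0P.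
have E n : (`|u n| = `| `|u n| `^ p | `^ p^-1)%R.
  by rewrite [X in (_ = X `^ _)%R]ger0_norm ?powR_ge0// -powRrM mulfV ?gt_eqF// powRr1.
rewrite (_ : (fun n => `|u n|)%R = (fun n => `| `|u n| `^ p | `^ p^-1)%R); last exact: funext.
have p1 : (0 < p^-1)%R by rewrite invr_gt0.
have c := @continuous_normpow R _ p1 0%R.
rewrite -[X in _ --> X](_ : (`|0 : R| `^ p^-1)%R = 0%R); last first.
  by rewrite normr0 powR0// gt_eqF.
exact: (cvg_comp _ _ h c).
Qed.

Lemma fatou_ae D F f q K : measurable D -> measurable_fun D f -> (0 < q)%R ->
  (forall n, measurable_fun D (F n)) ->
  {ae mu2 R, forall z, D z -> F ^~ z @ \oo --> f z} ->
  (forall n, \int[mu2 R]_(z in D) (`|F n z| `^ q)%:E <= K%:E) ->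
  \int[mu2 R]_(z in D) (`|f z| `^ q)%:E <= K%:E.
Proof.
move=> mD mf q0 mF [N [mN N0 subN]] FK.
rewrite (ge0_negligible_integral mN)//; last exact: measurable_normpowE.
have mDN : measurable (D `\` N) by exact: measurableD.
have mFDN n : measurable_fun (D `\` N) (fun z => (`|F n z| `^ q)%:E).
  by apply: measurable_normpowE; apply: measurable_funS (mF n) => //; exact: subDsetl.
have -> : \int[mu2 R]_(z in D `\` N) (`|f z| `^ q)%:E =
   \int[mu2 R]_(z in D `\` N) limn_einf (fun n => (`|F n z| `^ q)%:E).
  apply: eq_integral => z; rewrite inE => -[Dz nNz].
  have Fz : F ^~ z @ \oo --> f z.
    by apply: contrapT => h; apply: nNz; apply: subN => /= /(_ Dz).
  have c : (fun n => (`|F n z| `^ q)%:E) @ \oo --> (`|f z| `^ q)%:E.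
    apply: cvg_EFin; first exact: nearW.
    exact: (cvg_comp _ _ Fz (@continuous_normpow R _ q0 _)).
  by have [-> _] := cvg_limn_einf_sup c.
have F0 n (z : R * R) : (D `\` N) z -> 0 <= (`|F n z| `^ q)%:E by rewrite lee_fin powR_ge0.
apply: (@le_trans _ _ (limn_einf (fun n => \int[mu2 R]_(z in D `\` N) (`|F n z| `^ q)%:E))).
  exact: (@fatou _ _ R (mu2 R) (D `\` N) mDN (fun n z => (`|F n z| `^ q)%:E) mFDN F0).
rewrite limn_einf_lim; apply: lime_le.
  exact: is_cvg_einfs.
apply: nearW => n; apply: (@le_trans _ _ (\int[mu2 R]_(z in D `\` N) (`|F n z| `^ q)%:E)).
  by apply: ereal_inf_lbound; exists n => /=.
apply: le_trans (FK n); apply: ge0_subset_integral => //.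
exact: measurable_normpowE.
Qed.

Lemma ge0_cvg0 (I : nat -> \bar R) : (forall n, 0 <= I n) ->
  (forall e : R, (0 < e)%R -> \forall n \near \oo, I n <= e%:E) -> I @ \oo --> 0.
Proof.
move=> I0 h; apply/fine_cvgP; split.
  apply: filterS (h 1%R ltr01) => n hn.
  by rewrite ge0_fin_numE// (le_lt_trans hn)// ltry.
apply/cvgrPdist_le => e e0; apply: filterS (h e e0) => n hn /=.
rewrite sub0r normrN ger0_norm; last exact: fine_ge0.
by rewrite -lee_fin fineK// ge0_fin_numE// (le_lt_trans hn)// ltry.
Qed.

Lemma cvg0_near_le (I : nat -> \bar R) (e : R) : (forall n, 0 <= I n) ->
  I @ \oo --> 0 -> (0 < e)%R -> \forall n \near \oo, I n <= e%:E.
Proof.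
move=> I0 /fine_cvgP[If /cvgrPdist_le h] e0; near=> n.
have fn : I n \is a fin_num by near: n.
have : (`|0 - fine (I n)| <= e)%R by near: n; exact: h.
by rewrite sub0r normrN ger0_norm ?fine_ge0// -lee_fin fineK.
Unshelve. all: by end_near. Qed.

(** Let phi_n be the positive part of |F_n - f|^r h - e |F_n - f|^q.  By Young's
    inequality it is dominated by a multiple of h^s, so its integral tends to 0, while
    the term that was subtracted has integral at most e times a constant. *)
Lemma weighted_cvg D F f h q r s K : measurable D -> measurable_fun D f -> (0 < r)%R -> (r < q)%R ->
  s = (q / (q - r))%R -> (forall n, measurable_fun D (F n)) ->
  {ae mu2 R, forall z, D z -> F ^~ z @ \oo --> f z} ->
  (forall n, \int[mu2 R]_(z in D) (`|F n z| `^ q)%:E <= K%:E) ->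
  measurable_fun D h -> (forall z, D z -> 0 <= h z)%R ->
  \int[mu2 R]_(z in D) (h z `^ s)%:E < +oo ->
  (fun n => \int[mu2 R]_(z in D) (`|F n z - f z| `^ r * h z)%:E) @ \oo --> 0.
Proof.
move=> mD mf r0 rq sE mF Ff FK mh h0 hs.
have q0 : (0 < q)%R by exact: lt_trans rq.
have fK := fatou_ae mD mf q0 mF Ff FK.
have mFf n : measurable_fun D (fun z => F n z - f z)%R by exact: measurable_funB.
have K0 : (0 <= K)%R.
  by rewrite -lee_fin; apply: le_trans fK; apply: integral_ge0 => z _; rewrite lee_fin powR_ge0.
pose L := (2 `^ q * (K + K))%R.
have L0 : (0 <= L)%R by rewrite mulr_ge0 ?addr_ge0 ?powR_ge0.
have FfL n : \int[mu2 R]_(z in D) (`|F n z - f z| `^ q)%:E <= L%:E.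
  have m1 := measurable_normpowE q (mF n); have m2 := measurable_normpowE q mf.
  apply: (@le_trans _ _ (\int[mu2 R]_(z in D) ((2 `^ q)%:E *
    ((`|F n z| `^ q)%:E + (`|f z| `^ q)%:E)))).
    apply: ge0_le_integral => //.
    - exact: measurable_normpowE.
    - by apply: emeasurable_funM; [exact: measurable_cst|exact: emeasurable_funD].
    - move=> z Oz; rewrite -!(EFinM, EFinD) lee_fin.
      apply: le_trans (powRD2 (ltW q0) (normr_ge0 _) (normr_ge0 _)).
      apply: ge0_ler_powR; rewrite ?nnegrE ?addr_ge0 ?(ltW q0)//.
      exact: ler_normB.
  rewrite ge0_integralZl//; [|exact: emeasurable_funD|by move=> z _; exact: adde_ge0].
  rewrite ge0_integralD// EFinM EFinD; apply: lee_wpmul2l; first by rewrite lee_fin powR_ge0.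
  exact: leeD (FK n) fK.
pose y e n z := (`|F n z - f z| `^ r * h z - e * `|F n z - f z| `^ q)%R.
(* the positive part of y *)
pose phi e n z := ((y e n z + `|y e n z|) / 2)%R.
have my e n : measurable_fun D (y e n).
  apply: measurable_funB; first by apply: measurable_funM => //; exact: measurable_normpow.
  by apply: measurable_funM => //; exact: measurable_normpow.
have mphi e n : measurable_fun D (phi e n).
  by apply: measurable_funM => //; apply: measurable_funD => //; exact: measurableT_comp.
have phi0 e n z : (0 <= phi e n z)%R.
  by rewrite /phi; have := ler_norm (- y e n z)%R; rewrite normrN; lra.
have yphi e n z : (y e n z <= phi e n z)%R.
  by rewrite /phi; have := ler_norm (y e n z); lra.
have mhs : measurable_fun D (fun z => h z `^ s)%R.
  by apply: (@measurableT_comp _ _ _ _ _ _ (fun x : R => x `^ s)%R) => //; exact: measurable_powR.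
have phi_cvg e : (0 < e)%R -> (fun n => \int[mu2 R]_(z in D) (phi e n z)%:E) @ \oo --> 0.
  move=> e0; pose C := ((e^-1) `^ (r / (q - r)))%R.
  have C0 : (0 <= C)%R by exact: powR_ge0.
  have ig : (mu2 R).-integrable D (fun z => (C * h z `^ s)%:E).
    apply/integrableP; split; first by apply/measurable_EFinP; exact: measurable_funM.
    under eq_integral do rewrite gee0_abs ?lee_fin ?mulr_ge0 ?powR_ge0// EFinM.
    rewrite ge0_integralZl//; first by apply: lte_mul_pinfty => //; rewrite lee_fin.
      by apply/measurable_EFinP; exact: mhs.
    by move=> z _; rewrite lee_fin powR_ge0.
  have aec : {ae mu2 R, forall z, D z -> (fun n => (phi e n z)%:E) @ \oo --> (cst 0 z : \bar R)}.
    apply: filterS Ff => z /[apply] Fz.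
    have d0 : (fun n => F n z - f z)%R @ \oo --> (0%R : R).
      by rewrite -(subrr (f z)); apply: cvgB => //; exact: cvg_cst.
    have pow0 a : (0 < a)%R -> (fun n => `|F n z - f z| `^ a)%R @ \oo --> (0%R : R).
      move=> a0; have := cvg_comp _ _ d0 (@continuous_normpow R _ a0 0%R).
      by rewrite /= normr0 powR0 ?gt_eqF.
    have y0 : (fun n => y e n z) @ \oo --> (0%R : R).
      have -> : 0%R = (0 * h z - e * 0)%R :> R by rewrite mul0r mulr0 subrr.
      apply: cvgB; apply: cvgM; try exact: cvg_cst.
        exact: pow0.
      exact: pow0.
    apply: cvg_EFin; first exact: nearW.
    have := cvgM (cvgD y0 (cvg_norm y0)) (cvg_cst (2^-1 : R)%R).
    by rewrite normr0 addr0 mul0r; exact.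
  have dom : {ae mu2 R, forall z n, D z -> `|(phi e n z)%:E| <= (C * h z `^ s)%:E}.
    apply: aeW => z n Dz; rewrite gee0_abs ?lee_fin//.
    have := young_eps e0 r0 rq sE (normr_ge0 (F n z - f z)%R) (h0 _ Dz).
    rewrite -/C -/(y e n z) => H.
    have yC : (y e n z <= C * h z `^ s)%R by rewrite /y; lra.
    have : (0 <= C * h z `^ s)%R by rewrite mulr_ge0 ?powR_ge0.
    by rewrite /phi; have [yn|yn] := leP 0%R (y e n z); rewrite ?(ger0_norm yn) ?(ltr0_norm yn); lra.
  have mphiE n : measurable_fun D (fun z => (phi e n z)%:E) by apply/measurable_EFinP.
  have m0 : measurable_fun D (cst 0 : R * R -> \bar R) by exact: measurable_cst.
  have [_ _] := @dominated_convergence _ _ R (mu2 R) D mD (fun n z => (phi e n z)%:E) (cst 0) _ mphiE m0 aec ig dom.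
  by rewrite integral0.
have bound e n : (0 < e)%R -> \int[mu2 R]_(z in D) (`|F n z - f z| `^ r * h z)%:E
    <= \int[mu2 R]_(z in D) (phi e n z)%:E + (e * L)%:E.
  move=> e0; apply: (@le_trans _ _ (\int[mu2 R]_(z in D)
      ((phi e n z)%:E + e%:E * (`|F n z - f z| `^ q)%:E))).
    apply: ge0_le_integral => //.
    - by move=> z Dz; rewrite lee_fin mulr_ge0 ?powR_ge0 ?h0.
    - by apply/measurable_EFinP; apply: measurable_funM => //; exact: measurable_normpow.
    - apply: emeasurable_funD; first by apply/measurable_EFinP; exact: mphi.
      by apply: emeasurable_funM => //; exact: measurable_normpowE.
    - by move=> z Dz; rewrite -EFinM -EFinD lee_fin; have := yphi e n z; rewrite /y; lra.
  rewrite ge0_integralD//; last 4 first.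
  - by move=> z _; rewrite lee_fin.
  - by apply/measurable_EFinP; exact: mphi.
  - by move=> z _; rewrite -EFinM lee_fin mulr_ge0 ?powR_ge0// ltW.
  - by apply: emeasurable_funM => //; exact: measurable_normpowE.
  rewrite leeD2l// ge0_integralZl//; last 2 first.
  - exact: measurable_normpowE.
  - by rewrite lee_fin ltW.
  by rewrite EFinM; apply: lee_wpmul2l => //; rewrite lee_fin ltW.
have I0 n : 0 <= \int[mu2 R]_(z in D) (`|F n z - f z| `^ r * h z)%:E.
  by apply: integral_ge0 => z Dz; rewrite lee_fin mulr_ge0 ?powR_ge0 ?h0.
apply: ge0_cvg0 => // e e0.
have L1 : (0 < L + 1)%R by rewrite ltr_wpDl.
pose d := (e / 2 / (L + 1))%R.
have d0 : (0 < d)%R by rewrite /d !divr_gt0.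
have e20 : (0 < e / 2)%R by rewrite divr_gt0.
have dL : (d * L <= e / 2)%R.
  by rewrite /d -mulrA ger_pMr// mulrC ler_pdivrMr// mul1r; lra.
have P0 n : 0 <= \int[mu2 R]_(z in D) (phi d n z)%:E.
  by apply: integral_ge0 => z _; rewrite lee_fin.
have := cvg0_near_le P0 (phi_cvg d d0) e20; apply: filterS => n h1.
apply: (le_trans (bound d n d0)); have -> : e = (e / 2 + e / 2)%R by lra.
by rewrite EFinD; apply: leeD => //; rewrite lee_fin.
Qed.

End convergence.

(** * Grids of half-open squares *)

Section grid.
Variable R : realType.
Implicit Types (a c l N : R) (F : R * R -> \bar R) (b : bool).
Local Open Scope ereal_scope.

(** Half-open sides make the cells of a grid disjoint, so that integrals add up
    exactly. *)
Definition side a l : set R := `[a, (a + l)%R[%classic.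
Definition cell a c l : set (R * R) := side a l `*` side c l.

Lemma measurable_side a l : measurable (side a l). Proof. exact: measurable_itv. Qed.

Lemma lebesgue_side a l : (0 <= l)%R -> @lebesgue_measure R (side a l) = l%:E.
Proof.
move=> l0; rewrite /side lebesgue_measure_itv/= lte_fin ltrDl.
case: ltP => h; first by rewrite -EFinD addrAC subrr add0r.
by congr EFin; apply/eqP; rewrite eq_le l0 h.
Qed.

Lemma measurable_cell a c l : measurable (cell a c l).
Proof. by apply: measurableX; exact: measurable_side. Qed.

Lemma mu2_cell a c l : (0 <= l)%R -> mu2 R (cell a c l) = (l * l)%:E.
Proof.
move=> l0; rewrite mu2_rect; [|exact: measurable_side|exact: measurable_side].
by rewrite [X in X * _](lebesgue_side a l0) [X in _ * X](lebesgue_side c l0).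
Qed.

Lemma setX_unionl (A B J : set R) : (A `|` B) `*` J = (A `*` J) `|` (B `*` J).
Proof. by apply/seteqP; split => -[x y] /=; tauto. Qed.

Lemma setX_unionr (A B J : set R) : J `*` (A `|` B) = (J `*` A) `|` (J `*` B).
Proof. by apply/seteqP; split => -[x y] /=; tauto. Qed.

(** Both coordinates are treated in one induction on the number of sides. *)
Lemma ge0_integral_split_side a l (J : set R) k F : (0 <= l)%R -> measurable J ->
  measurable_fun setT F -> (forall z, 0 <= F z) ->
  \int[mu2 R]_(z in side a (k%:R * l) `*` J) F z =
    \sum_(i < k) \int[mu2 R]_(z in side (a + i%:R * l) l `*` J) F z /\
  \int[mu2 R]_(z in J `*` side a (k%:R * l)) F z =
    \sum_(i < k) \int[mu2 R]_(z in J `*` side (a + i%:R * l) l) F z.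
Proof.
move=> l0 mJ mF F0.
have disj i : side a (i%:R * l) `&` side (a + i%:R * l) l = set0.
  apply/seteqP; split => // x []; rewrite /side/= !in_itv/= => /andP[_ h1] /andP[h2 _].
  by move: h1; rewrite ltNge h2.
have un i : side a (i.+1%:R * l) = side a (i%:R * l) `|` side (a + i%:R * l) l.
  have E : (i.+1%:R * l = i%:R * l + l)%R by rewrite -addn1 natrD mulrDl mul1r.
  have il0 : (0 <= i%:R * l)%R by exact: mulr_ge0.
  rewrite /side E; apply/seteqP; split => x /=; rewrite !in_itv/=; move: (i%:R * l)%R il0 => u u0.
    by move=> /andP[h1 h2]; have [h|h] := ltP x (a + u)%R; [left|right]; apply/andP; split; lra.
  by move=> [|] /andP[h1 h2]; apply/andP; split; lra.
have mS i : measurable (side (a + i%:R * l) l) by exact: measurable_side.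
have mS' i : measurable (side a (i%:R * l)) by exact: measurable_side.
have zero : side a (0%:R * l) = set0 by rewrite /side mul0r addr0 set_itvE.
have U (A B : set (R * R)) : measurable A -> measurable B -> A `&` B `<=` set0 ->
    \int[mu2 R]_(z in A `|` B) F z = \int[mu2 R]_(z in A) F z + \int[mu2 R]_(z in B) F z.
  move=> mA mB AB; apply: ge0_integral_setU => //.
  - by apply: measurable_funTS.
  - by apply/disj_setPS.
elim: k => [|k [IH1 IH2]].
  by rewrite !big_ord0 zero set0X setX0 !integral_set0.
rewrite !big_ord_recr/= -IH1 -IH2 un; split.
- rewrite setX_unionl U//; [exact: measurableX|exact: measurableX|].
  by move=> [x y] [[/= h1 _] [/= h2 _]]; have : (side a (k%:R * l) `&` side (a + k%:R * l) l) x by []; rewrite disj.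
- rewrite setX_unionr U//; [exact: measurableX|exact: measurableX|].
  by move=> [x y] [[/= _ h1] [/= _ h2]]; have : (side a (k%:R * l) `&` side (a + k%:R * l) l) y by []; rewrite disj.
Qed.

Definition hbox (N : R) := cell (- N)%R (- N)%R (2 * N)%R.

Definition gcell (N : R) k (i j : 'I_k) :=
  cell (- N + i%:R * (2 * N / k%:R))%R (- N + j%:R * (2 * N / k%:R))%R (2 * N / k%:R)%R.

Lemma grid_sum (N : R) k F : (0 < k)%N -> (0 <= N)%R ->
  measurable_fun setT F -> (forall z, 0 <= F z) ->
  \int[mu2 R]_(z in hbox N) F z =
  \sum_(i < k) \sum_(j < k) \int[mu2 R]_(z in gcell N i j) F z.
Proof.
case: k => // k _ N0 mF F0; set l := (2 * N / k.+1%:R)%R.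
have l0 : (0 <= l)%R by rewrite divr_ge0// mulr_ge0.
have kl : (2 * N = k.+1%:R * l)%R by rewrite /l mulrCA mulfV ?mulr1.
rewrite /hbox /cell {1 2}kl.
rewrite (ge0_integral_split_side _ _ l0 _ mF F0).1; last exact: measurable_side.
apply: eq_bigr => i _.
by rewrite (ge0_integral_split_side _ _ l0 _ mF F0).2; last exact: measurable_side.
Qed.

Lemma tonelli_rect b (I J : set R) F : measurable I -> measurable J ->
  measurable_fun setT F -> (forall z, 0 <= F z) ->
  \int[mu2 R]_(z in (if b then J `*` I else I `*` J)) F z =
  \int[@lebesgue_measure R]_(t in J) \int[@lebesgue_measure R]_(s in I) F (put b s t).
Proof.
move=> mI mJ mF F0; set Q := (if b then _ else _).
have mQ : measurable Q by rewrite /Q; case: b @Q; exact: measurableX.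
rewrite integral_mkcond (tonelli b); last 2 first.
- exact/(measurable_restrictT _ mQ)/measurable_funTS.
- by move=> z; rewrite patchE; case: ifP.
rewrite [RHS]integral_mkcond; apply: eq_integral => t _.
rewrite patchE; case: ifPn => tJ.
  rewrite [RHS]integral_mkcond; apply: eq_integral => s _.
  rewrite !patchE /Q; congr (if _ then _ else _).
  apply/idP/idP; rewrite !inE; case: b @Q mQ => Q mQ /=; [by case|by case|..].
    by split => //; exact: set_mem.
  by split => //; exact: set_mem.
apply: integral0_eq => s _; rewrite patchE; case: ifPn => //; rewrite inE /Q.
by case: b @Q mQ => Q mQ /= [h1 h2]; move: tJ; rewrite notin_setE.
Qed.

End grid.

(** * Poincare's inequality on a square *)

Section poincare.
Variable R : realType.
Implicit Types (a c l N : R) (d f : R * R -> R) (b : bool).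
Local Open Scope ereal_scope.

Lemma bounded_cell_integrable f a c l : (0 <= l)%R -> continuous f ->
  (mu2 R).-integrable (cell a c l) (EFin \o f).
Proof.
move=> l0 cf.
have sub : cell a c l `<=` `[a, (a + l)%R] `*` `[c, (c + l)%R].
  move=> [x y] [/=]; rewrite /side/= !in_itv/= => /andP[h1 h2] /andP[h3 h4].
  by split; apply/andP; split => //; exact: ltW.
have cK : compact ((`[a, (a + l)%R] : set R) `*` (`[c, (c + l)%R] : set R)).
  by apply: compact_setX; exact: segment_compact.
have [M M0 fM] := continuous_bounded_on cf cK.
have mc := measurable_cell a c l.
have mf : measurable_fun (cell a c l) (fun z => (`|f z|)%:E).
  apply/measurable_EFinP; apply: measurableT_comp => //; apply: measurable_funTS.
  exact: continuous_measurable_plane.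
apply/integrableP; split.
  by apply/measurable_EFinP; apply: measurable_funTS; exact: continuous_measurable_plane.
apply: (@le_lt_trans _ _ (\int[mu2 R]_(z in cell a c l) (cst M%:E z))).
  by apply: ge0_le_integral => // z /sub /fM h; rewrite lee_fin.
rewrite [X in X < _]integral_cst; last exact: mc.
by rewrite [X in _ * X](mu2_cell a c l0) -EFinM ltry.
Qed.

Lemma measurable_tonelli_side b (S : set R) (F : R * R -> \bar R) : measurable S ->
  measurable_fun setT F -> (forall z, 0 <= F z) ->
  measurable_fun setT (fun t => \int[@lebesgue_measure R]_(s in S) F (put b s t)).
Proof.
move=> mS mF F0; pose Q : set (R * R) := if b then setT `*` S else S `*` setT.
have mQ : measurable Q by rewrite /Q; case: (b); exact: measurableX.
have mFQ : measurable_fun setT (F \_ Q).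
  by apply/(measurable_restrictT _ mQ); exact: measurable_funTS.
have FQ0 z : 0 <= (F \_ Q) z by rewrite patchE; case: ifP.
rewrite (_ : (fun t => _) = fun t => \int[@lebesgue_measure R]_s (F \_ Q) (put b s t)).
  exact: (@measurable_tonelli R b _ mFQ FQ0).
apply/funext => t; rewrite integral_mkcond; congr integral; apply/funext => s.
rewrite !patchE /Q; congr (if _ then _ else _).
by apply/idP/idP; rewrite !inE; case: (b) => /=; [|by move=> ?; split|case|case].
Qed.

Lemma poincare_algebra (X A B l k : \bar R) :
  0 <= X -> 0 <= A -> 0 <= B -> 0 <= l ->
  (X + l * B) * k + k * (l * A) <= k * (X + l * (A + B)) .
Proof.
move=> X0 A0 B0 l0; rewrite [_ * k]muleC.
by rewrite -ge0_muleDr ?adde_ge0 ?mule_ge0// (ge0_muleDr _ A0 B0) (addeC (l * A)) addeA.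
Qed.

(** Two points of a square are joined by a horizontal and a vertical segment, along
    which d varies by at most A(y) + B(x'), the integrals of the partial derivatives
    over a row and over a column.  Averaging over the second point compares d with its
    mean, and averaging over the first one gives the inequality. *)
Lemma poincare_cell d a c l : (0 < l)%R -> C1 d ->
  \int[mu2 R]_(z in cell a c l) `|d z|%:E <=
  `|\int[mu2 R]_(z in cell a c l) (d z)%:E| +
   l%:E * (\int[mu2 R]_(z in cell a c l) `|'D_(dir R false) d z|%:E +
           \int[mu2 R]_(z in cell a c l) `|'D_(dir R true) d z|%:E).
Proof.
move=> l0 cd; set Q := cell a c l.
have l0' := ltW l0.
have mQ : measurable Q := measurable_cell a c l.
have muQ : mu2 R Q = (l * l)%:E := mu2_cell a c l0'.
pose I := side a l; pose J := side c l.
have mI : measurable I := measurable_side a l.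
have mJ : measurable J := measurable_side c l.
have md : measurable_fun setT d by apply: continuous_measurable_plane; exact: cd.1.
have mD b : measurable_fun setT (fun z => `|'D_(dir R b) d z|%:E).
  apply/measurable_EFinP; apply: measurableT_comp => //.
  by apply: continuous_measurable_plane; exact: (cd.2 b).2.
have D0 b z : 0 <= `|'D_(dir R b) d z|%:E by [].
pose A (y : R) := \int[@lebesgue_measure R]_(s in I) `|'D_(dir R false) d (put false s y)|%:E.
pose B (x : R) := \int[@lebesgue_measure R]_(t in J) `|'D_(dir R true) d (put true t x)|%:E.
have A0 y : 0 <= A y by exact: integral_ge0.
have B0 x : 0 <= B x by exact: integral_ge0.
have QI (x y : R) : Q (x, y) <-> I x /\ J y by [].
have dAB x y x' y' : Q (x, y) -> Q (x', y') -> `|d (x, y) - d (x', y')|%:E <= A y + B x'.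
  move=> [/= Ix Jy] [/= Ix' Jy'].
  apply: (@le_trans _ _ (`|d (x, y) - d (x', y)|%:E + `|d (x', y) - d (x', y')|%:E)).
    by rewrite -EFinD lee_fin (le_trans _ (ler_normD _ _))// addrA subrK.
  by apply: leeD; [apply: (line_le false y cd)|apply: (line_le true x' cd)].
pose D1 := \int[mu2 R]_(z in Q) `|'D_(dir R false) d z|%:E.
pose D2 := \int[mu2 R]_(z in Q) `|'D_(dir R true) d z|%:E.
have IA : \int[@lebesgue_measure R]_(y in J) A y = D1.
  exact: (esym (@tonelli_rect R false I J _ mI mJ (mD false) (D0 false))).
have IB : \int[@lebesgue_measure R]_(x in I) B x = D2.
  exact: (esym (@tonelli_rect R true J I _ mJ mI (mD true) (D0 true))).
have mA : measurable_fun setT A := measurable_tonelli_side false mI (mD false) (D0 false).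
have mB : measurable_fun setT B := measurable_tonelli_side true mJ (mD true) (D0 true).
have mA2 : measurable_fun setT (fun z : R * R => A z.2).
  by apply: (measurableT_comp mA); exact: measurable_snd.
have mB1 : measurable_fun setT (fun z : R * R => B z.1).
  by apply: (measurableT_comp mB); exact: measurable_fst.
have mB1Q : measurable_fun Q (fun z : R * R => B z.1) := measurable_funTS mB1.
have mA2Q : measurable_fun Q (fun z : R * R => A z.2) := measurable_funTS mA2.
have D10 : 0 <= D1 by exact: integral_ge0.
have D20 : 0 <= D2 by exact: integral_ge0.
have cstI (k : \bar R) : \int[@lebesgue_measure R]_(x in I) k = k * l%:E.
  by rewrite integral_cst// [X in _ * X](lebesgue_side a l0').
have cstJ (k : \bar R) : \int[@lebesgue_measure R]_(x in J) k = k * l%:E.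
  by rewrite integral_cst// [X in _ * X](lebesgue_side c l0').
have cstQ (k : \bar R) : \int[mu2 R]_(x in Q) k = k * (l * l)%:E.
  by rewrite integral_cst// [X in _ * X]muQ.
have IQA : \int[mu2 R]_(z in Q) A z.2 = l%:E * D1.
  rewrite (@tonelli_rect R true J I _ mJ mI mA2); last by move=> z; exact: A0.
  transitivity (\int[@lebesgue_measure R]_(t in I) D1).
    by apply: eq_integral => t _; exact: IA.
  exact: (etrans (cstI D1) (muleC _ _)).
have IQB : \int[mu2 R]_(z in Q) B z.1 = l%:E * D2.
  rewrite (@tonelli_rect R false I J _ mI mJ mB1); last by move=> z; exact: B0.
  transitivity (\int[@lebesgue_measure R]_(t in J) D2).
    by apply: eq_integral => t _; exact: IB.
  exact: (etrans (cstJ D2) (muleC _ _)).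
set Id := \int[mu2 R]_(z in Q) (d z)%:E.
clear IA IB mA mB; clearbody A B.
have intd : (mu2 R).-integrable Q (EFin \o d) := bounded_cell_integrable a c l0' cd.1.
have Idfin : Id \is a fin_num by apply: (@integrable_fin_num _ _ R (mu2 R) Q mQ (EFin \o d) intd).
(* l^2 d(z) is the integral of d over Q plus that of d(z) - d *)
have step z : Q z -> (l * l)%:E * `|d z|%:E <= `|Id| + ((l * l)%:E * A z.2 + l%:E * D2).
  move=> Qz.
  have intk : (mu2 R).-integrable Q (EFin \o cst (d z)).
    by apply: bounded_cell_integrable => //; exact: cst_continuous.
  have E : (l * l)%:E * (d z)%:E = Id + \int[mu2 R]_(w in Q) (d z - d w)%:E.
    have -> : \int[mu2 R]_(w in Q) (d z - d w)%:E = (d z)%:E * (l * l)%:E - Id.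
      have <- := cstQ (d z)%:E.
      transitivity (\int[mu2 R]_(w in Q) ((EFin \o cst (d z)) w - (EFin \o d) w)).
        by apply: eq_integral => w _; rewrite /= EFinB.
      exact: (@integralB _ _ R (mu2 R) Q mQ (EFin \o cst (d z)) (EFin \o d) intk intd).
    by rewrite addeC subeK ?Idfin// muleC.
  have -> : (l * l)%:E * `|d z|%:E = `|(l * l)%:E * (d z)%:E|.
    by rewrite -!EFinM abse_EFin normrM ger0_norm// mulr_ge0.
  rewrite E; apply: (le_trans (lee_abs_add _ _)); apply: leeD2l.
  have mdw : measurable_fun Q (fun w => (d z - d w)%:E).
    by apply/measurable_EFinP; apply: measurable_funB => //; exact: measurable_funTS.
  apply: (@le_trans _ _ (\int[mu2 R]_(w in Q) `|(d z - d w)%:E|)).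
    exact: (@le_abse_integral _ _ R (mu2 R) Q (fun w => (d z - d w)%:E) mQ mdw).
  apply: (@le_trans _ _ (\int[mu2 R]_(w in Q) (A z.2 + B w.1))).
    apply: ge0_le_integral => //.
    - exact: measurableT_comp.
    - by apply: emeasurable_funD; [exact: measurable_cst|exact: mB1Q].
    - move=> w Qw; rewrite abse_EFin.
      by move: z w Qz Qw {E intk mdw} => [x y] [x' y']; exact: dAB.
  rewrite ge0_integralD//.
  by rewrite cstQ IQB muleC.
have ll0 : (0 < l * l)%R by exact: mulr_gt0.
rewrite -(@lee_pmul2l _ (l * l)%:E)//.
have mdQ : measurable_fun Q (fun z => `|d z|%:E).
  by apply/measurable_EFinP; apply: measurableT_comp => //; exact: measurable_funTS.
have ll0' : 0 <= (l * l)%:E by rewrite lee_fin ltW.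
have l0E : 0 <= l%:E by rewrite lee_fin.
rewrite -ge0_integralZl//.
apply: (@le_trans _ _ (\int[mu2 R]_(z in Q) ((`|Id| + l%:E * D2) + (l * l)%:E * A z.2))).
  apply: ge0_le_integral => //.
  - by move=> z _; rewrite mule_ge0.
  - by apply: emeasurable_funM; [exact: measurable_cst|exact: mdQ].
  - by apply: emeasurable_funD; [exact: measurable_cst|apply: emeasurable_funM; [exact: measurable_cst|exact: mA2Q]].
  - by move=> z Qz; apply: (le_trans (step z Qz)); rewrite -addeA (addeC (_ * A _)).
have kpos : 0 <= `|Id| + l%:E * D2 by rewrite adde_ge0// mule_ge0.
rewrite ge0_integralD//; last 2 first.
- by move=> z _; rewrite mule_ge0.
- by apply: emeasurable_funM; [exact: measurable_cst|exact: mA2Q].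
rewrite ge0_integralZl//.
rewrite (cstQ (`|Id| + l%:E * D2)) IQA.
exact: (@poincare_algebra `|Id| D1 D2 l%:E (l * l)%:E (abse_ge0 _) D10 D20 l0E).
Qed.

End poincare.

(** * Rellich's theorem *)

Section rellich.
Variable R : realType.
Implicit Types (d f : R * R -> R) (b : bool) (p q K : R).

Lemma C1B (f g : R * R -> R) : C1 f -> C1 g -> C1 (f \- g).
Proof.
move=> [cf df] [cg dg]; split; first by move=> z; apply: cvgB; [exact: cf|exact: cg].
move=> b; have [h1 h2] := df b; have [h3 h4] := dg b; split.
  by move=> z; exact: derivableB.
have -> : 'D_(dir R b) (f \- g) = fun z => 'D_(dir R b) f z - 'D_(dir R b) g z.
  by apply/funext => z; rewrite -deriveB.
by move=> z; apply: cvgB; [exact: h2|exact: h4].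
Qed.

Lemma ultra_bounded_cvg (U : set_system nat) (u : nat -> R) (M : R) :
  UltraFilter U -> (forall n, `|u n| <= M) ->
  exists c, forall e, 0 < e -> U [set n | `|u n - c| <= e].
Proof.
move=> UU uM.
have PU : ProperFilter U by exact: ultra_proper.
have cK : compact (`[- M, M]%classic : set R) by exact: segment_compact.
have [|c [_ clc]] := cK (u @ U) _.
  by apply: (@filterE _ U) => n; rewrite /= in_itv/= -ler_norml; exact: uM.
exists c => e e0; have [//|nU] := in_ultra_setVsetC [set n | `|u n - c| <= e] UU.
have [] := clc (u @` (~` [set n | `|u n - c| <= e])) (ball c e).
- by change (U (u @^-1` (u @` (~` [set n | `|u n - c| <= e])))); apply: filterS nU => n nn /=; exists n.
- exact: nbhsx_ballx.
- move=> _ [[n /= ne <-]]; rewrite /ball/= => be; exfalso; apply: ne.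
  by rewrite distrC ltW.
Qed.

Lemma norm_le1D_powR (x p : R) : 1 <= p -> `|x| <= 1 + `|x| `^ p.
Proof.
move=> p1; have [h|h] := leP `|x| 1; first by rewrite (le_trans h)// lerDl powR_ge0.
by rewrite (le_trans (le1r_powR (ltW h) p1))// lerDr.
Qed.

Local Open Scope ereal_scope.

Lemma integral_norm_le (Q : set (R * R)) f p (m K : R) : measurable Q -> (1 <= p)%R ->
  measurable_fun setT f -> mu2 R Q <= m%:E ->
  \int[mu2 R]_z (`|f z| `^ p)%:E <= K%:E ->
  \int[mu2 R]_(z in Q) `|f z|%:E <= (m + K)%:E.
Proof.
move=> mQ p1 mf Qm fK.
have mfQ : measurable_fun Q f := measurable_funTS mf.
apply: (@le_trans _ _ (\int[mu2 R]_(z in Q) (1 + (`|f z| `^ p)%:E))).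
  apply: ge0_le_integral => //.
  - by apply/measurable_EFinP; exact: measurableT_comp.
  - by apply: emeasurable_funD => //; exact: measurable_normpowE.
  - by move=> z _; rewrite -EFinD lee_fin norm_le1D_powR.
rewrite ge0_integralD//; last exact: measurable_normpowE.
rewrite integral_cst// mul1e EFinD; apply: leeD => //.
apply: le_trans fK; apply: ge0_subset_integral => //.
exact: measurable_normpowE.
Qed.

Lemma sum2_distrr k (l : \bar R) (a b : 'I_k -> 'I_k -> \bar R) :
  (forall i j, 0 <= a i j) -> (forall i j, 0 <= b i j) ->
  \sum_(i < k) \sum_(j < k) l * (a i j + b i j) =
  l * (\sum_(i < k) \sum_(j < k) a i j + \sum_(i < k) \sum_(j < k) b i j).
Proof.
move=> a0 b0; rewrite -big_split/= ge0_sume_distrr; last first.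
  by move=> i _; apply: adde_ge0; apply: sume_ge0.
apply: eq_bigr => i _; rewrite -big_split/= ge0_sume_distrr// => j _.
exact: adde_ge0.
Qed.

(** Along an ultrafilter the integral of eta_n over each of the finitely many cells
    of a grid has a limit.  For n and m in a set of the ultrafilter these integrals
    nearly agree, and Poincare's inequality bounds the rest by the side of the cells
    times a bound on the gradients. *)
Lemma rellich_close (U : set_system nat) (eta : nat -> R * R -> R) (N : nat) (e p q K : R) :
  UltraFilter U -> (forall n, C1 (eta n)) -> (0 < e)%R -> (1 <= p)%R -> (1 <= q)%R -> (0 <= K)%R ->
  (forall n b, \int[mu2 R]_z (`|'D_(dir R b) (eta n) z| `^ p)%:E <= K%:E) ->
  (forall n, \int[mu2 R]_z (`|eta n z| `^ q)%:E <= K%:E) ->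
  exists A, U A /\ forall n m, A n -> A m ->
    \int[mu2 R]_(z in hbox N.+1%:R) `|eta n z - eta m z|%:E <= e%:E.
Proof.
move=> UU ceta e0 p1 q1 K0 DK etaK.
have PU : ProperFilter U by exact: ultra_proper.
pose M := N.+1%:R : R; have M0 : (0 < M)%R by rewrite ltr0n.
pose C := ((2 * M) * (2 * M) + K)%R.
have C0 : (0 <= C)%R by rewrite addr_ge0// mulr_ge0 ?mulr_ge0 ?ltW.
(* the number of rows makes the gradient term, at most 4 C l, smaller than e/2 *)
pose k := (Num.truncn (16 * M * C / e)).+1.
pose l := (2 * M / k%:R)%R.
have k0 : (0 < k%:R :> R)%R by rewrite ltr0n.
have l0 : (0 < l)%R by rewrite divr_gt0// mulr_gt0.
have lC : (l * (4 * C) <= e / 2)%R.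
  have : (16 * M * C / e < k%:R)%R by exact: truncnS_gt.
  rewrite ltr_pdivrMr// => h.
  by rewrite /l mulrAC ler_pdivrMr//; lra.
have mc n := continuous_measurable_plane (ceta n).1.
have mD n b := continuous_measurable_plane ((ceta n).2 b).2.
have muh : mu2 R (hbox M) = (2 * M * (2 * M))%:E by rewrite mu2_cell// mulr_ge0// ltW.
have mh : measurable (hbox M) by exact: measurable_cell.
have DC n b : \int[mu2 R]_(z in hbox M) `|'D_(dir R b) (eta n) z|%:E <= C%:E.
  by apply: (integral_norm_le mh p1 (mD n b) _ (DK n b)); rewrite [X in X <= _]muh.
pose I (i j : 'I_k) n := fine (\int[mu2 R]_(z in gcell M i j) (eta n z)%:E).
have inte n (i j : 'I_k) : (mu2 R).-integrable (gcell M i j) (EFin \o eta n).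
  by apply: bounded_cell_integrable; [exact: ltW|exact: (ceta n).1].
have mg (i j : 'I_k) : measurable (gcell M i j) by exact: measurable_cell.
have intf n (i j : 'I_k) : \int[mu2 R]_(z in gcell M i j) (eta n z)%:E \is a fin_num.
  exact: (@integrable_fin_num _ _ R (mu2 R) (gcell M i j) (mg i j) (EFin \o eta n) (inte n i j)).
have Ibound i j n : (`|I i j n| <= l * l + K)%R.
  rewrite -lee_fin -abse_EFin /I fineK//.
  apply: (@le_trans _ _ (\int[mu2 R]_(z in gcell M i j) `|(eta n z)%:E|)).
    apply: (@le_abse_integral _ _ R (mu2 R) (gcell M i j) (fun z => (eta n z)%:E) (mg i j)).
    by apply/measurable_EFinP; exact: (measurable_funTS (mc n)).
  apply: (integral_norm_le (mg i j) q1 (mc n) _ (etaK n)).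
  by rewrite [X in X <= _](mu2_cell _ _ (ltW l0)).
(* k^2 cells contribute at most 2 dl each, which adds up to e/2 *)
pose dl := (e / (4 * (k%:R * k%:R)))%R.
have dl0 : (0 < dl)%R by rewrite divr_gt0// !mulr_gt0.
have lim (ij : 'I_k * 'I_k) : exists c, U [set n | `|I ij.1 ij.2 n - c| <= dl]%R.
  by have [c h] := ultra_bounded_cvg UU (Ibound ij.1 ij.2); exists c; exact: h.
have [c cP] := choice lim.
exists [set n | forall ij, `|I ij.1 ij.2 n - c ij| <= dl]%R; split.
  exact: filter_forall.
move=> n m An Am.
have cd : C1 (eta n \- eta m)%R by exact: C1B.
have Dd b z : 'D_(dir R b) (eta n \- eta m)%R z =
    ('D_(dir R b) (eta n) z - 'D_(dir R b) (eta m) z)%R.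
  by rewrite -deriveB//; [exact: ((ceta n).2 b).1|exact: ((ceta m).2 b).1].
have md : measurable_fun setT (fun z => `|(eta n \- eta m)%R z|%:E).
  by apply/measurable_EFinP; apply: measurableT_comp => //; exact: measurable_funB.
have mDd b : measurable_fun setT (fun z => `|'D_(dir R b) (eta n \- eta m)%R z|%:E).
  apply/measurable_EFinP; apply: measurableT_comp => //.
  by apply: continuous_measurable_plane; exact: (cd.2 b).2.
have DdC b : \int[mu2 R]_(z in hbox M) `|'D_(dir R b) (eta n \- eta m)%R z|%:E <= C%:E + C%:E.
  have h1 : measurable_fun (hbox M) (fun z => `|'D_(dir R b) (eta n) z|%:E).
    by apply/measurable_EFinP; apply: measurableT_comp => //; apply: measurable_funTS; exact: mD.
  have h2 : measurable_fun (hbox M) (fun z => `|'D_(dir R b) (eta m) z|%:E).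
    by apply/measurable_EFinP; apply: measurableT_comp => //; apply: measurable_funTS; exact: mD.
  apply: (@le_trans _ _ (\int[mu2 R]_(z in hbox M)
     (`|'D_(dir R b) (eta n) z|%:E + `|'D_(dir R b) (eta m) z|%:E))).
    apply: ge0_le_integral => //.
    - exact: (measurable_funTS (mDd b)).
    - exact: emeasurable_funD.
    - by move=> z _; rewrite Dd -EFinD lee_fin; exact: ler_normB.
  by rewrite ge0_integralD//; apply: leeD; exact: DC.
rewrite -/M (@grid_sum _ M k (fun z => `|(eta n \- eta m)%R z|%:E) (ltn0Sn _) (ltW M0) md)//.
have cellb (i j : 'I_k) : \int[mu2 R]_(z in gcell M i j) `|(eta n \- eta m)%R z|%:E <=
   (2 * dl)%:E + l%:E * (\int[mu2 R]_(z in gcell M i j) `|'D_(dir R false) (eta n \- eta m)%R z|%:E +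
     \int[mu2 R]_(z in gcell M i j) `|'D_(dir R true) (eta n \- eta m)%R z|%:E).
  have P := @poincare_cell R (eta n \- eta m)%R (- M + i%:R * l)%R (- M + j%:R * l)%R l l0 cd.
  have gE : cell (- M + i%:R * l)%R (- M + j%:R * l)%R l = gcell M i j by [].
  rewrite gE in P.
  apply: (le_trans P); apply: leeD2r.
  have -> : \int[mu2 R]_(z in gcell M i j) ((eta n \- eta m)%R z)%:E = (I i j n - I i j m)%:E.
    rewrite EFinB /I !fineK//.
    exact: (@integralB_EFin _ _ R (mu2 R) (gcell M i j) (eta n) (eta m) (mg i j) (inte n i j) (inte m i j)).
  rewrite abse_EFin lee_fin.
  have := An (i, j); have := Am (i, j) => /= h1 h2.
  have -> : (I i j n - I i j m = (I i j n - c (i, j)) - (I i j m - c (i, j)))%R by ring.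
  by apply: (le_trans (ler_normB _ _)); lra.
apply: (@le_trans _ _ (\sum_(i < k) \sum_(j < k) ((2 * dl)%:E + l%:E * (\int[mu2 R]_(z in gcell M i j) `|'D_(dir R false) (eta n \- eta m)%R z|%:E +
     \int[mu2 R]_(z in gcell M i j) `|'D_(dir R true) (eta n \- eta m)%R z|%:E)))).
  by apply: lee_sum => i _; apply: lee_sum => j _; exact: cellb.
under eq_bigr do rewrite big_split/=.
rewrite big_split/=.
have -> : \sum_(i < k) \sum_(j < k) (2 * dl)%:E = (e / 2)%:E.
  under eq_bigr do rewrite sumEFin.
  rewrite sumEFin; congr EFin; rewrite !sumr_const !card_ord -mulrnA -[LHS]mulr_natr natrM /dl.
  by field; rewrite gt_eqF.
have e2 : e%:E = (e / 2)%:E + (e / 2)%:E by rewrite -EFinD; congr EFin; lra.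
rewrite e2; apply: leeD2l.
have int0 b (i j : 'I_k) : 0 <= \int[mu2 R]_(z in gcell M i j) `|'D_(dir R b) (eta n \- eta m)%R z|%:E.
  by apply: integral_ge0.
have G b : \sum_(i < k) \sum_(j < k) \int[mu2 R]_(z in gcell M i j) `|'D_(dir R b) (eta n \- eta m)%R z|%:E <= C%:E + C%:E.
  apply: le_trans (DdC b).
  by rewrite (@grid_sum _ M k (fun z => `|'D_(dir R b) (eta n \- eta m)%R z|%:E) (ltn0Sn _) (ltW M0) (mDd b)).
have -> : \sum_(i < k) \sum_(j < k) (l%:E * (\int[mu2 R]_(z in gcell M i j) `|'D_(dir R false) (eta n \- eta m)%R z|%:E +
     \int[mu2 R]_(z in gcell M i j) `|'D_(dir R true) (eta n \- eta m)%R z|%:E)) =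
  l%:E * (\sum_(i < k) \sum_(j < k) \int[mu2 R]_(z in gcell M i j) `|'D_(dir R false) (eta n \- eta m)%R z|%:E +
     \sum_(i < k) \sum_(j < k) \int[mu2 R]_(z in gcell M i j) `|'D_(dir R true) (eta n \- eta m)%R z|%:E).
  exact: (@sum2_distrr k l%:E
    (fun i j => \int[mu2 R]_(z in gcell M i j) `|'D_(dir R false) (eta n \- eta m)%R z|%:E)
    (fun i j => \int[mu2 R]_(z in gcell M i j) `|'D_(dir R true) (eta n \- eta m)%R z|%:E)
    (int0 false) (int0 true)).
apply: (@le_trans _ _ (l%:E * ((C%:E + C%:E) + (C%:E + C%:E)))).
  by apply: lee_wpmul2l; [rewrite lee_fin ltW|apply: leeD; exact: G].
by rewrite -!EFinD -EFinM lee_fin; apply: le_trans lC; lra.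
Qed.

End rellich.

Section extraction.
Variable R : realType.
Implicit Types (p q K : R).
Local Open Scope ereal_scope.

(** Since the A i belong to one filter, any finite number of them can be met at once,
    beyond any index; this replaces a diagonal argument. *)
Lemma ultra_extract (A : nat -> set nat) (U : set_system nat) :
  UltraFilter U -> \oo `<=` U -> (forall j, U (A j)) ->
  exists k : nat -> nat, {homo k : m n / (m < n)%N} /\
    forall i j, (i <= j)%N -> A i (k j).
Proof.
move=> UU Uoo UA; have PU : ProperFilter U by exact: ultra_proper.
have step j m : exists n, (m < n)%N /\ forall i, (i <= j)%N -> A i n.
  have h1 : U [set n | (m < n)%N] by apply: Uoo; exact: nbhs_infty_gt.
  have h2 : U [set n | forall i : 'I_j.+1, A i n] by apply: filter_forall => i; exact: UA.
  have [n [/= mn An]] := filter_ex (filterI h1 h2).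
  by exists n; split => // i ij; exact: (An (Ordinal (ij : (i < j.+1)%N))).
have [s sP] := choice (fun jm : nat * nat => step jm.1 jm.2).
pose k := fix k j := if j is j'.+1 then s (j'.+1, k j') else s (0, 0)%N.
exists k; split.
- apply: homo_ltn => [y x z|j]; first exact: ltn_trans.
  exact: (sP (j.+1, k j)).1.
- by move=> i [|j] ij; apply: (sP (_, _)).2.
Qed.

Lemma hbox_exhaust (z : R * R) : exists N : nat, hbox N.+1%:R z.
Proof.
case: z => x y; pose N := Num.truncn (`|x| + `|y|)%R.
have := truncnS_gt (`|x| + `|y|)%R; rewrite -/N => h.
have x0 := normr_ge0 x; have y0 := normr_ge0 y.
have : (`|x| < N.+1%:R)%R by lra.
have : (`|y| < N.+1%:R)%R by lra.
rewrite !ltr_norml => /andP[h1 h2] /andP[h3 h4].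
by exists N; split; rewrite /side/= in_itv/=; apply/andP; split; lra.
Qed.

(** Consecutive terms of the subsequence are 2^-j close in L_1 on boxes that grow with
    j, so that on each box the series of their differences converges almost
    everywhere. *)
Lemma rellich_ae (eta : nat -> R * R -> R) p q K :
  (forall n, C1 (eta n)) -> (1 <= p)%R -> (1 <= q)%R -> (0 <= K)%R ->
  (forall n b, \int[mu2 R]_z (`|'D_(dir R b) (eta n) z| `^ p)%:E <= K%:E) ->
  (forall n, \int[mu2 R]_z (`|eta n z| `^ q)%:E <= K%:E) ->
  exists k : nat -> nat, {homo k : m n / (m < n)%N} /\
    {ae mu2 R, forall z, cvgn (fun j => eta (k j) z)}.
Proof.
move=> ceta p1 q1 K0 DK etaK.
(* one ultrafilter serves all boxes and all precisions *)
have [U [UU Uoo]] := ultraFilterLemma (F := \oo : set_system nat) _.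
have close N : exists A, U A /\ forall n m, A n -> A m ->
    \int[mu2 R]_(z in hbox N.+1%:R) `|eta n z - eta m z|%:E <= ((2^-1) ^+ N)%:E.
  by apply: (rellich_close N UU ceta _ p1 q1 K0 DK etaK); rewrite exprn_gt0// invr_gt0.
have [A /all_and2[UA AP]] := choice close.
have [k [kh kA]] := ultra_extract UU Uoo UA.
exists k; split => //.
have mc n := continuous_measurable_plane (ceta n).1.
pose F N j z := `|eta (k (N + j)%N.+1) z - eta (k (N + j)%N) z|%R.
have mF N j D : measurable_fun D (F N j).
  by apply: measurable_funTS; apply: measurableT_comp => //; exact: measurable_funB.
have aeN N : {ae mu2 R, forall z, hbox N.+1%:R z -> cvgn (series (fun j => F N j z))}.
  apply: fast_cvg_ae; [exact: measurable_cell|by move=> n; exact: mF|by move=> *; exact: normr_ge0|].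
  move=> j.
  have sub : (hbox N.+1%:R : set (R * R)) `<=` hbox (N + j).+1%:R.
    have le : (N.+1%:R <= (N + j).+1%:R :> R)%R by rewrite ler_nat ltnS leq_addr.
    move=> [x y] [/=]; rewrite /side/= !in_itv/= => /andP[h1 h2] /andP[h3 h4].
    by split; rewrite /side/= in_itv/=; apply/andP; split; lra.
  apply: (@le_trans _ _ (\int[mu2 R]_(z in hbox (N + j).+1%:R) (F N j z)%:E)).
    apply: ge0_subset_integral => //; [exact: measurable_cell|exact: measurable_cell| |].
      by apply/measurable_EFinP; exact: mF.
    by move=> w _; rewrite lee_fin /F normr_ge0.
  apply: (le_trans (AP (N + j)%N _ _ (kA _ _ _) (kA _ _ _))) => //.
  rewrite lee_fin; apply: ler_wiXn2l; rewrite ?invr_ge0//; first by rewrite invf_le1// ler1n.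
  exact: leq_addl.
have : {ae mu2 R, forall z N, hbox N.+1%:R z -> cvgn (series (fun j => F N j z))}.
  by apply: ae_foralln.
apply: filterS => z h; have [N Nz] := hbox_exhaust z.
have := normed_cvg (h N Nz).
move=> c; apply/(cvg_ex _).2.
have E j : eta (k (N + j)%N) z = (eta (k N) z + series (fun j => eta (k (N + j)%N.+1) z - eta (k (N + j)%N) z) j)%R.
  elim: j => [|j IH]; first by rewrite addn0 /series/= big_geq// addr0.
  by rewrite /series/= big_nat_recr//= addrA -IH addnS addrC subrK.
have /cvg_ex[l cl] := c.
exists (eta (k N) z + l)%R.
rewrite -(cvg_shiftn N).
have -> : (fun n => eta (k (n + N)%N) z) = (fun j => eta (k N) z + series (fun j => eta (k (N + j)%N.+1) z - eta (k (N + j)%N) z) j)%R.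
  by apply/funext => j; rewrite addnC E.
by apply: cvgD => //; exact: cvg_cst.
Qed.

End extraction.

(** * Compactness of the embedding for an integrable power of the weight *)

Section compact_embedding.
Variable R : realType.
Implicit Types (f g h eta : R * R -> R) (Om : set (R * R)) (p q r s K M : R).
Local Open Scope ereal_scope.

Lemma poweR_cvg0 (I : nat -> \bar R) (a : R) : (0 < a)%R -> (forall n, 0 <= I n) ->
  I @ \oo --> 0 -> (fun n => I n `^ a) @ \oo --> 0.
Proof.
move=> a0 I0 I_0; apply: ge0_cvg0 => [n|e e0]; first exact: poweR_ge0.
have d0 : (0 < e `^ a^-1)%R by rewrite powR_gt0.
apply: filterS (cvg0_near_le I0 I_0 d0) => n h.
have -> : e%:E = (e `^ a^-1)%:E `^ a by rewrite poweR_EFin -powRrM mulVf ?powRr1 ?(ltW e0)// gt_eqF.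
have H (x : \bar R) : 0 <= x -> x \in `[0, +oo] by move=> x0; rewrite in_itv/= x0 leey.
by apply: gt0_ler_poweR => //; rewrite ?(ltW a0)// H// lee_fin ltW.
Qed.

Lemma fast_approx_ae Om p (F : nat -> R * R -> R) : measurable Om -> (0 < p)%R ->
  (forall n, measurable_fun Om (F n)) ->
  (forall n, \int[mu2 R]_(z in Om) (`|F n z| `^ p)%:E <= ((2^-1) ^+ n)%:E) ->
  {ae mu2 R, forall z, Om z -> F ^~ z @ \oo --> (0%R : R)}.
Proof.
move=> mO p0 mF FI.
have : {ae mu2 R, forall z, Om z -> cvgn (series (fun n => `|F n z| `^ p)%R)}.
  by apply: fast_cvg_ae => // n; exact: measurable_normpow.
apply: filterS => z /[apply] /cvg_series_cvg_0 h.
exact: (cvg_normpow0 p0 h).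
Qed.

Lemma half_pow_gt0 n : (0 < (2^-1) ^+ n :> R)%R. Proof. by rewrite exprn_gt0// invr_gt0. Qed.

Lemma measurable_W1_0 Om p f : elements (W1_0 p Om) f -> measurable_fun Om f.
Proof. by case=> -[[]]. Qed.

Lemma W1_0_approx Om p M : open Om -> (1 < p < 2)%R -> (0 <= M)%R -> exists2 K, (0 <= K)%R &
  forall u : nat -> R * R -> R, (forall n, elements (W1_0 p Om) (u n)) ->
  (forall n, W1_norm p Om (u n) <= M%:E) ->
  exists eta : nat -> R * R -> R, [/\ forall n, test_function Om (eta n),
    {ae mu2 R, forall z, Om z -> (fun n => u n z - eta n z)%R @ \oo --> (0%R : R)},
    forall n b, \int[mu2 R]_z (`|'D_(dir R b) (eta n) z| `^ p)%:E <= K%:E &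
    forall n, \int[mu2 R]_z (`|eta n z| `^ (2 * p / (2 - p)))%:E <= K%:E].
Proof.
move=> oO p12 M0; have [K K0 KP] := approx_test oO p12 M0.
have mO := open_measurable_plane oO; have /andP[p1 p2] := p12.
exists K => // u Wu uM.
have ex n : exists eta, [/\ test_function Om eta,
    \int[mu2 R]_(z in Om) (`|u n z - eta z| `^ p)%:E <= ((2^-1) ^+ n)%:E,
    forall b, \int[mu2 R]_z (`|'D_(dir R b) eta z| `^ p)%:E <= K%:E &
    \int[mu2 R]_z (`|eta z| `^ (2 * p / (2 - p)))%:E <= K%:E].
  exact: (KP _ (Wu n) (uM n) _ (half_pow_gt0 n)).
have [eta etaP] := choice ex; exists eta; split.
- by move=> n; case: (etaP n).
- apply: (@fast_approx_ae _ p (fun n z => u n z - eta n z)%R) => //.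
  + by lra.
  + move=> n; apply: measurable_funB; first exact: (measurable_W1_0 (Wu n)).
    by have [te _ _ _] := etaP n; exact: test_measurable te.
  + by move=> n; case: (etaP n).
- by move=> n; case: (etaP n).
- by move=> n; case: (etaP n).
Qed.

Lemma W1_0_sobolev Om p M : open Om -> (1 < p < 2)%R -> (0 <= M)%R -> exists2 K, (0 <= K)%R &
  forall f, elements (W1_0 p Om) f -> W1_norm p Om f <= M%:E ->
  \int[mu2 R]_(z in Om) (`|f z| `^ (2 * p / (2 - p)))%:E <= K%:E.
Proof.
move=> oO p12 M0; have [K K0 KP] := W1_0_approx oO p12 M0.
have mO := open_measurable_plane oO; have /andP[p1 p2] := p12.
exists K => // f Wf fM.
have [eta [te ae0 _ etaK]] := KP (fun=> f) (fun=> Wf) (fun=> fM).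
have q0 : (0 < 2 * p / (2 - p))%R by rewrite divr_gt0; lra.
apply: (@fatou_ae _ _ eta _ _ _ mO (measurable_W1_0 Wf) q0).
- by move=> n; exact: (test_measurable (te n)).
- apply: filterS ae0 => z /[apply] h.
  have c := cvgB (cvg_cst (f z)) h; rewrite subr0 in c.
  rewrite (_ : eta ^~ z = (fun n => f z - (f z - eta n z))%R); first exact: c.
  by apply/funext => n; rewrite subKr.
- move=> n; apply: le_trans (etaK n); apply: ge0_subset_integral => //.
  have mt : measurable_fun setT (eta n) := test_measurable (te n).
  exact: measurable_normpowE.
Qed.

(** Young's inequality with e = 1. *)
Lemma weighted_L_mem Om q r s K h f : measurable Om -> (0 < r)%R -> (r < q)%R -> s = (q / (q - r))%R ->
  measurable_fun Om h -> (forall z, Om z -> 0 <= h z)%R ->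
  \int[mu2 R]_(z in Om) (h z `^ s)%:E < +oo ->
  measurable_fun Om f -> \int[mu2 R]_(z in Om) (`|f z| `^ q)%:E <= K%:E ->
  elements (weighted_L r Om h) f.
Proof.
move=> mO r0 rq sE mh h0 hs mf fK; split => //=; rewrite /L_norm; apply: poweR_lty.
have mhs : measurable_fun Om (fun z => (h z `^ s)%:E).
  apply/measurable_EFinP.
  by apply: (@measurableT_comp _ _ _ _ _ _ (fun x : R => x `^ s)%R) => //; exact: measurable_powR.
have mfq := measurable_normpowE q mf.
apply: (@le_lt_trans _ _ (\int[mu2 R]_(z in Om) ((`|f z| `^ q)%:E + (h z `^ s)%:E))).
  apply: ge0_le_integral => //.
  - by move=> z Oz; rewrite lee_fin mulr_ge0 ?powR_ge0 ?h0.
  - by apply/measurable_EFinP; apply: measurable_funM => //; exact: measurable_normpow.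
  - exact: emeasurable_funD.
  - move=> z Oz; rewrite -EFinD lee_fin.
    have := young_eps (ltr01 : 0 < 1 :> R)%R r0 rq sE (normr_ge0 (f z)) (h0 _ Oz).
    by rewrite invr1 powR1 !mul1r.
rewrite ge0_integralD//; last by move=> z _; rewrite lee_fin powR_ge0.
exact: (lte_add_pinfty (le_lt_trans fK (ltry _)) hs).
Qed.

(** Off a negligible set the sequence converges everywhere, and on that set it is
    replaced by 0, so that its pointwise limit is measurable. *)
Lemma ae_limit_measurable Om (F : nat -> R * R -> R) : measurable Om ->
  (forall n, measurable_fun Om (F n)) ->
  {ae mu2 R, forall z, Om z -> cvgn (F ^~ z)} ->
  exists g, measurable_fun Om g /\ {ae mu2 R, forall z, Om z -> F ^~ z @ \oo --> g z}.
Proof.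
move=> mO mF [N [mN N0 subN]].
have mON : measurable (Om `\` N) by exact: measurableD.
pose G n := (F n \_ (Om `\` N)).
have mG n : measurable_fun setT (G n).
  by apply/(measurable_restrictT _ mON); apply: measurable_funS (mF n) => //; exact: subDsetl.
have cF z : (Om `\` N) z -> cvgn (F ^~ z).
  by move=> [Oz nNz]; apply: contrapT => h; apply: nNz; apply: subN => /= /(_ Oz).
have cG z : cvgn (G ^~ z).
  have [h|h] := pselect ((Om `\` N) z).
    by rewrite (_ : G ^~ z = F ^~ z); [exact: cF|apply/funext => n; rewrite /G patchE mem_set].
  by rewrite (_ : G ^~ z = cst 0%R); [exact: is_cvg_cst|apply/funext => n; rewrite /G patchE memNset].
exists (fun z => lim (G ^~ z @ \oo)); split.
  apply: measurable_funTS; apply: (@measurable_fun_cvg _ _ _ _ G) => //.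
exists N; split; [exact: mN|exact: N0|].
move=> z /= h1; apply: contrapT => nNz; apply: h1 => Oz.
have -> : F ^~ z = G ^~ z by apply/funext => n; rewrite /G patchE mem_set.
exact: cG.
Qed.

Lemma increasing_cvg_infty (k : nat -> nat) : {homo k : m n / (m < n)%N} -> k @ \oo --> \oo.
Proof.
move=> kh; have ge j : (j <= k j)%N.
  by elim: j => // j IH; exact: leq_ltn_trans IH (kh _ _ (ltnSn j)).
by apply/cvgnyPge => A; exists A => // j /= Aj; exact: leq_trans (ge j).
Qed.

(** The limit of a subsequence is taken almost everywhere, and not in L_p; the
    bound in L_q passes to it by Fatou's lemma. *)
Lemma compact_embedding Om p r s h : open Om -> (1 < p < 2)%R ->
  (1 <= r)%R -> (r < 2 * p / (2 - p))%R ->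
  s = (2 * p / (2 - p) / (2 * p / (2 - p) - r))%R ->
  measurable_fun Om h -> (forall z, Om z -> 0 <= h z)%R ->
  \int[mu2 R]_(z in Om) (h z `^ s)%:E < +oo ->
  compact_operator (W1_0 p Om) (weighted_L r Om h) (fun f => f).
Proof.
move=> oO p12 r1; set q := (2 * p / (2 - p))%R => rq sE mh h0 hs.
have mO := open_measurable_plane oO; have /andP[p1 p2] := p12.
have r0 : (0 < r)%R by lra.
split => //.
- move=> f Wf; have [_ _ fM] := Wf.1.
  have f0 : 0 <= W1_norm p Om f by rewrite adde_ge0 ?poweR_ge0.
  have fE : W1_norm p Om f = (fine (W1_norm p Om f))%:E by rewrite fineK// ge0_fin_numE.
  have [K K0 KP] := W1_0_sobolev oO p12 (fine_ge0 f0).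
  apply: (weighted_L_mem mO r0 rq sE mh h0 hs (measurable_W1_0 Wf)).
  by apply: (KP f Wf); rewrite -fE.
- move=> B [BW [M0 BM0]] u uB.
  pose M := `|M0|%R; have M0' : (0 <= M)%R by exact: normr_ge0.
  have Wu n : elements (W1_0 p Om) (u n) by have [f Bf <-] := uB n; exact: BW.
  have uM n : W1_norm p Om (u n) <= M%:E.
    have [f Bf <-] := uB n; apply: (le_trans (BM0 f Bf)); rewrite lee_fin; exact: ler_norm.
  have mu n := measurable_W1_0 (Wu n).
  have [K1 K10 K1P] := W1_0_approx oO p12 M0'.
  have [K K0 KP] := W1_0_sobolev oO p12 M0'.
  have [eta [te ae0 Deta etaK]] := K1P u Wu uM.
  have q1 : (1 <= q)%R by lra.
  have ceta n : C1 (eta n) by have [s' _ _] := te n; exact: smooth_C1.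
  have [k [kh aek]] := rellich_ae ceta (ltW p1) q1 K10 Deta etaK.
  have koo := increasing_cvg_infty kh.
  have aeu : {ae mu2 R, forall z, Om z -> cvgn (fun j => u (k j) z)}.
    apply: filterS2 ae0 aek => z h1 h2 Oz.
    have h3 := cvg_comp _ _ koo (h1 Oz).
    rewrite (_ : (fun j => u (k j) z) =
      (fun j => (u (k j) z - eta (k j) z) + eta (k j) z)%R).
      exact: (is_cvgD (cvgP _ h3) h2).
    by apply/funext => j; rewrite subrK.
  have [g [mg gP]] := ae_limit_measurable mO (fun j => mu (k j)) aeu.
  have uK j := KP (u (k j)) (Wu _) (uM _).
  have gK := fatou_ae mO mg (lt_trans r0 rq) (fun j => mu (k j)) gP uK.
  exists k, g; split => //.
    exact: (weighted_L_mem mO r0 rq sE mh h0 hs mg gK).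
  apply: poweR_cvg0; first by rewrite invr_gt0.
    by move=> n; apply: integral_ge0 => z Oz; rewrite lee_fin mulr_ge0 ?powR_ge0 ?h0.
  exact: (weighted_cvg mO mg r0 rq sE (fun j => mu (k j)) gP uK mh h0 hs).
Qed.

End compact_embedding.

(** * Complex derivatives and inverse maps *)

Section conformal_maps.
Variable R : realType.
Implicit Types (A B : set (R * R)) (phi psi : R * R -> R * R) (z w : R * R).

Lemma ofCK : cancel (@ofC R) (@toC R). Proof. by case. Qed.
Lemma toCK : cancel (@toC R) (@ofC R). Proof. by case. Qed.

Lemma normcE (x : R[i]^o) : `|x| = ((modulus x)%:C)%C.
Proof. by []. Qed.

Lemma modulus_ge0 (x : R[i]) : 0 <= modulus x.
Proof. by case: x => a b; exact: sqrtr_ge0. Qed.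

Lemma modulus_gt0 (x : R[i]) : x != 0 -> 0 < modulus x.
Proof. by rewrite -(@normr_gt0 _ (R[i]^o)) normcE ltcR. Qed.

(** The norm of the plane is the maximum of the two coordinates; it is compared with
    the modulus here and in the next lemma. *)
Lemma modulus_ofC_le (x : R[i]) : `|ofC x| <= modulus x.
Proof.
case: x => a b; rewrite prod_normE/= ge_max; apply/andP; split.
  by rewrite -sqrtr_sqr ler_wsqrtr// lerDl sqr_ge0.
by rewrite -sqrtr_sqr ler_wsqrtr// lerDr sqr_ge0.
Qed.

Lemma modulus_le_ofC (x : R[i]) : modulus x <= 2 * `|ofC x|.
Proof.
case: x => a b; rewrite prod_normE /modulus /=; set m := Num.max _ _.
have am : `|a| <= m by rewrite le_max lexx.
have bm : `|b| <= m by rewrite le_max lexx orbT.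
have m0 : 0 <= m by exact: le_trans am.
rewrite -[leRHS]ger0_norm ?mulr_ge0// -sqrtr_sqr ler_wsqrtr//.
have ha : a ^+ 2 <= m ^+ 2 by rewrite -real_normK ?num_real// ler_sqr ?nnegrE.
have hb : b ^+ 2 <= m ^+ 2 by rewrite -real_normK ?num_real// ler_sqr ?nnegrE.
have : 0 <= m ^+ 2 by exact: sqr_ge0.
rewrite exprMn; lra.
Qed.

Lemma toC_cvg (T : Type) (F : set_system T) {FF : Filter F} (f : T -> R * R) w :
  f @ F --> w -> (fun t => toC (f t) : R[i]^o) @ F --> (toC w : R[i]^o).
Proof.
move=> /cvgrPdist_lt fw; apply/cvgrPdist_lt => e e0.
have [e' e'0 ee] : exists2 e' : R, 0 < e' & (e' %:C)%C = e.
  exists (complex.Re e).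
    by move: e0; case: e => a b; rewrite ltcE/= => /andP[].
  by rewrite RRe_real// gtr0_real.
have h2 : 0 < e' / 2 by rewrite divr_gt0.
apply: filterS (fw _ h2) => t ht.
rewrite -ee normcE ltcR; apply: (le_lt_trans (modulus_le_ofC _)).
have -> : ofC (toC w - toC (f t)) = w - f t by case: (w) => ? ?; case: (f t).
lra.
Qed.

Lemma cderivableP phi z : cderivable phi z ->
  (fun h : R[i]^o => h^-1 *: (complexify phi (h + toC z) - complexify phi (toC z)))
    @ 0^' --> (cderiv phi z : R[i]^o).
Proof.
move=> /cvg_ex[/= d dP].
have -> : cderiv phi z = d by apply: (@cvg_lim R[i]^o) dP; exact: norm_hausdorff.
have E : (fun h : R[i]^o => h^-1 *: ((complexify phi \o shift (toC z)) (h *: (1 : R[i]^o)) - complexify phi (toC z)))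
  = (fun h : R[i]^o => h^-1 *: (complexify phi (h + toC z) - complexify phi (toC z))).
  by apply/funext => h; rewrite /= [h *: 1]mulr1.
by rewrite -E.
Qed.

Lemma cderivable_intro phi z (d : R[i]^o) :
  (fun h : R[i]^o => h^-1 *: (complexify phi (h + toC z) - complexify phi (toC z)))
    @ 0^' --> d -> cderivable phi z /\ cderiv phi z = d.
Proof.
have E : (fun h : R[i]^o => h^-1 *: ((complexify phi \o shift (toC z)) (h *: (1 : R[i]^o)) - complexify phi (toC z)))
  = (fun h : R[i]^o => h^-1 *: (complexify phi (h + toC z) - complexify phi (toC z))).
  by apply/funext => h; rewrite /= [h *: 1]mulr1.
rewrite -E => dP; split; first by apply/cvg_ex; exists d.
by apply: (@cvg_lim R[i]^o) dP; exact: norm_hausdorff.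
Qed.

(** The increment k(h) of psi tends to 0 without vanishing, because psi is continuous
    and injective; the difference quotient of psi is the inverse of that of phi for
    the increment k(h). *)
Lemma inverse_cderiv B phi psi w : open B -> B w -> {within B, continuous psi} ->
  (forall v, B v -> phi (psi v) = v) -> cderivable phi (psi w) -> cderiv phi (psi w) != 0 ->
  cderivable psi w /\ cderiv psi w = (cderiv phi (psi w))^-1.
Proof.
move=> oB Bw cpsi phiK dphi d0; apply: cderivable_intro.
have /cderivableP dP := dphi; set a := toC (psi w) in dP.
pose k (h : R[i]^o) : R[i]^o := complexify psi (h + toC w) - a.
have FF : Filter (nbhs (0 : R[i]^o)) by exact: nbhs_filter.
have shiftw : (fun h : R[i]^o => ofC (h + toC w)) @ (0 : R[i]^o) --> w.
  apply/(@cvgrPdist_lt _ _ _ (nbhs (0 : R[i]^o)) FF) => e e0; near=> h.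
  have -> : w - ofC (h + toC w) = - ofC h.
    by case: (h) => a' b'; case: (w) => u v; congr pair; rewrite /= opprD addrCA subrr addr0.
  rewrite normrN; apply: (le_lt_trans (modulus_ofC_le h)).
  have : `|h| < (e%:C)%C.
    near: h; exists (e%:C)%C; first by rewrite /= ltcR.
    by move=> h; rewrite /ball_/= sub0r normrN.
  by rewrite normcE ltcR.
have nearB : \forall h \near (0 : R[i]^o)^', B (ofC (h + toC w)).
  apply: nbhs_dnbhs; apply: shiftw; exact: open_nbhs_nbhs.
have cpsiw : psi @ w --> psi w.
  by move: cpsi; rewrite continuous_open_subspace// => /(_ w (mem_set Bw)).
have k0 : k @ (0 : R[i]^o)^' --> (0 : R[i]^o).
  have kl : (fun h : R[i]^o => complexify psi (h + toC w)) @ (0 : R[i]^o) --> (a : R[i]^o).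
    apply: (@toC_cvg _ _ _ (fun h : R[i]^o => psi (ofC (h + toC w))) (psi w)).
    exact: (cvg_comp _ _ shiftw cpsiw).
  have := cvgB kl (cvg_cst (a : R[i]^o)); rewrite subrr => kl0.
  by move=> S hS; apply: nbhs_dnbhs; exact: (kl0 FF FF _ hS).
have kneq : \forall h \near (0 : R[i]^o)^', k h != 0.
  have neq : \forall h \near (0 : R[i]^o)^', h != 0 by exact: nbhs_dnbhs_neq.
  apply: filterS2 nearB neq => h Bh; apply: contra_neq => /eqP.
  rewrite subr_eq0 /a => /eqP /(can_inj toCK) E.
  have : phi (psi (ofC (h + toC w))) = phi (psi w) by rewrite E.
  rewrite !phiK// => /(congr1 (@toC R)); rewrite ofCK => /eqP.
  by rewrite -subr_eq0 addrK => /eqP.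
have k0' : k @ (0 : R[i]^o)^' --> (0 : R[i]^o)^'.
  move=> S; rewrite /dnbhs /within /= => hS.
  have h1 : \forall h \near (0 : R[i]^o)^', k h != 0 -> S (k h).
    exact: (k0 (fun x => x != 0 -> S x) hS).
  by apply: filterS2 kneq h1 => h kh; apply.
have := cvg_comp _ _ k0' dP.
move=> /(cvgV d0); apply: cvg_trans; apply: near_eq_cvg.
apply: filterS nearB => h Bh.
rewrite /= /k subrK.
have -> : complexify phi (complexify psi (h + toC w)) = h + toC w.
  by rewrite /complexify toCK phiK// ofCK.
have -> : complexify phi a = toC w by rewrite /complexify /a toCK phiK.
have -> : complexify psi (toC w) = a by rewrite /complexify toCK.
by rewrite addrK /GRing.scale/= invfM invrK mulrC.
Unshelve. all: by end_near. Qed.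

End conformal_maps.

Section conformal_inverse.
Variable R : realType.
Implicit Types (A B : set (R * R)) (phi psi : R * R -> R * R) (z w : R * R).

Lemma continuous_modulus_toC : continuous (fun z : R * R => modulus (toC z)).
Proof.
move=> z; apply: (@continuous_comp _ _ _ (fun z : R * R => z.1 ^+ 2 + z.2 ^+ 2) Num.sqrt).
  by apply: cvgD; apply: cvgM; solve [exact: cvg_fst|exact: cvg_snd].
exact: sqrt_continuous.
Qed.

Lemma open_unit_disc : open (unit_disc R).
Proof.
have -> : unit_disc R = (fun z : R * R => modulus (toC z)) @^-1` [set x | x < 1] by [].
by apply: open_comp; [move=> z _; exact: continuous_modulus_toC|exact: open_lt].
Qed.

Lemma conformal_inverse A B phi : open B -> conformal_homeomorphism A B phi ->
  exists psi, [/\ conformal_homeomorphism B A psi,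
    (forall z, A z -> psi (phi z) = z), (forall w, B w -> A (psi w) /\ phi (psi w) = w) &
    (forall w, B w -> cderiv psi w = (cderiv phi (psi w))^-1)].
Proof.
move=> oB [bphi cphi [psi [cpsi phiK]] dphi dphi0].
have K z : A z -> psi (phi z) = z by move=> Az; apply: phiK; rewrite inE.
have S w : B w -> A (psi w) /\ phi (psi w) = w.
  by case: bphi => _ _ /[apply] -[z Az <-]; rewrite K.
have D w : B w -> cderivable psi w /\ cderiv psi w = (cderiv phi (psi w))^-1.
  move=> Bw; apply: (inverse_cderiv oB Bw cpsi (fun v Bv => (S v Bv).2)).
    exact: (dphi _ (S w Bw).1).
  exact: (dphi0 _ (S w Bw).1).
exists psi; split => //; last by move=> w /D[].
split => //.
- split.
  + by move=> w Bw; exact: (S w Bw).1.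
  + by move=> v w; rewrite !inE => /S[_ {2}<-] /S[_ {2}<-] ->.
  + by move=> z Az; exists (phi z); [by case: bphi => h _ _; exact: h|exact: K].
- by exists phi; split => // w; rewrite inE => /S[].
- by move=> w /D[].
- by move=> w Bw; have [_ ->] := D w Bw; rewrite invr_eq0; apply: dphi0; case: (S w Bw).
Qed.

Lemma modulusD (x y : R[i]) : modulus (x + y) <= modulus x + modulus y.
Proof. by have := ler_normD (x : R[i]^o) y; rewrite !normcE -rmorphD/= lecR. Qed.

Lemma modulusN (x : R[i]) : modulus (- x) = modulus x.
Proof. by case: x => a b; rewrite /modulus /= !sqrrN. Qed.

Lemma modulusM (x y : R[i]) : modulus (x * y) = modulus x * modulus y.
Proof.
have := normrM (x : R[i]) y => /(congr1 (@complex.Re R)).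
by rewrite !(normcE, (rmorphM (@real_complex R))) -rmorphM.
Qed.

Lemma modulusV (x : R[i]) : modulus x^-1 = (modulus x)^-1.
Proof.
have := normfV (x : R[i]) => /(congr1 (@complex.Re R)).
by rewrite !normcE -fmorphV.
Qed.

Lemma modulus_dist (x y : R[i]) : `|modulus x - modulus y| <= modulus (x - y).
Proof.
have h1 : modulus x <= modulus (x - y) + modulus y by rewrite -{1}(subrK y x) modulusD.
have h2 : modulus y <= modulus (x - y) + modulus x.
  by rewrite -{1}(subrK x y) (le_trans (modulusD _ _))// -modulusN opprB.
by rewrite ler_norml; apply/andP; split; lra.
Qed.

(** The limit that defines the complex derivative, with real bounds and increments in
    the plane. *)
Lemma cderiv_quotient phi z (e : R) : cderivable phi z -> 0 < e ->
  exists2 d : R, 0 < d & forall w, w != z -> modulus (toC (w - z)) < d ->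
    modulus (cderiv phi z - (toC (w - z))^-1 * toC (phi w - phi z)) < e.
Proof.
move=> /cderivableP dP e0.
have FF : Filter (0 : R[i]^o)^' by exact: dnbhs_filter.
have /cvgrPdist_lt/(_ (e%:C)%C) := dP.
rewrite ltcR => /(_ e0); rewrite near_withinE => -[d /= d0 dP'].
have [d' d'0 dd] : exists2 d' : R, 0 < d' & (d'%:C)%C = d.
  exists (complex.Re d).
    by move: d0; case: d {dP'} => a b; rewrite ltcE/= => /andP[].
  by rewrite RRe_real// gtr0_real.
exists d' => // w wz wd.
have := dP' (toC (w - z)).
rewrite /ball_/= sub0r normrN -dd normcE ltcR => /(_ wd).
have nz : toC (w - z) != 0.
  apply: contra_neq wz => /(congr1 (@ofC R)); rewrite toCK => /eqP.
  by rewrite -[ofC 0]/(0 : R * R) subr_eq0 => /eqP.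
move=> /(_ nz); rewrite normcE ltcR.
have -> : toC (w - z) + toC z = toC w.
  by case: (w) => ? ?; case: (z) => ? ?; congr complex.Complex; rewrite /= subrK.
have -> : complexify phi (toC w) - complexify phi (toC z) = toC (phi w - phi z).
  by rewrite /complexify !toCK; case: (phi w) => ? ?; case: (phi z).
exact.
Qed.

(** The modulus of the derivative is a pointwise limit of difference quotients along
    real increments 1/(n+1).  Extending phi by 0 outside A makes these quotients
    measurable on the whole plane, and for n large they only involve values on A. *)
Lemma measurable_modulus_cderiv A phi : open A -> {within A, continuous phi} ->
  (forall z, A z -> cderivable phi z) -> measurable_fun A (fun z => modulus (cderiv phi z)).
Proof.
move=> oA cphi dphi; have mA := open_measurable_plane oA.
have mphi := within_continuous_measurable_plane mA cphi.
have m1 : measurable_fun setT ((fst \o phi) \_ A).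
  by apply/(measurable_restrictT _ mA); apply: (measurableT_comp _ mphi); exact: measurable_fst.
have m2 : measurable_fun setT ((snd \o phi) \_ A).
  by apply/(measurable_restrictT _ mA); apply: (measurableT_comp _ mphi); exact: measurable_snd.
pose f z := (((fst \o phi) \_ A) z, ((snd \o phi) \_ A) z).
have fE z : A z -> f z = phi z by move=> Az; rewrite /f !patchE mem_set//=; case: (phi z).
pose t (n : nat) : R := n.+1%:R^-1.
have tn0 n : 0 < t n by rewrite invr_gt0.
pose sh n z : R * R := (t n + z.1, z.2).
have msh n : measurable_fun setT (sh n).
  apply: measurable_fun_pair; last exact: measurable_snd.
  by apply: measurable_funD => //; exact: measurable_fst.
pose F n z := (t n)^-1 * modulus (toC (f (sh n z) - f z)).
have mF n : measurable_fun setT (F n).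
  apply: measurable_funM => //.
  apply: (@measurableT_comp _ _ _ _ _ _ (fun z : R * R => modulus (toC z))).
    by apply: continuous_measurable_plane; exact: continuous_modulus_toC.
  by apply: measurable_fun_pair; apply: measurable_funB => //=; apply: measurableT_comp.
apply: (measurable_fun_cvg (h := F)); first by move=> n; exact: measurable_funTS.
move=> z Az; apply/cvgrPdist_lt => e e0.
have [d d0 dP] := cderiv_quotient (dphi z Az) e0.
have /nbhs_ballP[r /= r0 rA] : nbhs z A by exact: open_nbhs_nbhs.
have [N _ NP] : \forall n \near \oo, t n < Num.min d r.
  have /cvgrPdist_lt/(_ (Num.min d r)) := @cvg_harmonic R.
  rewrite lt_min d0 r0 => /(_ isT); apply: filterS => n.
  by rewrite sub0r normrN ger0_norm// ltW// tn0.
exists N => // n /NP; rewrite lt_min => /andP[td tr] /=.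
have shE : sh n z - z = (t n, 0).
  by case: (z) => x y; congr pair; rewrite /= ?subrr// addrK.
have tC : toC (sh n z - z) = ((t n)%:C)%C by rewrite shE.
have Ash : A (sh n z).
  apply: rA; case: z shE {Az tC dP} => x y _; split; rewrite /ball/= ?subrr ?normr0//.
  by rewrite opprD addrCA subrr addr0 normrN gtr0_norm.
have shz : sh n z != z.
  by apply/eqP => E; move: shE; rewrite E subrr => -[/esym/eqP]; rewrite gt_eqF.
have mt : modulus ((t n)%:C)%C = t n.
  by rewrite /modulus /= expr0n/= addr0 sqrtr_sqr gtr0_norm.
have := dP _ shz; rewrite tC mt => /(_ td).
apply: le_lt_trans; rewrite /F !fE//.
rewrite -[X in X * _ ](_ : modulus ((t n)%:C)%C^-1 = _); last by rewrite modulusV mt.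
by rewrite -modulusM; exact: modulus_dist.
Qed.

End conformal_inverse.

(** * Areas under a Lipschitz map *)

Section lipschitz_image.
Variable R : realType.
Implicit Types (W B : set (R * R)) (phi psi : R * R -> R * R) (L d : R).

Lemma side_cover (a l t : R) k : side a (k.+1%:R * l) t ->
  exists i : 'I_k.+1, side (a + i%:R * l) l t.
Proof.
rewrite /side/= in_itv/= => /andP[].
elim: k => [|k IH] h1 h2; first by exists ord0; rewrite in_itv/= mul0r addr0 h1 -[l]mul1r.
have [h|h] := ltP t (a + k.+1%:R * l).
  have [i hi] := IH h1 h; exists (widen_ord (leqnSn _) i); exact: hi.
exists ord_max; rewrite in_itv/= h/=; apply: lt_le_trans h2 _.
by rewrite -addn1 natrD mulrDl mul1r addrA.
Qed.

Lemma hbox_cover (N : R) k w : hbox N w -> exists i j : 'I_k.+1, gcell N i j w.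
Proof.
have E : 2 * N = k.+1%:R * (2 * N / k.+1%:R) by rewrite mulrCA mulfV ?mulr1.
move=> [/=]; rewrite {1 2}E => /side_cover[i hi] /side_cover[j hj].
by exists i, j.
Qed.

Lemma mu2_finite_cover k (F : 'I_k -> set (R * R)) B :
  measurable B -> (forall i, measurable (F i)) -> (forall z, B z -> exists i, F i z) ->
  (mu2 R B <= \sum_(i < k) mu2 R (F i))%E.
Proof.
elim: k F B => [|k IH] F B mB mF cov.
  by rewrite (_ : B = set0) ?measure0 ?sume_ge0//; apply/seteqP; split => // z /cov[[]].
rewrite big_ord_recr/=.
have m1 : measurable (B `\` F ord_max) by exact: measurableD.
apply: (@le_trans _ _ (mu2 R ((B `\` F ord_max) `|` F ord_max))).
  have mU := measurableU _ _ m1 (mF ord_max).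
  apply: le_measure; rewrite ?inE//.
  by move=> z Bz; have [|] := pselect (F ord_max z); [right|left].
apply: (@le_trans _ _ (mu2 R (B `\` F ord_max) + mu2 R (F ord_max))%E).
  apply: (@measureU2 _ _ R (mu2 R)); [exact: m1|exact: mF].
rewrite leeD2r//.
apply: IH => // z [/cov[i Fi] nF].
have [j ij|E] := unliftP ord_max i; last by move: Fi; rewrite E.
exists j; move: Fi; rewrite ij; congr (F _ z); apply/val_inj => /=.
by rewrite /bump leqNgt ltn_ord.
Qed.

(** A closed set is the intersection of its neighbourhoods of radius 5/(k+1).  The
    radius exceeds 4/(k+1), the side of the cells when the square of half-side 2 is cut
    into k+1 rows. *)
Lemma closed_near_mem W w : closed W ->
  (forall k : nat, (\bigcup_(v in W) ball v (5 / k.+1%:R)) w) -> W w.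
Proof.
move=> cW h; apply: cW => V /nbhs_ballP[e /= e0 eV].
pose k := Num.truncn (5 / e).
have kP : 5 / k.+1%:R < e.
  by rewrite ltr_pdivrMr// mulrC -ltr_pdivrMr//; exact: truncnS_gt.
have [v Wv vw] := h k; exists v; split => //; apply: eV.
by apply: ball_sym; apply: le_ball vw; exact: ltW.
Qed.

(** Each cell that meets phi(B) lies in the 5/(k+1)-neighbourhood of W, and the part of
    B over it lies in a square whose side is 2L times that of the cell, centred at any
    point of that part. *)
Lemma lipschitz_image_grid W B phi psi L d k :
  W `<=` hbox 2 -> measurable B -> measurable_fun B phi ->
  (forall z, B z -> W (phi z) /\ psi (phi z) = z) -> 0 < L ->
  (forall v w, W v -> W w -> `|v - w| < d -> `|psi v - psi w| <= L * `|v - w|) ->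
  5 / k.+1%:R < d ->
  (mu2 R B <= (4 * L ^+ 2)%:E *
    mu2 R ((\bigcup_(v in W) ball v (5 / k.+1%:R)) `&` hbox 2))%E.
Proof.
move=> Wb mB mphi K L0 lip kd.
set T := \bigcup_(v in W) _.
have oT : open T by apply: bigcup_open => v _; exact: ball_open.
have mT := open_measurable_plane oT.
have mC i j : measurable (gcell (2 : R) i j : set (R * R)) by move=> *; exact: measurable_cell.
set l := (2 * 2 / k.+1%:R : R) in mC *.
have l0 : 0 < l by rewrite divr_gt0.
have l5 : l < 5 / k.+1%:R by rewrite ltr_pM2r ?invr_gt0//; lra.
pose F (w : R * R) : \bar R := (\1_T w)%:E.
have mF : measurable_fun setT F by apply/measurable_EFinP; exact: measurable_indic.
have F0 w : (0 <= F w)%E by rewrite lee_fin.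
have mH : measurable (hbox (2 : R)) by exact: measurable_cell.
rewrite -(integral_indic (mu2 R) mH mT).
rewrite (@grid_sum R 2 k.+1 F)//.
have mS i j : measurable (B `&` phi @^-1` (@gcell R 2 k.+1 i j)).
  by apply: mphi => //; exact: measurable_cell.
apply: (@le_trans _ _ (\sum_(i < k.+1) \sum_(j < k.+1)
   mu2 R (B `&` phi @^-1` (@gcell R 2 k.+1 i j)))%E).
  apply: (@le_trans _ _ (\sum_(i < k.+1)
     mu2 R (\bigcup_(j in setT) (B `&` phi @^-1` (@gcell R 2 k.+1 i j))))%E).
    apply: mu2_finite_cover => //.
      by move=> i; apply: fin_bigcup_measurable.
    move=> z Bz; have [i [j hij]] := @hbox_cover 2 k _ (Wb _ (K z Bz).1).
    by exists i, j.
  apply: lee_sum => i _; apply: mu2_finite_cover => //.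
    by apply: fin_bigcup_measurable.
  by move=> z [j _ hj]; exists j.
have near v w i j : @gcell R 2 k.+1 i j v -> @gcell R 2 k.+1 i j w -> `|v - w| < l.
  case: v w => [a b] [a' b'] [/= + +] [/= + +]; rewrite /side/= !in_itv/= -/l.
  move: (_ + _) (_ + _) => x y /andP[? ?] /andP[? ?] /andP[? ?] /andP[? ?].
  by rewrite prod_normE/= gt_max !ltr_norml; apply/andP; split; apply/andP; split; lra.
rewrite ge0_sume_distrr; last by move=> i _; apply: sume_ge0 => j _; exact: integral_ge0.
apply: lee_sum => i _.
rewrite ge0_sume_distrr; last by move=> j _; exact: integral_ge0.
apply: lee_sum => j _.
have [/eqP E|/set0P[z0 [Bz0 Cz0]]] := boolP (B `&` phi @^-1` (@gcell R 2 k.+1 i j) == set0).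
  by rewrite E measure0 mule_ge0// ?lee_fin ?mulr_ge0 ?exprn_ge0 ?integral_ge0// ltW.
rewrite integral_indic//; last exact: measurable_cell.
have -> : T `&` @gcell R 2 k.+1 i j = @gcell R 2 k.+1 i j.
  apply/seteqP; split => [w []//|w Cw]; split => //; exists (phi z0); first by case: (K z0 Bz0).
  by rewrite -ball_normE/=; apply: lt_trans l5; exact: near Cz0 Cw.
have -> : mu2 R (@gcell R 2 k.+1 i j) = (l * l)%:E by rewrite mu2_cell// ltW.
rewrite -EFinM (_ : 4 * L ^+ 2 * (l * l) = (2 * L * l) * (2 * L * l)); last by ring.
rewrite -(@mu2_cell R (z0.1 - L * l) (z0.2 - L * l)); last by rewrite !mulr_ge0// ltW.
apply: le_measure; rewrite ?inE; [exact: mS|exact: measurable_cell|].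
move=> z [Bz Cz].
have h1 : `|phi z - phi z0| < l by exact: near Cz Cz0.
have := lip _ _ (K z Bz).1 (K z0 Bz0).1 (lt_trans h1 (lt_trans l5 kd)).
have {}h1 : L * `|phi z - phi z0| < L * l by rewrite ltr_pM2l.
rewrite (K z Bz).2 (K z0 Bz0).2 => /le_lt_trans/(_ h1).
rewrite (_ : 2 * L * l = L * l + L * l); last by ring.
move: (L * l) => m; move: (z) (z0) => [a b] [a' b']; rewrite prod_normE/= gt_max !ltr_norml.
move=> /andP[/andP[? ?] /andP[? ?]].
by split; rewrite /side/= in_itv/=; apply/andP; split; lra.
Qed.

(** B is contained in psi(W); stating the bound for B, together with a measurable
    inverse phi of psi, avoids the measurability of images.  As the grid gets finer,
    the neighbourhoods of W decrease to W. *)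
Lemma lipschitz_image W B phi psi L d : closed W ->
  W `<=` hbox 2 -> measurable B -> measurable_fun B phi ->
  (forall z, B z -> W (phi z) /\ psi (phi z) = z) -> 0 < L -> 0 < d ->
  (forall v w, W v -> W w -> `|v - w| < d -> `|psi v - psi w| <= L * `|v - w|) ->
  (mu2 R B <= (4 * L ^+ 2)%:E * mu2 R W)%E.
Proof.
move=> cW Wb mB mphi K L0 d0 lip.
pose T k := (\bigcup_(v in W) ball v (5 / k.+1%:R)) `&` hbox 2.
have mH : measurable (hbox (2 : R)) by exact: measurable_cell.
have mT k : measurable (T k).
  apply: measurableI => //; apply: open_measurable_plane.
  by apply: bigcup_open => v _; exact: ball_open.
have TW : \bigcap_k T k = W.
  apply/seteqP; split => w.
    by move=> h; apply: (closed_near_mem cW) => k; case: (h k I).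
  move=> Ww k _; split; last exact: Wb.
  by exists w => //; apply: ballxx; rewrite divr_gt0.
have cv : mu2 R \o T @ \oo --> mu2 R (\bigcap_k T k).
  apply: nonincreasing_cvg_mu => //.
  - apply: (@le_lt_trans _ _ (mu2 R (hbox (2 : R)))).
      by apply: le_measure; rewrite ?inE; [exact: mT|exact: mH|exact: subIsetr].
    by rewrite mu2_cell ?ltry.
  - by rewrite TW; exact: closed_measurable_plane.
  - apply/nonincreasing_seqP => k; apply/subsetPset => w [[v Wv vw] hw]; split => //.
    exists v => //; apply: le_ball vw.
    by rewrite ler_pM2l// lef_pV2 ?posrE// ler_nat.
rewrite TW in cv.
apply: (cvge_to_ge (@cvgeZl _ _ _ _ _ (4 * L ^+ 2)%:E _ cv)) => //.
exists (Num.truncn (5 / d)) => // k /= kd.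
apply: (lipschitz_image_grid (phi := phi) (psi := psi) (d := d)) => //.
rewrite ltr_pdivrMr// mulrC -ltr_pdivrMr//.
by apply: (lt_le_trans (truncnS_gt _)); rewrite ler_nat.
Qed.

End lipschitz_image.

(** * Areas under a conformal map *)

Section distortion.
Variable R : realType.
Implicit Types (W B Om : set (R * R)) (phi psi : R * R -> R * R) (L d M : R).

(** The factor 2 bounds the ratio of the modulus to the sup norm of the plane. *)
Lemma local_lipschitz psi w M : cderivable psi w -> modulus (cderiv psi w) < M ->
  exists2 d : R, 0 < d &
    forall v, `|v - w| < d -> `|psi v - psi w| <= 2 * M * `|v - w|.
Proof.
move=> dpsi cM.
have [|d d0 dP] := cderiv_quotient dpsi (e := M - modulus (cderiv psi w)).
  by rewrite subr_gt0.
exists (d / 2); first by rewrite divr_gt0.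
move=> v vd; have [->|vw] := eqVneq v w; first by rewrite !subrr normr0 mulr0.
set D := toC (v - w).
have mD : modulus D <= 2 * `|v - w| by have := modulus_le_ofC D; rewrite toCK.
have D0 : D != 0.
  apply: contra_neq vw => /(congr1 (@ofC R)); rewrite toCK => /eqP.
  by rewrite -[ofC 0]/(0 : R * R) subr_eq0 => /eqP.
have := dP v vw; rewrite -/D; set N := toC (psi v - psi w).
have -> : modulus D < d by lra.
move=> /(_ isT) h.
have hq : modulus (D^-1 * N) <= M.
  have := modulusD (cderiv psi w) (- (cderiv psi w - D^-1 * N)).
  by rewrite modulusN opprB addrCA subrr addr0; lra.
have -> : psi v - psi w = ofC N by rewrite toCK.
apply: (le_trans (modulus_ofC_le _)).
have -> : N = D * (D^-1 * N) by rewrite mulrA divff// mul1r.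
rewrite modulusM (_ : 2 * M * `|v - w| = 2 * `|v - w| * M); last by ring.
by apply: ler_pM => //; exact: modulus_ge0.
Qed.

Lemma lipschitz_cderiv psi w L d : cderivable psi w -> 0 < d ->
  (forall v, `|v - w| < d -> `|psi v - psi w| <= L * `|v - w|) ->
  modulus (cderiv psi w) <= 2 * L.
Proof.
move=> dpsi d0 lip; apply/ler_addgt0Pr => e e0.
have [c c0 cP] := cderiv_quotient dpsi e0.
pose t := Num.min c d / 2.
have t0 : 0 < t by rewrite divr_gt0// lt_min c0.
have [tc td] : t < c /\ t < d.
  have : Num.min c d <= c /\ Num.min c d <= d by split; rewrite ge_min lexx// orbT.
  by move: t0; rewrite /t; move: (Num.min c d) => m; split; lra.
pose v := (t + w.1, w.2); have E : v - w = (t, 0).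
  by rewrite /v; case: (w) => x y; congr pair; rewrite /= ?subrr// addrK.
have vw : v != w.
  by apply/eqP => vw; move: E; rewrite vw subrr => -[/esym/eqP]; rewrite gt_eqF.
have mt : modulus (toC (v - w)) = t.
  by rewrite E /modulus/= expr0n/= addr0 sqrtr_sqr gtr0_norm.
have nt : `|v - w| = t by rewrite E prod_normE/= normr0 gtr0_norm// max_l// ltW.
have := cP v vw; rewrite mt => /(_ tc) h.
have := lip v; rewrite nt => /(_ td) h2.
set q := (toC _)^-1 * _ in h.
have hq : modulus q <= 2 * L.
  rewrite /q modulusM modulusV mt mulrC ler_pdivrMr//.
  by apply: (le_trans (modulus_le_ofC _)); rewrite toCK; lra.
have := modulusD (cderiv psi w - q) q; rewrite subrK; lra.
Qed.

(** The distance to the circle is bounded below as well, so that these sets are closed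
    in the plane and not only in the disc. *)
Definition lip_set psi M (n : nat) : set (R * R) :=
  [set w | modulus (toC w) <= 1 - n.+1%:R^-1 /\
    forall v, unit_disc R v -> `|v - w| < n.+1%:R^-1 ->
      `|psi v - psi w| <= 2 * M * `|v - w|].

Lemma lip_set_disc psi M n : lip_set psi M n `<=` unit_disc R.
Proof. by move=> w [h _]; rewrite /unit_disc/=; apply: le_lt_trans h _; rewrite ltrBlDr ltrDl. Qed.

(** The negation of the Lipschitz inequality at w is an open condition on w, because psi
    is continuous. *)
Lemma closed_lip_set psi M n : {within unit_disc R, continuous psi} ->
  closed (lip_set psi M n).
Proof.
move=> cpsi w clw.
have mw : modulus (toC w) <= 1 - n.+1%:R^-1.
  have cl : closed (fun z : R * R => modulus (toC z) <= 1 - n.+1%:R^-1).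
    have -> : (fun z : R * R => modulus (toC z) <= 1 - n.+1%:R^-1 : Prop) =
      (fun z : R * R => modulus (toC z)) @^-1` [set x | x <= 1 - n.+1%:R^-1] by [].
    by apply: closed_comp; [move=> z _; exact: continuous_modulus_toC|exact: closed_le].
  by apply: cl => V /clw[z [[hz _] Vz]]; exists z.
have Dw : unit_disc R w.
  by rewrite /unit_disc/=; apply: le_lt_trans mw _; rewrite ltrBlDr ltrDl.
split => // v Dv vw; rewrite leNgt; apply/negP => lt.
have cw : {for w, continuous psi}.
  move: cpsi; rewrite continuous_open_subspace; last exact: open_unit_disc.
  by apply; rewrite inE.
have n1 : `|v - u| @[u --> w] --> `|v - w|.
  by apply: cvg_norm; apply: cvgB; [exact: cvg_cst|exact: cvg_id].
have n2 : `|psi v - psi u| @[u --> w] --> `|psi v - psi w|.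
  by apply: cvg_norm; apply: cvgB; [exact: cvg_cst|exact: cw].
have n3 : 2 * M * `|v - u| @[u --> w] --> 2 * M * `|v - w|.
  by apply: cvgM; [exact: cvg_cst|exact: n1].
have n4 : (`|psi v - psi u| - 2 * M * `|v - u|) @[u --> w] -->
    `|psi v - psi w| - 2 * M * `|v - w| by exact: cvgB.
have h1 : \forall u \near w, `|v - u| < n.+1%:R^-1.
  by apply: (cvgr_lt _ n1).
have h2 : \forall u \near w, 0 < `|psi v - psi u| - 2 * M * `|v - u|.
  by apply: (cvgr_gt _ n4); rewrite subr_gt0.
have [u [[_ hu] [/= u1 u2]]] := clw _ (filterI h1 h2).
by have := hu v Dv u1; lra.
Qed.

Lemma lip_set_cderiv psi M n w : (forall w, unit_disc R w -> cderivable psi w) ->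
  lip_set psi M n w -> modulus (cderiv psi w) <= 4 * M.
Proof.
move=> dpsi Ww; have Dw := lip_set_disc Ww; case: Ww => _ lip.
have /nbhs_ballP[r /= r0 rD] : nbhs w (unit_disc R).
  by apply: open_nbhs_nbhs; split => //; exact: open_unit_disc.
rewrite (_ : 4 * M = 2 * (2 * M)); last by ring.
apply: (@lipschitz_cderiv psi w (2 * M) (Num.min r n.+1%:R^-1)); first exact: dpsi.
  by rewrite lt_min r0 invr_gt0/=.
move=> v; rewrite lt_min => /andP[vr vn]; apply: lip => //; apply: rD.
by rewrite -ball_normE/= distrC.
Qed.

Lemma lip_set_cover psi M w : cderivable psi w -> unit_disc R w ->
  modulus (cderiv psi w) < M -> exists n, lip_set psi M n w.
Proof.
move=> dpsi Dw cM; have [d d0 dP] := local_lipschitz dpsi cM.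
have : 0 < Num.min d (1 - modulus (toC w)) by rewrite lt_min d0 subr_gt0.
move=> m0; have /cvgrPdist_lt/(_ _ m0) := @cvg_harmonic R.
move=> [N _ /(_ N (leqnn N))].
rewrite sub0r normrN [harmonic N]/harmonic gtr0_norm ?invr_gt0//.
rewrite lt_min => /andP[h1 h2].
exists N; split; first by rewrite lerBrDr addrC -lerBrDr; exact: ltW.
by move=> v _ /lt_trans/(_ h1); exact: dP.
Qed.

Lemma lip_set_nondecreasing psi M n : lip_set psi M n `<=` lip_set psi M n.+1.
Proof.
have h : n.+2%:R^-1 <= n.+1%:R^-1 :> R by rewrite lef_pV2 ?posrE// ler_nat.
move=> w [w1 w2]; split; first by apply: le_trans w1 _; rewrite lerD2l lerN2.
by move=> v Dv vw; apply: w2 => //; exact: lt_le_trans vw h.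
Qed.

(** The closed sets [lip_set psi M n] increase with n; they contain every point at which
    |psi'| < M for n large, and |psi'| <= 4M on each of them.  So the Lipschitz bound
    passes to the limit in n. *)
Lemma distortion Om phi psi M : open Om -> 0 < M -> {within Om, continuous phi} ->
  {within unit_disc R, continuous psi} ->
  (forall z, Om z -> unit_disc R (phi z) /\ psi (phi z) = z) ->
  (forall w, unit_disc R w -> cderivable psi w) ->
  (mu2 R (Om `&` [set z | (modulus (cderiv psi (phi z)) < M)%R]) <= (16 * M ^+ 2)%:E *
   mu2 R (unit_disc R `&` [set w | (modulus (cderiv psi w) <= 4 * M)%R]))%E.
Proof.
move=> oOm M0 cphi cpsi K dpsi.
have mOm := open_measurable_plane oOm.
have oD : open (unit_disc R) by exact: open_unit_disc.
have mD := open_measurable_plane oD.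
have mphi := within_continuous_measurable_plane mOm cphi.
have mm := measurable_modulus_cderiv oD cpsi dpsi.
pose W n := lip_set psi M n; pose B n := Om `&` phi @^-1` W n.
have cW n : closed (W n) by exact: closed_lip_set.
have mW n : measurable (W n) by exact: closed_measurable_plane.
have mB n : measurable (B n) by apply: mphi.
have mU : measurable (\bigcup_n B n) by apply: bigcupT_measurable.
have mL : measurable (unit_disc R `&` [set w | modulus (cderiv psi w) <= 4 * M]).
  rewrite (_ : [set w | _] = (fun w => modulus (cderiv psi w)) @^-1` `]-oo, 4 * M]).
    by apply: mm => //; exact: measurable_itv.
  by apply/seteqP; split => w; rewrite /= in_itv/=.
have mA : measurable (Om `&` [set z | modulus (cderiv psi (phi z)) < M]).
  rewrite (_ : _ `&` _ = Om `&` phi @^-1` (unit_disc R `&`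
      (fun w => modulus (cderiv psi w)) @^-1` `]-oo, M[)).
    by apply: mphi => //; apply: mm => //; exact: measurable_itv.
  apply/seteqP; split => z [Oz]; rewrite /= in_itv/=; first by have [] := K z Oz.
  by case.
apply: (@le_trans _ _ (mu2 R (\bigcup_n B n))).
  apply: le_measure; rewrite ?inE; [exact: mA|exact: mU|].
  move=> z [Oz /= hz]; have [Dz _] := K z Oz.
  by have [n nW] := lip_set_cover (dpsi _ Dz) Dz hz; exists n.
have cv : mu2 R \o B @ \oo --> mu2 R (\bigcup_n B n).
  apply: nondecreasing_cvg_mu => //; apply/nondecreasing_seqP => n.
  by apply/subsetPset => z [Oz] /lip_set_nondecreasing.
apply: (cvge_to_le cv); exists 0 => // n _ /=.
have mBphi : measurable_fun (B n) phi.
  by apply: measurable_funS mphi => //; exact: subIsetl.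
apply: (@le_trans _ _ ((4 * (2 * M) ^+ 2)%:E * mu2 R (W n))%E).
  apply: (@lipschitz_image _ (W n) (B n) phi psi (2 * M) n.+1%:R^-1) => //.
  - move=> w /lip_set_disc Dw.
    have := le_lt_trans (modulus_ofC_le (toC w)) Dw; rewrite toCK.
    case: (w) => x y; rewrite prod_normE/= gt_max !ltr_norml => /andP[/andP[? ?] /andP[? ?]].
    by split; rewrite /side/= in_itv/=; apply/andP; split; lra.
  - by move=> z [Oz Wz]; split => //; have [] := K z Oz.
  - by rewrite mulr_gt0.
  - by move=> v w /lip_set_disc Dv [_ hw]; exact: hw.
rewrite (_ : 4 * (2 * M) ^+ 2 = 16 * M ^+ 2); last by ring.
apply: lee_wpmul2l; first by rewrite lee_fin mulr_ge0 ?exprn_ge0// ltW.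
apply: le_measure; rewrite ?inE; [exact: mW|exact: mL|].
by move=> w Ww; split; [exact: lip_set_disc Ww|exact: lip_set_cderiv Ww].
Qed.

End distortion.

(** * From level sets to integrals *)

Section level_sums.
Variable R : realType.
Implicit Types (A D : set (R * R)) (f g : R * R -> R) (t tau Y K : R).

Definition dyad (m n : nat) : R := 2 ^+ n / 2 ^+ m.

Lemma dyad_gt0 m n : 0 < dyad m n. Proof. by rewrite divr_gt0// exprn_gt0. Qed.

Lemma dyadS m n : dyad m n.+1 = 2 * dyad m n. Proof. by rewrite /dyad exprS mulrA. Qed.

Lemma dyad_bracket m N x : dyad m 0 < x -> x <= dyad m N ->
  exists n : 'I_N, dyad m n < x <= 2 * dyad m n.
Proof.
move=> x0; elim: N => [|N IH] xN; first by move: (lt_le_trans x0 xN); rewrite ltxx.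
have [h|h] := leP x (dyad m N); first by have [n hn] := IH h; exists (widen_ord (leqnSn _) n).
by exists ord_max; rewrite h/= -dyadS.
Qed.

(** A geometric sum is comparable with its largest term.  The bound by the next term
    of the progression, proved simultaneously, is what the induction needs. *)
Lemma geometric_sum_le m tau N (P : pred nat) Y : 0 < tau -> 0 <= Y ->
  (forall n, P n -> dyad m n `^ tau <= Y) ->
  \sum_(n < N) (dyad m n `^ tau * (P n)%:R) <= 2 `^ tau / (2 `^ tau - 1) * Y.
Proof.
move=> tau0 Y0 PY; set b := 2 `^ tau.
have b1 : 1 < b by have := gt0_ltr_powR tau0 (x := 1) (y := 2); rewrite powR1 !nnegrE; apply => //; rewrite ltr1n.
have b10 : 0 < b - 1 by rewrite subr_gt0.
have aS n : dyad m n.+1 `^ tau = b * dyad m n `^ tau by rewrite dyadS powRM// ltW// dyad_gt0.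
suff : \sum_(n < N) (dyad m n `^ tau * (P n)%:R) <= b / (b - 1) * Y /\
    \sum_(n < N) (dyad m n `^ tau * (P n)%:R) <= dyad m N `^ tau / (b - 1) by case.
elim: N => [|N [IH1 IH2]].
  by rewrite big_ord0; split; [rewrite mulr_ge0// divr_ge0// ltW// (lt_trans ltr01)|rewrite divr_ge0// ?powR_ge0 ?ltW].
rewrite big_ord_recr/= aS.
set S := \sum_(n < N) _ in IH1 IH2 *; set x := dyad m N `^ tau in IH2 *.
have x0 : 0 <= x by exact: powR_ge0.
have h : S + x <= b * x / (b - 1).
  by rewrite (_ : b * x / (b - 1) = x / (b - 1) + x) ?lerD2r//; field; rewrite gt_eqF.
case: (boolP (P N)) => [/PY xY|_]; rewrite ?mulr1 ?mulr0 ?addr0.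
  split => //; apply: (le_trans h).
  rewrite (_ : b * x / (b - 1) = b / (b - 1) * x); last by ring.
  by rewrite ler_wpM2l// divr_ge0// ltW// (lt_trans ltr01).
split => //; apply: le_trans h; lra.
Qed.

Lemma integral_steps A N (a : nat -> R) (E : nat -> set (R * R)) :
  measurable A -> (forall n, measurable (E n)) -> (forall n, 0 <= a n) ->
  (\int[mu2 R]_(z in A) (\sum_(n < N) a n * \1_(E n) z)%:E =
   \sum_(n < N) (a n)%:E * mu2 R (E n `&` A))%E.
Proof.
move=> mA mE a0.
have m1 n : measurable_fun A (fun z => (\1_(E n) z)%:E).
  by apply/measurable_EFinP; exact: measurable_indic.
under eq_integral do rewrite -sumEFin.
rewrite (@ge0_integral_sum _ _ R (mu2 R) A mA 'I_N (fun n z => (a n * \1_(E n) z)%:E)).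
- apply: eq_bigr => n _; under eq_integral do rewrite EFinM.
  by rewrite ge0_integralZl_EFin//; [congr (_ * _)%E; apply: integral_indic; [exact: mA|exact: mE]|exact: m1].
- by move=> n; apply/measurable_EFinP; apply: measurable_funM; [exact: measurable_cst|apply: measurable_indic; exact: mE].
- by move=> n z _; rewrite lee_fin mulr_ge0.
Qed.

(** Where 2^-m < f <= 2^m, the function f^(tau+2) is comparable with the sum of the
    t^(tau+2) over the dyadic levels t < f.  Integrating turns that sum into areas of
    level sets of f, hence of g by assumption, with t^tau in place of t^(tau+2); over
    the levels t <= 4/g the t^tau add up to a multiple of g^(-tau).  The bound does not
    depend on m. *)
Lemma level_sum A D f g tau K : measurable A -> measurable D ->
  measurable_fun A f -> measurable_fun D g ->
  (forall z, A z -> 0 < f z) -> (forall w, D w -> 0 < g w) -> 0 < tau -> 0 <= K ->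
  (forall t, 0 < t -> (mu2 R (A `&` [set z | (t < f z)%R]) <=
     (K / t ^+ 2)%:E * mu2 R (D `&` [set w | (g w <= 4 / t)%R]))%E) ->
  (\int[mu2 R]_(w in D) (g w `^ (- tau))%:E < +oo)%E ->
  (\int[mu2 R]_(z in A) (f z `^ (tau + 2))%:E < +oo)%E.
Proof.
move=> mA mD mf mg f0 g0 tau0 K0 lev fin.
pose s := tau + 2; have s0 : 0 < s by rewrite addr_gt0.
have mE t : measurable (A `&` [set z | t < f z]).
  rewrite (_ : [set z | _] = f @^-1` `]t, +oo[); first by apply: mf => //; exact: measurable_itv.
  by apply/seteqP; split => z; rewrite /= in_itv/= andbT.
have mE' t : measurable (A `&` [set z | f z <= t]).
  rewrite (_ : [set z | _] = f @^-1` `]-oo, t]); first by apply: mf => //; exact: measurable_itv.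
  by apply/seteqP; split => z; rewrite /= in_itv/=.
have mF t : measurable (D `&` [set z | g z <= t]).
  rewrite (_ : [set z | _] = g @^-1` `]-oo, t]); first by apply: mg => //; exact: measurable_itv.
  by apply/seteqP; split => z; rewrite /= in_itv/=.
have mfs : measurable_fun A (fun z => (f z `^ s)%:E).
  by apply/measurable_EFinP; apply: (@measurableT_comp _ _ _ _ _ _ (fun x : R => x `^ s) _ f _ mf); exact: measurable_powR.
have mgs : measurable_fun D (fun w => (g w `^ (- tau))%:E).
  by apply/measurable_EFinP; apply: (@measurableT_comp _ _ _ _ _ _ (fun x : R => x `^ (- tau)) _ g _ mg); exact: measurable_powR.
pose S (m : nat) := (A `&` [set z | dyad m 0 < f z]) `&` (A `&` [set z | f z <= dyad m (m + m)]).
have mS m : measurable (S m) by apply: measurableI; [exact: mE|exact: mE'].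
have SA m : S m `<=` A by move=> z [[]].
pose b : R := 2 `^ tau; pose C := 2 `^ s * K * (b / (b - 1) * 4 `^ tau).
have C0 : 0 <= C.
  have b1 : 1 < b by have := gt0_ltr_powR tau0 (x := 1) (y := 2); rewrite powR1 !nnegrE; apply => //; rewrite ltr1n.
  by rewrite !mulr_ge0 ?powR_ge0// invr_ge0 subr_ge0 ltW.
(* a bound on S m that does not depend on m suffices, as S m increases to A *)
suff bnd m : (\int[mu2 R]_(z in S m) (f z `^ s)%:E <=
    C%:E * \int[mu2 R]_(w in D) (g w `^ (- tau))%:E)%E.
  have US : \bigcup_m S m = A.
    apply/seteqP; split => [z [m _ [[]]]//|z Az].
    have fz := f0 z Az.
    pose m := (Num.truncn (f z) + Num.truncn (f z)^-1).+1.
    have m2 : m%:R < 2 ^+ m :> R by rewrite -natrX ltr_nat ltn_expl.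
    have p2 : 0 < 2 ^+ m :> R by rewrite exprn_gt0.
    exists m => //; split; split => //=.
      rewrite /dyad expr0 div1r invf_plt ?posrE//.
      apply: lt_trans m2; apply: (lt_le_trans (truncnS_gt _)).
      by rewrite ler_nat ltnS leq_addl.
    rewrite /dyad exprD mulfK ?gt_eqF//; apply: ltW; apply: lt_trans m2.
    by apply: (lt_le_trans (truncnS_gt _)); rewrite ler_nat ltnS leq_addr.
  have cv : (\int[mu2 R]_(z in S m) (f z `^ s)%:E @[m --> \oo] -->
      \int[mu2 R]_(z in \bigcup_m S m) (f z `^ s)%:E)%E.
    apply: ge0_nondecreasing_set_cvg_integral => //.
    - apply/nondecreasing_seqP => m; apply/subsetPset => z [[Az h1] [_ h2]].
      have E : dyad m.+1 0 = dyad m 0 / 2 by rewrite /dyad exprSr invfM mulrA.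
      have E2 : dyad m.+1 (m.+1 + m.+1) = 2 * dyad m (m + m).
        rewrite (_ : (m.+1 + m.+1 = (m + m).+2)%N) ?addSn ?addnS// !dyadS /dyad (exprS (2 : R) m).
        set x := 2 ^+ (m + m); set y := 2 ^+ m.
        by field; rewrite /y expf_neq0.
      have p0 := dyad_gt0 m 0; have p1 := dyad_gt0 m (m + m).
      split; split => //=; first by rewrite E; move: h1 => /=; lra.
      by rewrite E2; move: h2 => /=; lra.
    - by move=> m; exact: measurable_funS mfs.
    - by move=> m z _; rewrite lee_fin powR_ge0.
  rewrite US in cv; apply: (@le_lt_trans _ _ (C%:E * \int[mu2 R]_(w in D) (g w `^ (- tau))%:E)%E).
    by apply: (cvge_to_le cv); exists 0.
  by apply: lte_mul_pinfty => //; rewrite ?lee_fin.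
pose t n := dyad m n; have t0 n : 0 < t n by exact: dyad_gt0.
pose E n := A `&` [set z | t n < f z]; pose F n := D `&` [set w | g w <= 4 / t n].
pose N := (m + m)%N.
apply: (@le_trans _ _ (\int[mu2 R]_(z in S m)
    (\sum_(n < N) (2 `^ s * t n `^ s) * \1_(E n) z)%:E)%E).
  apply: ge0_le_integral; [exact: mS|..].
  - by move=> z _; rewrite lee_fin powR_ge0.
  - exact: (measurable_funS mA (SA m) mfs).
  - apply/measurable_EFinP; apply: measurable_sum => n.
    by apply: measurable_funM; [exact: measurable_cst|apply: measurable_indic; exact: mE].
  - move=> z [[Az h1] [_ h2]]; rewrite lee_fin.
    have [n /andP[n1 n2]] := dyad_bracket h1 h2.
    rewrite (bigD1 n)//= [\1_(E n) z](_ : _ = 1); last by rewrite indicE mem_set.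
    rewrite mulr1 -powRM ?(ltW (t0 n))//; apply: (@le_trans _ _ ((2 * t n) `^ s)).
      by apply: ge0_ler_powR; rewrite ?nnegrE ?mulr_ge0// ltW// f0.
    by rewrite lerDl sumr_ge0// => i _; rewrite mulr_ge0// mulr_ge0// powR_ge0.
rewrite (@integral_steps _ _ (fun n => 2 `^ s * t n `^ s) E)//; last 2 first.
- by move=> n; exact: mE.
- by move=> n; rewrite mulr_ge0// powR_ge0.
apply: (@le_trans _ _ (\sum_(n < N) (2 `^ s * K * t n `^ tau)%:E * mu2 R (F n `&` D))%E).
  apply: lee_sum => n _.
  have -> : F n `&` D = F n by apply: setIidl; exact: subIsetl.
  have -> : (2 `^ s * K * t n `^ tau)%:E = ((2 `^ s * t n `^ s)%:E * (K / t n ^+ 2)%:E)%E.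
    rewrite -EFinM /s (@powRD _ (t n)); last by rewrite gt_eqF ?t0// implybT.
    rewrite (_ : t n `^ 2 = t n ^+ 2) ?powR_mulrn// ?ltW//; congr EFin; field.
    by rewrite gt_eqF.
  rewrite -muleA; apply: lee_wpmul2l; first by rewrite lee_fin mulr_ge0 ?powR_ge0.
  apply: le_trans (lev (t n) (t0 n)).
  by apply: le_measure; rewrite ?inE; [apply: measurableI; [exact: mE|exact: mS]|exact: mE|exact: subIsetl].
have step := @integral_steps D N (fun n => 2 `^ s * K * t n `^ tau) F mD (fun n => mF _).
rewrite -step; last by move=> n; rewrite !mulr_ge0 ?powR_ge0.
rewrite -ge0_integralZl_EFin//; last by move=> w _; rewrite lee_fin powR_ge0.
apply: ge0_le_integral; [exact: mD|..].
- by move=> w _; rewrite lee_fin sumr_ge0// => i _; rewrite mulr_ge0// !mulr_ge0 ?powR_ge0.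
- apply/measurable_EFinP; apply: measurable_sum => n.
  by apply: measurable_funM; [exact: measurable_cst|apply: measurable_indic; exact: mF].
- by apply: emeasurable_funM => //; exact: measurable_cst.
move=> w Dw; rewrite -EFinM lee_fin.
have gw := g0 w Dw.
rewrite (eq_bigr (fun n : 'I_N => 2 `^ s * K * (t n `^ tau * (g w <= 4 / t n)%R%:R))); last first.
  move=> n _; rewrite mulrA indicE; congr (_ * (nat_of_bool _)%:R).
  by apply/idP/idP; rewrite inE /F/=; [case|split].
rewrite -mulr_sumr /C -[leRHS]mulrA; apply: ler_wpM2l; first by rewrite mulr_ge0 ?powR_ge0.
have -> : b / (b - 1) * 4 `^ tau * g w `^ (- tau) = b / (b - 1) * (4 / g w) `^ tau.
  by rewrite powRM ?invr_ge0 ?(ltW gw)// -(powR_inv1 (ltW gw)) -powRrM mulN1r mulrA.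
apply: (@geometric_sum_le m tau N (fun n => (g w <= 4 / t n)%R)) => //; first exact: powR_ge0.
move=> n hn; apply: ge0_ler_powR; rewrite ?nnegrE ?divr_ge0 ?(ltW gw) ?(ltW tau0) ?(ltW (t0 n))//.
by rewrite ler_pdivlMr// mulrC -ler_pdivlMr.
Qed.

End level_sums.

(** Since phi' = 1/psi' at corresponding points, the level sets |phi'| > t are those
    |psi'| < 1/t, to which [distortion] applies. *)
Lemma jacobian_pow_integrable (R : realType) (Omega : set (R * R)) (phi : R * R -> R * R)
    (alpha0 s : R) : domain Omega -> simply_connected Omega -> boundary Omega !=set0 ->
  inverse_brennan alpha0 -> conformal_homeomorphism Omega (unit_disc R) phi ->
  1 < s -> alpha0 <= 2 - 2 * s ->
  (\int[mu2 R]_(z in Omega) (jacobian_det phi z `^ s)%:E < +oo)%E.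
Proof.
move=> dOm scOm bOm brennan cphi s1 as0.
have [oOm _ _] := dOm; have mOm := open_measurable_plane oOm.
have oD : open (unit_disc R) by exact: open_unit_disc.
have mD := open_measurable_plane oD.
have [psi [cpsi K K' dE]] := conformal_inverse oD cphi.
have [_ phic _ dphi dphi0] := cphi; have [_ psic _ dpsi dpsi0] := cpsi.
have phiD z : Omega z -> unit_disc R (phi z) by case: cphi => -[h _ _ _ _ _ _]; exact: h.
have dinv z : Omega z -> modulus (cderiv phi z) = (modulus (cderiv psi (phi z)))^-1.
  by move=> Oz; rewrite dE; [rewrite K// modulusV invrK|exact: phiD].
have -> : (\int[mu2 R]_(z in Omega) (jacobian_det phi z `^ s)%:E =
    \int[mu2 R]_(z in Omega) (modulus (cderiv phi z) `^ ((2 * s - 2) + 2))%:E)%E.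
  apply: eq_integral => z; rewrite inE => Oz; rewrite jacobian_detE; last exact: dphi.
  by rewrite powR_norm_sqr subrK ger0_norm ?modulus_ge0.
apply: (@level_sum R Omega (unit_disc R) _ (fun w => modulus (cderiv psi w)) _ 16) => //.
- exact: measurable_modulus_cderiv.
- exact: measurable_modulus_cderiv.
- by move=> z Oz; apply: modulus_gt0; exact: dphi0.
- by move=> w Dw; apply: modulus_gt0; exact: dpsi0.
- lra.
- move=> t t0; have ti0 : 0 < t^-1 by rewrite invr_gt0.
  have inv z : Omega z ->
      (modulus (cderiv psi (phi z)) < t^-1) = (t < modulus (cderiv phi z)).
    move=> Oz; have m0 : 0 < modulus (cderiv psi (phi z)).
      by apply: modulus_gt0; apply: dpsi0; exact: phiD.
    have swap (m m' : R) : 0 < m -> m' = m^-1 -> (m < t^-1) = (t < m').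
      by move=> ? ->; exact: invf_pgt.
    exact: swap m0 (dinv z Oz).
  have sets : Omega `&` [set z | modulus (cderiv psi (phi z)) < t^-1] =
      Omega `&` [set z | t < modulus (cderiv phi z)].
    apply/seteqP; split => z [Oz hz]; (split; first exact: Oz).
      by rewrite /mkset -(inv z Oz).
    by rewrite /mkset (inv z Oz).
  have := distortion oOm ti0 phic psic (fun z Oz => conj (phiD z Oz) (K z Oz)) dpsi.
  by rewrite exprVn sets.
- have -> : - (2 * s - 2) = 2 - 2 * s by ring.
  by apply: (brennan Omega psi) => //; apply/andP; split => //; lra.
Qed.

Theorem theorem4p8 (R : realType) (Omega : set (R * R)) (alpha0 p : R)
    (phi : R * R -> R * R) :
  domain Omega -> simply_connected Omega -> boundary Omega !=set0 ->
  -2 < alpha0 < 0 ->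
  inverse_brennan alpha0 ->
  (`|alpha0| + 2) / (`|alpha0| + 1) < p < 2 ->
  conformal_homeomorphism Omega (unit_disc R) phi ->
  let h := jacobian_det phi in
  forall r : R,
    1 <= r ->
    r < 2 * p / (2 - p) * (`|alpha0| / (2 + `|alpha0|)) < p / (2 - p) ->
    compact_operator (W1_0 p Omega) (weighted_L r Omega h) (fun f => f).
Proof.
move=> dOm scOm bOm /andP[_ a0] brennan /andP[pa p2] cphi h r r1 /andP[rq _].
have [oOm _ _] := dOm; have [_ phic _ dphi _] := cphi.
rewrite ltr0_norm// in pa rq.
have p1 : 1 < p.
  by apply: lt_trans pa; rewrite ltr_pdivlMr; lra.
set q := 2 * p / (2 - p) in rq.
have q0 : 0 < q by rewrite /q divr_gt0; lra.
have rqa : r * (2 - alpha0) < q * (- alpha0).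
  by move: rq; rewrite mulrA ltr_pdivlMr; lra.
have rq1 : r < q by nra.
have qr0 : 0 < q - r by rewrite subr_gt0.
pose s := q / (q - r).
have s1 : 1 < s by rewrite /s ltr_pdivlMr; lra.
have sE : s * (q - r) = q by rewrite /s divfK// gt_eqF.
(* after multiplication by q - r this is the hypothesis on r *)
have as0 : alpha0 <= 2 - 2 * s.
  by rewrite -(ler_pM2r qr0) mulrBl -mulrA sE; lra.
have hE z : Omega z -> h z = modulus (cderiv phi z) ^+ 2.
  by move=> Oz; exact: jacobian_detE (dphi z Oz).
apply: (compact_embedding (s := s) oOm _ r1 rq1) => //; first by rewrite p1.
- apply: (eq_measurable_fun (fun z => modulus (cderiv phi z) ^+ 2)).
    by move=> z; rewrite inE => Oz; rewrite hE.
  by apply: measurable_funX; exact: measurable_modulus_cderiv.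
- by move=> z Oz; rewrite hE// sqr_ge0.
- exact: jacobian_pow_integrable dOm scOm bOm brennan cphi s1 as0.
Qed.
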